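(* Let $\hat{\mathcal{Y}}$, $\hat{\mathcal{D}}$ and $\hat{\mathcal{X}}$ be compactly generated algebraic triangulated categories and let $(\hat{\mathcal{Y}}^b_{fl}\equiv\hat{\mathcal{D}}^b_{fl}\equiv\hat{\mathcal{X}}^b_{fl})$ be a recollement, with functors $i^*,i_*,i^!,j_!,j^*,j_*$, such that the subcategories involved contain the respective subcategories of compact objects and $\hat{\mathcal{D}}$ is compact-detectable in finite length. Let $T_X\in\hat{\mathcal{X}}^c$ and $T_Y\in\hat{\mathcal{Y}}^c$ be classical silting objects in $\hat{\mathcal{X}}^c$ and $\hat{\mathcal{Y}}^c$, respectively, and let $(\mathcal{X}^{\leq0},\mathcal{X}^{\geq0})$ and $(\mathcal{Y}^{\leq0},\mathcal{Y}^{\geq0})$ be the corresponding t-structures (generated by $T_X$ and $T_Y$) in $\hat{\mathcal{X}}^b_{fl}$ and $\hat{\mathcal{Y}}^b_{fl}$. There is a triangle $\tilde{T}_Y\longrightarrow i_*(T_Y)\longrightarrow U_{T_Y}[1]\stackrel{+}{\longrightarrow}$ in $\hat{\mathcal{D}}^c$ such that $U_{T_Y}\in\mathrm{susp}_{\hat{\mathcal{D}}}(j_!(T_X))$ and $\tilde{T}_Y\in{}^\perp(j_!(\mathcal{X}^{\leq0})[1])$. In particular $T:=j_!(T_X)\oplus\tilde{T}_Y$ is a silting object in $\hat{\mathcal{D}}^c$, uniquely determined up to add-equivalence, which generates the glued t-structure in $\hat{\mathcal{D}}^b_{fl}$.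
   Context: Conventions: $K$ is a commutative ring; all categories and functors are $K$-linear; triangulated categories have split idempotents; subcategories are full and closed under isomorphisms; coproducts are set-indexed. A triangulated category is algebraic if it is triangle equivalent to the stable category of a Frobenius exact category. An object $X$ of a triangulated category with coproducts is compact if $\mathrm{Hom}(X,-)$ commutes with coproducts; $\mathcal{E}^c$ denotes the subcategory of compact objects. $\mathcal{E}$ is compactly generated if it has coproducts and a set $\mathcal{S}$ of compact objects such that $\mathrm{Hom}(S,M[k])=0$ for all $S\in\mathcal S$, $k\in\mathbb{Z}$ implies $M=0$. For compactly generated $\mathcal{E}$, $\mathcal{E}^b_{fl}$ is the thick subcategory of objects $M$ such that for each $X\in\mathcal{E}^c$ the $K$-module $\mathrm{Hom}(X,M[k])$ has finite length for all $k$ and is zero for $|k|\gg0$. $\mathcal{E}$ is compact-detectable in finite length when $\mathcal{E}^c$ consists precisely of the objects $X\in\mathcal{E}^b_{fl}$ such that, for each $E\in\mathcal{E}^b_{fl}$, $\mathrm{Hom}_\mathcal{E}(X,E[k])=0$ for $k\gg0$. $\mathrm{susp}(\mathcal{S})$ is the smallest subcategory containing $\mathcal{S}$ closed under extensions, direct summands and $[1]$; $\mathrm{add}(T)$ consists of direct summands of finite coproducts of copies of $T$; $T,T'$ are add-equivalent if $\mathrm{add}(T)=\mathrm{add}(T')$. A (classical) silting object in a triangulated category $\mathcal{E}$ is an object $T$ with $\mathrm{Hom}(T,T[i])=0$ for $i>0$ and such that the smallest thick subcategory of $\mathcal{E}$ containing $T$ is $\mathcal{E}$. Recollement $(\mathcal{Y}\equiv\mathcal{D}\equiv\mathcal{X})$: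 triangulated functors $i_*:\mathcal{Y}\to\mathcal{D}$, $i^*,i^!:\mathcal{D}\to\mathcal{Y}$, $j^*:\mathcal{D}\to\mathcal{X}$, $j_!,j_*:\mathcal{X}\to\mathcal{D}$ such that $(i^*,i_* )$, $(i_*,i^!)$, $(j_!,j^* )$, $(j^*,j_* )$ are adjoint pairs; $i_*,j_*,j_!$ are fully faithful; $i^!j_*=0$; and for each $Z\in\mathcal{D}$ units and counits give triangles $i_*i^!Z\to Z\to j_*j^*Z\stackrel{+}{\to}$ and $j_!j^*Z\to Z\to i_*i^*Z\stackrel{+}{\to}$. A t-structure in $\mathcal{D}$ is a pair $(\mathcal{D}^{\leq0},\mathcal{D}^{\geq0})$ of subcategories closed under summands with $\mathcal{D}^{\leq0}[1]\subseteq\mathcal{D}^{\leq0}$, $\mathrm{Hom}(\mathcal{D}^{\leq0},\mathcal{D}^{\geq0}[-1])=0$ and each $M$ in a triangle $U\to M\to V\stackrel{+}{\to}$ with $U\in\mathcal{D}^{\leq0}$, $V\in\mathcal{D}^{\geq0}[-1]$. The t-structure generated by a set $\mathcal{S}$ in $\mathcal{D}$ is $({}^\perp(\mathcal{S}^{\perp_{\leq0}}),\mathcal{S}^{\perp_{<0}})$ (orthogonals in $\mathcal{D}$), where ${}^\perp\mathcal{S}=\{X:\mathrm{Hom}(X,S)=0\ \forall S\in\mathcal S\}$ and $\mathcal{S}^{\perp_{\leq0}}$ (resp. $\mathcal{S}^{\perp_{<0}}$) is the class of $X$ with $\mathrm{Hom}(S,X[k])=0$ for all $S\in\mathcal{S}$,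 $k\leq0$ (resp. $k<0$). The glued t-structure is $\mathcal{D}^{\leq0}=\{Z: j^*Z\in\mathcal{X}^{\leq0},\ i^*Z\in\mathcal{Y}^{\leq0}\}$, $\mathcal{D}^{\geq0}=\{Z: j^*Z\in\mathcal{X}^{\geq0},\ i^!Z\in\mathcal{Y}^{\geq0}\}$. *)

(* Defs.v *)
From HB Require Import structures.
From mathcomp Require Import all_boot all_order all_algebra.
From mathcomp Require Import boolp zify.

Set Implicit Arguments.
Unset Strict Implicit.
Unset Printing Implicit Defensive.

Import Order.TTheory GRing.Theory Num.Theory.
Local Open Scope ring_scope.

Declare Scope lincat_scope.
Delimit Scope lincat_scope with cat.
Local Open Scope lincat_scope.

Section FiniteLength.
Variables (K : comPzRingType) (M : lmodType K).

Definition simple_step (N N' : {pred M}) :=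
  [/\ {subset N <= N'}, ~ {subset N' <= N} &
      forall P : {pred M}, submod_closed P ->
        {subset N <= P} -> {subset P <= N'} ->
        {subset P <= N} \/ {subset N' <= P}].

(* Existence of a composition series. *)
Definition finite_length :=
  exists (n : nat) (N : nat -> {pred M}),
    [/\ forall i, submod_closed (N i),
        forall x, x \in N 0%N -> x = 0,
        forall x, x \in N n &
        forall i, (i < n)%N -> simple_step (N i) (N i.+1)].

End FiniteLength.

Section ModuleQuotient.
Variables (K : comPzRingType) (V : lmodType K) (S : {pred V}).
Hypothesis hS : submod_closed S.

Let S0 : 0 \in S. Proof. exact: hS.1. Qed.
Let SD x y : x \in S -> y \in S -> x + y \in S.
Proof. by move=> Sx Sy; rewrite -[x]scale1r hS.2. Qed.
Let SZ a x : x \in S -> a *: x \in S.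
Proof. by move=> Sx; rewrite -[_ *: _]addr0 hS.2. Qed.
Let SN x : x \in S -> - x \in S.
Proof. by move=> Sx; rewrite -scaleN1r SZ. Qed.

Definition modq_rel (x y : V) := x - y \in S.

Lemma modq_equiv : equiv_class_of modq_rel.
Proof.
split=> [x|x y|y x z]; rewrite /modq_rel; first by rewrite subrr.
  by apply/idP/idP => /SN; rewrite opprB.
by move=> xy yz; rewrite -(subrK y x) -addrA SD.
Qed.

Definition modq_equivRel := EquivRelPack modq_equiv.
Definition modq := {eq_quot modq_equivRel}%qT.

HB.instance Definition _ := Choice.on modq.

Definition modq_pi (x : V) : modq := (\pi_modq x)%qT.
Definition modq_repr (x : modq) : V := repr x.

Lemma modq_reprK x : modq_pi (modq_repr x) = x.
Proof. exact: reprK. Qed.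

Lemma modq_piP x y : modq_pi x = modq_pi y <-> x - y \in S.
Proof.
by split=> [/eqmodP|xy]; [|apply/eqmodP].
Qed.

Let piP x y : x - y \in S -> modq_pi x = modq_pi y.
Proof. by move/modq_piP. Qed.
Let reprP x : modq_repr (modq_pi x) - x \in S.
Proof. by apply/modq_piP; rewrite modq_reprK. Qed.

Definition modq_add x y := modq_pi (modq_repr x + modq_repr y).
Definition modq_opp x := modq_pi (- modq_repr x).
Definition modq_scale a x := modq_pi (a *: modq_repr x).

Lemma modq_piD x y : modq_add (modq_pi x) (modq_pi y) = modq_pi (x + y).
Proof. by apply: piP; rewrite opprD addrACA SD ?reprP. Qed.
Lemma modq_piN x : modq_opp (modq_pi x) = modq_pi (- x).
Proof. by apply: piP; rewrite -opprD SN ?reprP. Qed.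
Lemma modq_piZ a x : modq_scale a (modq_pi x) = modq_pi (a *: x).
Proof. by apply: piP; rewrite -scalerBr SZ ?reprP. Qed.

Let piS (x : modq) : exists y, x = modq_pi y.
Proof. by exists (modq_repr x); rewrite modq_reprK. Qed.

Fact modq_addA : associative modq_add.
Proof.
move=> x y z; have [[x' ->] [y' ->] [z' ->]] := And3 (piS x) (piS y) (piS z).
by rewrite !modq_piD addrA.
Qed.
Fact modq_addC : commutative modq_add.
Proof.
by move=> x y; have [[x' ->] [y' ->]] := conj (piS x) (piS y);
  rewrite !modq_piD addrC.
Qed.
Fact modq_add0 : left_id (modq_pi 0) modq_add.
Proof. by move=> x; have [x' ->] := piS x; rewrite modq_piD add0r. Qed.
Fact modq_addN : left_inverse (modq_pi 0) modq_opp modq_add.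
Proof. by move=> x; have [x' ->] := piS x; rewrite modq_piN modq_piD addNr. Qed.

HB.instance Definition _ :=
  GRing.isZmodule.Build modq modq_addA modq_addC modq_add0 modq_addN.

Fact modq_scaleA a b x : modq_scale a (modq_scale b x) = modq_scale (a * b) x.
Proof. by have [x' ->] := piS x; rewrite !modq_piZ scalerA. Qed.
Fact modq_scale1 : left_id 1 modq_scale.
Proof. by move=> x; have [x' ->] := piS x; rewrite modq_piZ scale1r. Qed.
Fact modq_scaleDr : right_distributive modq_scale modq_add.
Proof.
move=> a x y; have [[x' ->] [y' ->]] := conj (piS x) (piS y).
by rewrite !(modq_piD, modq_piZ) scalerDr.
Qed.
Fact modq_scaleDl x a b :
  modq_scale (a + b) x = modq_add (modq_scale a x) (modq_scale b x).
Proof. by have [x' ->] := piS x; rewrite !(modq_piD, modq_piZ) scalerDl. Qed.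

HB.instance Definition _ := GRing.Zmodule_isLmodule.Build K modq
  modq_scaleA modq_scale1 modq_scaleDr modq_scaleDl.

Lemma modq_pi_linear a x y :
  modq_pi (a *: x + y) = a *: modq_pi x + modq_pi y.
Proof. by rewrite -modq_piD -modq_piZ. Qed.

End ModuleQuotient.

(* Hom-modules live in the universe of [lmodType], the one of the index types
   [I : choiceType] of coproducts below ("sets"); objects may be larger. *)
Record lincat (K : comPzRingType) := LinCat {
  ob :> Type;
  mor : ob -> ob -> lmodType K;
  idm : forall X, mor X X;
  compm : forall X Y Z, mor Y Z -> mor X Y -> mor X Z;
  compmA : forall X Y Z W (h : mor Z W) (g : mor Y Z) (f : mor X Y),
    compm h (compm g f) = compm (compm h g) f;
  comp1m : forall X Y (f : mor X Y), compm (idm Y) f = f;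
  compm1 : forall X Y (f : mor X Y), compm f (idm X) = f;
  comp_linearl : forall X Y Z (f : mor X Y) a (g g' : mor Y Z),
    compm (a *: g + g') f = a *: compm g f + compm g' f;
  comp_linearr : forall X Y Z (g : mor Y Z) a (f f' : mor X Y),
    compm g (a *: f + f') = a *: compm g f + compm g f' }.

Arguments mor {K C} X Y : rename.
Arguments idm {K C} X : rename.
Arguments compm {K C X Y Z} g f : rename.
Notation "g '\c' f" := (compm g f)
  (at level 40, left associativity) : lincat_scope.

Section LinCatNotions.
Variables (K : comPzRingType) (C : lincat K).
Implicit Types X Y Z : C.

Definition is_iso X Y (f : mor X Y) :=
  exists g : mor Y X, g \c f = idm X /\ f \c g = idm Y.
Definition isomorphic X Y := exists f : mor X Y, is_iso f.

Definition is_zero X := idm X = 0.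

Definition is_biproduct X Y Z :=
  exists (i1 : mor Y X) (i2 : mor Z X) (p1 : mor X Y) (p2 : mor X Z),
    [/\ p1 \c i1 = idm Y, p2 \c i2 = idm Z, p1 \c i2 = 0, p2 \c i1 = 0 &
        i1 \c p1 + i2 \c p2 = idm X].

Definition is_summand Y X := exists Z, is_biproduct X Y Z.

Definition additive_cat :=
  (exists Z, is_zero Z) /\ (forall Y Z, exists X, is_biproduct X Y Z).

Definition split_idempotents :=
  forall X (e : mor X X), e \c e = e ->
  exists Y (p : mor X Y) (i : mor Y X), p \c i = idm Y /\ i \c p = e.

Definition is_coproduct (I : choiceType) (M : I -> C) X
    (inj : forall i, mor (M i) X) :=
  forall Y (f : forall i, mor (M i) Y),
  exists! g : mor X Y, forall i, g \c inj i = f i.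

Definition has_coproducts :=
  forall (I : choiceType) (M : I -> C),
  exists X (inj : forall i, mor (M i) X), is_coproduct inj.

(* The canonical map from the direct sum of the Hom(X, M i), an element of
   which is given by a family [g] restricted to a finite set [s] of indices, to
   Hom(X, Y) is onto and one-to-one. *)
Definition compact_ob X :=
  forall (I : choiceType) (M : I -> C) Y (inj : forall i, mor (M i) Y),
    is_coproduct inj ->
    (forall f : mor X Y, exists (s : seq I) (g : forall i, mor X (M i)),
       uniq s /\ f = \sum_(i <- s) inj i \c g i) /\
    (forall (s : seq I) (g : forall i, mor X (M i)),
       uniq s -> \sum_(i <- s) inj i \c g i = 0 ->
       forall i, i \in s -> g i = 0).

Definition in_add (T X : C) :=
  exists (n : nat) (Y : C) (inj : 'I_n -> mor T Y),
    is_coproduct inj /\ is_summand X Y.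
Definition add_equiv (T T' : C) := forall X, in_add T X <-> in_add T' X.

End LinCatNotions.

Section LinCatTheory.
Variables (K : comPzRingType) (C : lincat K).
Implicit Types X Y Z : C.

Lemma compDl X Y Z (g g' : mor Y Z) (f : mor X Y) :
  (g + g') \c f = g \c f + g' \c f.
Proof. by have := comp_linearl f 1 g g'; rewrite !scale1r. Qed.
Lemma compDr X Y Z (g : mor Y Z) (f f' : mor X Y) :
  g \c (f + f') = g \c f + g \c f'.
Proof. by have := comp_linearr g 1 f f'; rewrite !scale1r. Qed.
Lemma comp0m X Y Z (f : mor X Y) : (0 : mor Y Z) \c f = 0.
Proof. by apply: (addrI (0 \c f)); rewrite -compDl !addr0. Qed.
Lemma compm0 X Y Z (g : mor Y Z) : g \c (0 : mor X Y) = 0.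
Proof. by apply: (addrI (g \c 0)); rewrite -compDr !addr0. Qed.
Lemma compZl X Y Z a (g : mor Y Z) (f : mor X Y) :
  (a *: g) \c f = a *: (g \c f).
Proof. by have := comp_linearl f a g 0; rewrite comp0m !addr0. Qed.
Lemma compZr X Y Z a (g : mor Y Z) (f : mor X Y) :
  g \c (a *: f) = a *: (g \c f).
Proof. by have := comp_linearr g a f 0; rewrite compm0 !addr0. Qed.
Lemma compNl X Y Z (g : mor Y Z) (f : mor X Y) : (- g) \c f = - (g \c f).
Proof. by rewrite -scaleN1r compZl scaleN1r. Qed.
Lemma compNr X Y Z (g : mor Y Z) (f : mor X Y) : g \c (- f) = - (g \c f).
Proof. by rewrite -scaleN1r compZr scaleN1r. Qed.
Lemma compBl X Y Z (g g' : mor Y Z) (f : mor X Y) :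
  (g - g') \c f = g \c f - g' \c f.
Proof. by rewrite compDl compNl. Qed.
Lemma compBr X Y Z (g : mor Y Z) (f f' : mor X Y) :
  g \c (f - f') = g \c f - g \c f'.
Proof. by rewrite compDr compNr. Qed.
Lemma comp_sumr X Y Z (g : mor Y Z) I (s : seq I) (f : I -> mor X Y) :
  g \c (\sum_(i <- s) f i) = \sum_(i <- s) g \c f i.
Proof.
by elim/big_rec2: _ => [|i x y _ <-]; rewrite ?compm0 // compDr.
Qed.
Lemma comp_suml X Y Z (f : mor X Y) I (s : seq I) (g : I -> mor Y Z) :
  (\sum_(i <- s) g i) \c f = \sum_(i <- s) g i \c f.
Proof.
by elim/big_rec2: _ => [|i x y _ <-]; rewrite ?comp0m // compDl.
Qed.

Lemma iso_refl X : isomorphic X X.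
Proof. by exists (idm X), (idm X); rewrite comp1m. Qed.
Lemma iso_trans X Y Z : isomorphic X Y -> isomorphic Y Z -> isomorphic X Z.
Proof.
move=> [f [f' [f'f ff']]] [g [g' [g'g gg']]].
exists (g \c f), (f' \c g'); split.
  by rewrite compmA -(compmA f') g'g compm1.
by rewrite compmA -(compmA g) ff' compm1.
Qed.
Lemma iso_sym X Y : isomorphic X Y -> isomorphic Y X.
Proof. by move=> [f [g [gf fg]]]; exists g, f. Qed.

End LinCatTheory.

Record functor (K : comPzRingType) (C D : lincat K) := Functor {
  fob :> C -> D;
  fmap : forall X Y, mor X Y -> mor (fob X) (fob Y);
  fmap_linear : forall X Y a (f g : mor X Y),
    fmap (a *: f + g) = a *: fmap f + fmap g;
  fmap1 : forall X, fmap (idm X) = idm (fob X);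
  fmapM : forall X Y Z (g : mor Y Z) (f : mor X Y),
    fmap (g \c f) = fmap g \c fmap f }.
Arguments fmap {K C D} F {X Y} f : rename.

Section Functors.
Variable K : comPzRingType.

Definition fid (C : lincat K) : functor C C :=
  @Functor K C C (fun X => X) (fun _ _ f => f) (fun _ _ _ _ _ => erefl)
    (fun _ => erefl) (fun _ _ _ _ _ => erefl).

Section Composition.
Variables (C D E : lincat K) (G : functor D E) (F : functor C D).

Definition fcomp_map X Y (f : mor X Y) : mor (G (F X)) (G (F Y)) :=
  fmap G (fmap F f).
Fact fcomp_linear X Y a (f g : mor X Y) :
  fcomp_map (a *: f + g) = a *: fcomp_map f + fcomp_map g.
Proof. by rewrite /fcomp_map !fmap_linear. Qed.
Fact fcomp1 X : fcomp_map (idm X) = idm (G (F X)).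
Proof. by rewrite /fcomp_map !fmap1. Qed.
Fact fcompM X Y Z (g : mor Y Z) (f : mor X Y) :
  fcomp_map (g \c f) = fcomp_map g \c fcomp_map f.
Proof. by rewrite /fcomp_map !fmapM. Qed.

Definition fcomp : functor C E :=
  @Functor K C E (fun X => G (F X)) fcomp_map fcomp_linear fcomp1 fcompM.
End Composition.

Definition fully_faithful (C D : lincat K) (F : functor C D) :=
  forall X Y (g : mor (F X) (F Y)), exists! f : mor X Y, fmap F f = g.

Definition essentially_surjective (C D : lincat K) (F : functor C D) :=
  forall Y : D, exists X : C, isomorphic (F X) Y.

Record natiso (C D : lincat K) (F G : functor C D) := NatIso {
  nto : forall X, mor (F X) (G X);
  nfrom : forall X, mor (G X) (F X);
  ntoK : forall X, nfrom X \c nto X = idm (F X);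
  nfromK : forall X, nto X \c nfrom X = idm (G X);
  nto_nat : forall X Y (f : mor X Y), nto Y \c fmap F f = fmap G f \c nto X }.

Record adjunction (C D : lincat K) (L : functor C D) (R : functor D C) :=
  Adjunction {
  adj_unit : forall X, mor X (R (L X));
  adj_counit : forall Y, mor (L (R Y)) Y;
  unit_nat : forall X Y (f : mor X Y),
    adj_unit Y \c f = fmap R (fmap L f) \c adj_unit X;
  counit_nat : forall X Y (f : mor X Y),
    adj_counit Y \c fmap L (fmap R f) = f \c adj_counit X;
  adj_unitK : forall X, adj_counit (L X) \c fmap L (adj_unit X) = idm (L X);
  adj_counitK : forall Y, fmap R (adj_counit Y) \c adj_unit (R Y) = idm (R Y) }.

End Functors.
Arguments nto {K C D F G} n X : rename.
Arguments nfrom {K C D F G} n X : rename.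
Arguments adj_unit {K C D L R} a X : rename.
Arguments adj_counit {K C D L R} a Y : rename.

Section FunctorTheory.
Variable K : comPzRingType.

Lemma nfrom_nat (C D : lincat K) (F G : functor C D) (n : natiso F G)
    (X Y : C) (f : mor X Y) : nfrom n Y \c fmap G f = fmap F f \c nfrom n X.
Proof.
rewrite -[LHS]compm1 -(nfromK n) -compmA (compmA (fmap G f)) -nto_nat.
by rewrite !compmA ntoK comp1m.
Qed.

Definition natiso_sym (C D : lincat K) (F G : functor C D) (n : natiso F G) :
    natiso G F :=
  @NatIso K C D G F (nfrom n) (nto n) (nfromK n) (ntoK n) (@nfrom_nat _ _ _ _ n).

Variables (C D : lincat K) (F : functor C D).

Lemma fmapD X Y (f g : mor X Y) : fmap F (f + g) = fmap F f + fmap F g.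
Proof. by have := fmap_linear F 1 f g; rewrite !scale1r. Qed.
Lemma fmap0 X Y : fmap F (0 : mor X Y) = 0.
Proof. by apply: (addrI (fmap F 0)); rewrite -fmapD !addr0. Qed.
Lemma fmap_sum X Y I (s : seq I) (f : I -> mor X Y) :
  fmap F (\sum_(i <- s) f i) = \sum_(i <- s) fmap F (f i).
Proof. by elim/big_rec2: _ => [|i x y _ <-]; rewrite ?fmap0 // fmapD. Qed.
Lemma fmap_iso X Y : isomorphic X Y -> isomorphic (F X) (F Y).
Proof.
move=> [f [g [gf fg]]]; exists (fmap F f), (fmap F g).
by rewrite -!fmapM gf fg !fmap1.
Qed.

End FunctorTheory.

(* A category with a suspension and a class of triangles; the axioms of
   triangulated categories are stated separately. *)
Record suspcat (K : comPzRingType) := SuspCat {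
  sc_cat :> lincat K;
  susp : functor sc_cat sc_cat;
  dist : forall X Y Z : sc_cat,
    mor X Y -> mor Y Z -> mor Z (susp X) -> Prop }.
Arguments susp {K s}.
Arguments dist {K s X Y Z} f g h.

(* The suspension is an equivalence, with a chosen quasi-inverse; it need not
   be an automorphism. *)
Record pretri (K : comPzRingType) := PreTri {
  pt_susp :> suspcat K;
  desusp : functor pt_susp pt_susp;
  suspK : natiso (fcomp desusp susp) (fid pt_susp);
  desuspK : natiso (fcomp susp desusp) (fid pt_susp) }.
Arguments desusp {K p}.
Arguments suspK {K p}.
Arguments desuspK {K p}.

Definition tshift (K : comPzRingType) (D : pretri K) (M : D) (k : int) : D :=
  match k with
  | Posz n => iter n susp M
  | Negz n => iter n.+1 desusp M
  end.
Notation "M .[ k ]" := (tshift M k) : lincat_scope.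

Record triangulated (K : comPzRingType) (D : pretri K) : Prop := Triangulated {
  tr_additive : additive_cat D;
  tr_split : split_idempotents D;
  tr_iso : forall (X Y Z X' Y' Z' : D) (f : mor X Y) (g : mor Y Z)
      (h : mor Z (susp X)) (f' : mor X' Y') (g' : mor Y' Z')
      (h' : mor Z' (susp X')) (a : mor X X') (b : mor Y Y') (c : mor Z Z'),
    is_iso a -> is_iso b -> is_iso c ->
    f' \c a = b \c f -> g' \c b = c \c g -> h' \c c = fmap susp a \c h ->
    dist f g h -> dist f' g' h';
  tr_id : forall X Z : D, is_zero Z ->
    dist (idm X) (0 : mor X Z) (0 : mor Z (susp X));
  tr_cone : forall (X Y : D) (f : mor X Y),
    exists (Z : D) (g : mor Y Z) (h : mor Z (susp X)), dist f g h;
  tr_rot : forall (X Y Z : D) (f : mor X Y) (g : mor Y Z) (h : mor Z (susp X)),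
    dist f g h <-> dist g h (- fmap susp f);
  tr_fill : forall (X Y Z X' Y' Z' : D) (f : mor X Y) (g : mor Y Z)
      (h : mor Z (susp X)) (f' : mor X' Y') (g' : mor Y' Z')
      (h' : mor Z' (susp X')) (a : mor X X') (b : mor Y Y'),
    dist f g h -> dist f' g' h' -> f' \c a = b \c f ->
    exists c : mor Z Z', g' \c b = c \c g /\ h' \c c = fmap susp a \c h;
  tr_octahedron : forall (X Y Z A B C : D) (f : mor X Y) (g : mor Y Z)
      (a : mor Y C) (b : mor C (susp X)) (c : mor Z A) (d : mor A (susp Y))
      (e : mor Z B) (p : mor B (susp X)),
    dist f a b -> dist g c d -> dist (g \c f) e p ->
    exists (u : mor C B) (v : mor B A),
      [/\ dist u v (fmap susp a \c d), u \c a = e \c g, p \c u = b,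
          v \c e = c & d \c v = fmap susp f \c p] }.

Record trifunctor (K : comPzRingType) (C D : suspcat K) := TriFunctor {
  tf_fun :> functor C D;
  tf_susp : natiso (fcomp tf_fun susp) (fcomp susp tf_fun);
  tf_dist : forall (X Y Z : C) (f : mor X Y) (g : mor Y Z) (h : mor Z (susp X)),
    dist f g h ->
    dist (fmap tf_fun f) (fmap tf_fun g) (nto tf_susp X \c fmap tf_fun h) }.

Definition triangle_equivalent (K : comPzRingType) (C D : suspcat K) :=
  exists F : trifunctor C D, fully_faithful F /\ essentially_surjective F.

(* The triangles of a full subcategory are those of [D] with vertices in it. *)
Section FullSubcategory.
Variables (K : comPzRingType) (D : pretri K) (P : D -> Prop).

Definition shift_closed :=
  (forall X, P X -> P (susp X)) /\ (forall X, P X -> P (desusp X)).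

Definition sub_lincat : lincat K :=
  @LinCat K {X : D | P X} (fun X Y => mor (sval X) (sval Y))
    (fun X => idm (sval X)) (fun _ _ _ g f => g \c f)
    (fun _ _ _ _ h g f => compmA h g f) (fun _ _ f => comp1m f)
    (fun _ _ f => compm1 f) (fun _ _ _ f a g g' => comp_linearl f a g g')
    (fun _ _ _ g a f f' => comp_linearr g a f f').

Definition sub_functor (F : functor D D) (hF : forall X, P X -> P (F X)) :
    functor sub_lincat sub_lincat :=
  @Functor K sub_lincat sub_lincat
    (fun X => exist P (F (sval X)) (hF _ (proj2_sig X)))
    (fun _ _ f => fmap F f) (fun _ _ a f g => fmap_linear F a f g)
    (fun X => fmap1 F (sval X)) (fun _ _ _ g f => fmapM F g f).

Hypothesis hP : shift_closed.

Definition sub_suspcat : suspcat K :=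
  @SuspCat K sub_lincat (sub_functor hP.1) (fun X Y Z f g h =>
    @dist K D (sval X) (sval Y) (sval Z) f g h).

Let desusp_sub : functor sub_suspcat sub_suspcat := sub_functor hP.2.

Definition sub_suspK : natiso (fcomp desusp_sub susp) (fid sub_suspcat) :=
  @NatIso K sub_lincat sub_lincat (fcomp desusp_sub susp) (fid sub_suspcat)
    (fun X => nto suspK (sval X)) (fun X => nfrom suspK (sval X))
    (fun X => ntoK suspK (sval X)) (fun X => nfromK suspK (sval X))
    (fun X Y f => @nto_nat _ _ _ _ _ suspK (sval X) (sval Y) f).
Definition sub_desuspK : natiso (fcomp susp desusp_sub) (fid sub_suspcat) :=
  @NatIso K sub_lincat sub_lincat (fcomp susp desusp_sub) (fid sub_suspcat)
    (fun X => nto desuspK (sval X)) (fun X => nfrom desuspK (sval X))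
    (fun X => ntoK desuspK (sval X)) (fun X => nfromK desuspK (sval X))
    (fun X Y f => @nto_nat _ _ _ _ _ desuspK (sval X) (sval Y) f).

Definition subcat : pretri K := PreTri sub_suspK sub_desuspK.

End FullSubcategory.

Section Subcategories.
Variables (K : comPzRingType) (D : pretri K).
Implicit Types (P Q : D -> Prop) (T : D).

Definition summand_closed P := forall X Y : D, is_summand Y X -> P X -> P Y.
Definition extension_closed P :=
  forall (X Y Z : D) (f : mor X Y) (g : mor Y Z) (h : mor Z (susp X)),
    dist f g h -> P X -> P Z -> P Y.
Definition thick P :=
  [/\ shift_closed P, extension_closed P & summand_closed P].

Definition in_susp T (X : D) := forall P,
  P T -> extension_closed P -> summand_closed P ->
  (forall Y, P Y -> P (susp Y)) -> P X.

Definition silting T :=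
  (forall (i : int) (f : mor T T.[i]), 0 < i -> f = 0) /\
  (forall P, thick P -> P T -> forall X, P X).

Definition tstructure (L R : D -> Prop) :=
  [/\ summand_closed L /\ summand_closed R,
      forall X, L X -> L X.[1],
      forall X Y, L X -> R Y -> forall f : mor X Y.[-1], f = 0 &
      forall M, exists (U V V' : D) (f : mor U M) (g : mor M V)
          (h : mor V (susp U)),
        [/\ L U, R V', isomorphic V V'.[-1] & dist f g h]].

Definition left_perp P (X : D) := forall Y, P Y -> forall f : mor X Y, f = 0.
Definition perp_le0 T (X : D) :=
  forall (k : int), k <= 0 -> forall f : mor T X.[k], f = 0.
Definition perp_lt0 T (X : D) :=
  forall (k : int), k < 0 -> forall f : mor T X.[k], f = 0.

Definition gen_le0 T : D -> Prop := left_perp (perp_le0 T).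
Definition gen_ge0 T : D -> Prop := perp_lt0 T.

Definition compactly_generated :=
  has_coproducts D /\
  exists (I : choiceType) (S : I -> D),
    (forall i, compact_ob (S i)) /\
    forall M : D,
      (forall i (k : int) (f : mor (S i) M.[k]), f = 0) -> is_zero M.

Definition bfl (M : D) := forall X, compact_ob X ->
  (forall k : int, finite_length (mor X M.[k])) /\
  (exists n : nat, forall k : int, (n < `|k|)%N ->
     forall f : mor X M.[k], f = 0).

Definition compact_detectable := forall X : D,
  compact_ob X <->
  bfl X /\ (forall E, bfl E ->
    exists n : int, forall k, n <= k -> forall f : mor X E.[k], f = 0).

End Subcategories.

Section ShiftInvariance.
Variable K : comPzRingType.

Lemma finite_length_bij (U V : lmodType K) (phi : U -> V) (psi : V -> U) :
  cancel phi psi -> cancel psi phi ->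
  (forall a x y, phi (a *: x + y) = a *: phi x + phi y) ->
  finite_length U -> finite_length V.
Proof.
move=> phiK psiK phiL [n [N [Nsub N0 Nn Nstep]]].
have psiL a x y : psi (a *: x + y) = a *: psi x + psi y.
  by apply: (can_inj phiK); rewrite phiL !psiK.
have phi0 : phi 0 = 0 by have := phiL (-1) 0 0; rewrite !scaleN1r !addNr.
have psi0 : psi 0 = 0 by rewrite -phi0 phiK.
exists n, (fun i => [pred x | psi x \in N i] : {pred V}); split.
- move=> i; have [S0 SL] := Nsub i; split; first by rewrite inE psi0.
  by move=> a x y; rewrite !inE psiL; exact: SL.
- by move=> x /N0 x0; rewrite -[x]psiK x0.
- by move=> x; exact: Nn.
- move=> i /Nstep[sub nsub simp]; split.
  + by move=> x; exact: sub.
  + by move=> sub'; apply: nsub => x Nx; have := sub' (phi x);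
      rewrite !inE phiK; exact.
  + move=> P [P0 PL] sub1 sub2.
    have [||| H|H] := simp [pred x | phi x \in P].
    * split; first by rewrite inE phi0.
      by move=> a x y; rewrite !inE phiL; exact: PL.
    * by move=> x Nx; rewrite inE; apply: sub1; rewrite inE phiK.
    * by move=> x Px; have := sub2 _ Px; rewrite inE phiK.
    * by left=> x Px; rewrite inE; apply: H; rewrite inE psiK.
    * by right=> x Nx; have := H _ Nx; rewrite inE psiK.
Qed.

Section Equivalence.
Variables (C : lincat K) (F G : functor C C).
Hypotheses (eta : natiso (fcomp G F) (fid C)) (eps : natiso (fcomp F G) (fid C)).

Let e X : mor (G (F X)) X := nto eta X.
Let e' X : mor X (G (F X)) := nfrom eta X.
Let d X : mor (F (G X)) X := nto eps X.
Let d' X : mor X (F (G X)) := nfrom eps X.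
Let ee' X : e X \c e' X = idm X. Proof. exact: (nfromK eta). Qed.
Let e'e X : e' X \c e X = idm (G (F X)). Proof. exact: (ntoK eta). Qed.
Let dd' X : d X \c d' X = idm X. Proof. exact: (nfromK eps). Qed.
Let d'd X : d' X \c d X = idm (F (G X)). Proof. exact: (ntoK eps). Qed.
Let eN X Y (f : mor X Y) : e Y \c fmap G (fmap F f) = f \c e X.
Proof. exact: (nto_nat eta). Qed.
Let dN X Y (f : mor X Y) : d Y \c fmap F (fmap G f) = f \c d X.
Proof. exact: (nto_nat eps). Qed.
Let d'N X Y (f : mor X Y) : d' Y \c f = fmap F (fmap G f) \c d' X.
Proof. exact: (nfrom_nat eps). Qed.

Let F_faithful X Y (f g : mor X Y) : fmap F f = fmap F g -> f = g.
Proof.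
by move=> fg; rewrite -[f]compm1 -[g]compm1 -ee' !compmA -!eN fg.
Qed.
Let G_faithful X Y (f g : mor X Y) : fmap G f = fmap G g -> f = g.
Proof.
by move=> fg; rewrite -[f]compm1 -[g]compm1 -dd' !compmA -!dN fg.
Qed.

Let G_full X Y (g : mor (G X) (G Y)) : exists f : mor X Y, fmap G f = g.
Proof.
exists (d Y \c fmap F g \c d' X); apply: F_faithful.
rewrite -[LHS]comp1m -(d'd Y) -compmA dN.
by rewrite -!compmA d'd compm1 !compmA d'd comp1m.
Qed.

(* The automorphism measuring the failure of a triangle identity. *)
Let a X : mor (G X) (G X) := e (G X) \c fmap G (d' X).
Let b X : mor (G X) (G X) := fmap G (d X) \c e' (G X).
Let abK X : a X \c b X = idm (G X).
Proof.
by rewrite /a /b compmA -(compmA (e _)) -fmapM d'd fmap1 compm1 ee'.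
Qed.
Let baK X : b X \c a X = idm (G X).
Proof.
by rewrite /a /b compmA -(compmA (fmap G _)) e'e compm1 -fmapM dd' fmap1.
Qed.
Let aN X Y (h : mor X Y) : a Y \c fmap G h = fmap G h \c a X.
Proof. by rewrite /a -compmA -fmapM d'N fmapM compmA eN -compmA. Qed.
Let bN X Y (h : mor X Y) : b Y \c fmap G h = fmap G h \c b X.
Proof.
rewrite -[LHS]compm1 -(abK X) compmA -(compmA (b Y)) -aN (compmA (b Y)).
by rewrite baK comp1m.
Qed.

Lemma equiv_coproduct (I : choiceType) (M : I -> C) Y
    (inj : forall i, mor (M i) Y) :
  is_coproduct inj -> is_coproduct (fun i => fmap G (inj i)).
Proof.
move=> coY Z f.
have [g [gE gU]] := coY _ (fun i => fmap F (f i) \c d' (M i)).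
have fE i : e Z \c fmap G (fmap F (f i) \c d' (M i)) = f i \c a (M i).
  by rewrite fmapM compmA eN -compmA.
exists (e Z \c fmap G g \c b Y); split.
  by move=> i; rewrite -compmA bN compmA -(compmA (e Z)) -fmapM gE fE
    -(compmA (f i)) abK compm1.
move=> g' g'E.
have [w wE] : exists w : mor Y (F Z), fmap G w = e' Z \c g' \c a Y.
  exact: G_full.
have -> : g = w.
  apply: gU => i; apply: G_faithful.
  rewrite fmapM wE -compmA aN compmA -(compmA _ g') g'E.
  by rewrite -[RHS]comp1m -(e'e Z) -[in RHS]compmA fE compmA.
by rewrite wE (compmA (e Z)) (compmA (e Z)) ee' comp1m -(compmA g') abK compm1.
Qed.

Lemma equiv_compact X : compact_ob X -> compact_ob (F X).
Proof.
move=> cX I M Y inj coY.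
have [surj injv] := cX I (fun i => G (M i)) _ _ (equiv_coproduct coY).
split=> [f|s g us sum0 i si].
  pose v : mor (F X) (F X) := d (F X) \c fmap F (e' X).
  pose v' : mor (F X) (F X) := fmap F (e X) \c d' (F X).
  have vK : v \c v' = idm (F X).
    by rewrite /v /v' compmA -(compmA (d _)) -fmapM e'e fmap1 compm1 dd'.
  have [s [g [us gE]]] := surj (fmap G f \c e' X).
  exists s, (fun i => d (M i) \c fmap F (g i) \c v'); split=> //.
  have -> : \sum_(i <- s) inj i \c (d (M i) \c fmap F (g i) \c v') =
      d Y \c fmap F (\sum_(i <- s) fmap G (inj i) \c g i) \c v'.
    rewrite fmap_sum comp_sumr comp_suml; apply: eq_bigr => i _.
    by rewrite fmapM !compmA dN.
  by rewrite -gE fmapM compmA dN -(compmA f) -(compmA f) vK compm1.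
apply: G_faithful; rewrite fmap0 -[LHS]compm1 -(e'e X) compmA.
rewrite (injv s (fun i => fmap G (g i) \c e' X) us) ?comp0m //.
under eq_bigr do rewrite compmA -fmapM.
by rewrite -comp_suml -fmap_sum sum0 fmap0 comp0m.
Qed.

End Equivalence.

Variable D : pretri K.

Lemma compact_shift : shift_closed (@compact_ob K D).
Proof.
split=> X; first exact: (equiv_compact suspK desuspK).
exact: (equiv_compact desuspK suspK).
Qed.

Lemma iso_shift_susp (M : D) k : isomorphic (susp M).[k] M.[k + 1].
Proof.
have desusp_iter n (N N' : D) :
    isomorphic N N' -> isomorphic (iter n desusp N) (iter n desusp N').
  by move=> NN'; elim: n => //= n; exact: fmap_iso.
case: k => [n|n]; first by rewrite -PoszD addn1 /= -iterSr; exact: iso_refl.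
have -> : (susp M).[Negz n] = iter n desusp (desusp (susp M)) by exact: iterSr.
have -> : M.[Negz n + 1] = iter n desusp M.
  by rewrite NegzE -addn1 PoszD opprD subrK; case: n.
apply: desusp_iter; exists (nto suspK M), (nfrom suspK M).
by split; [exact: (ntoK suspK) | exact: (nfromK suspK)].
Qed.

Lemma iso_shift_desusp (M : D) k : isomorphic (desusp M).[k] M.[k - 1].
Proof.
have susp_iter n (N N' : D) :
    isomorphic N N' -> isomorphic (iter n susp N) (iter n susp N').
  by move=> NN'; elim: n => //= n; exact: fmap_iso.
case: k => [[|n]|n].
- exact: iso_refl.
- have -> : (desusp M).[n.+1] = iter n susp (susp (desusp M)) by exact: iterSr.
  have -> : M.[n.+1%:Z - 1] = iter n susp M by rewrite intS addrC addKr.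
  apply: susp_iter; exists (nto desuspK M), (nfrom desuspK M).
  by split; [exact: (ntoK desuspK) | exact: (nfromK desuspK)].
- have -> : Negz n - 1 = Negz n.+1 by rewrite !NegzE -opprD -PoszD addn1.
  have -> : M.[Negz n.+1] = iter n.+1 desusp (desusp M) by exact: iterSr.
  exact: iso_refl.
Qed.

Let bfl_iso_shift (M N : D) (c : int) (c1 : (`|c| <= 1)%N) :
  (forall k, isomorphic N.[k] M.[k + c]) -> bfl M -> bfl N.
Proof.
move=> NM bM X cX; have [fl [n van]] := bM X cX; split.
  move=> k; have [f [g [gf fg]]] := NM k.
  apply: (@finite_length_bij _ _ (fun u => g \c u) (fun u => f \c u)).
  - by move=> u; rewrite compmA fg comp1m.
  - by move=> u; rewrite compmA gf comp1m.
  - by move=> a u v; rewrite comp_linearr.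
  - exact: fl.
exists n.+1 => k nk u; have [f [g [gf fg]]] := NM k.
by rewrite -[u]comp1m -gf -compmA (van (k + c) _ (f \c u)) ?compm0 //; lia.
Qed.

Lemma bfl_shift : shift_closed (@bfl K D).
Proof.
split=> M.
  by apply: (bfl_iso_shift (c := 1)) => // k; exact: iso_shift_susp.
by apply: (bfl_iso_shift (c := - 1)) => // k; exact: iso_shift_desusp.
Qed.

End ShiftInvariance.

Definition cptcat (K : comPzRingType) (D : pretri K) : pretri K :=
  subcat (compact_shift D).
Definition bflcat (K : comPzRingType) (D : pretri K) : pretri K :=
  subcat (bfl_shift D).

Record conflcat (K : comPzRingType) := ConflCat {
  cc_cat :> lincat K;
  confl : forall A B C : cc_cat, mor A B -> mor B C -> Prop }.
Arguments confl {K c A B C} i p.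

Section ExactCategories.
Variables (K : comPzRingType) (E : conflcat K).

Definition is_kernel (A B C : E) (i : mor A B) (p : mor B C) :=
  p \c i = 0 /\ forall Z (f : mor Z B), p \c f = 0 -> exists! g, i \c g = f.
Definition is_cokernel (A B C : E) (i : mor A B) (p : mor B C) :=
  p \c i = 0 /\ forall Z (f : mor B Z), f \c i = 0 -> exists! g, g \c p = f.

Definition inflation (A B : E) (i : mor A B) :=
  exists (C : E) (p : mor B C), confl i p.
Definition deflation (B C : E) (p : mor B C) :=
  exists (A : E) (i : mor A B), confl i p.

Definition is_pushout (A B A' B' : E) (i : mor A B) (f : mor A A')
    (f' : mor B B') (i' : mor A' B') :=
  f' \c i = i' \c f /\
  forall Z (u : mor B Z) (v : mor A' Z), u \c i = v \c f ->
    exists! w : mor B' Z, w \c f' = u /\ w \c i' = v.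
Definition is_pullback (B C B' C' : E) (p : mor B C) (f : mor C' C)
    (f' : mor B' B) (p' : mor B' C') :=
  p \c f' = f \c p' /\
  forall Z (u : mor Z B) (v : mor Z C'), p \c u = f \c v ->
    exists! w : mor Z B', f' \c w = u /\ p' \c w = v.

(* Quillen's axioms, in Keller's and Buehler's form. *)
Record exact_cat : Prop := Exact {
  ex_additive : additive_cat E;
  ex_kercok : forall (A B C : E) (i : mor A B) (p : mor B C),
    confl i p -> is_kernel i p /\ is_cokernel i p;
  ex_iso : forall (A B C A' B' C' : E) (i : mor A B) (p : mor B C)
      (i' : mor A' B') (p' : mor B' C') (a : mor A A') (b : mor B B')
      (c : mor C C'),
    is_iso a -> is_iso b -> is_iso c ->
    i' \c a = b \c i -> p' \c b = c \c p -> confl i p -> confl i' p';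
  ex_infl1 : forall A : E, inflation (idm A);
  ex_defl1 : forall A : E, deflation (idm A);
  ex_inflM : forall (A B C : E) (i : mor A B) (j : mor B C),
    inflation i -> inflation j -> inflation (j \c i);
  ex_deflM : forall (A B C : E) (p : mor A B) (q : mor B C),
    deflation p -> deflation q -> deflation (q \c p);
  ex_pushout : forall (A B A' : E) (i : mor A B) (f : mor A A'),
    inflation i ->
    exists (B' : E) (f' : mor B B') (i' : mor A' B'),
      is_pushout i f f' i' /\ inflation i';
  ex_pullback : forall (B C C' : E) (p : mor B C) (f : mor C' C),
    deflation p ->
    exists (B' : E) (f' : mor B' B) (p' : mor B' C'),
      is_pullback p f f' p' /\ deflation p' }.

Definition injective_ob (I : E) :=
  forall (A B : E) (i : mor A B), inflation i ->
  forall f : mor A I, exists g : mor B I, g \c i = f.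
Definition projective_ob (P : E) :=
  forall (B C : E) (p : mor B C), deflation p ->
  forall f : mor P C, exists g : mor P B, p \c g = f.

Record frobenius_cat : Prop := Frobenius {
  fr_exact : exact_cat;
  fr_inj : forall A : E, exists (I B : E) (i : mor A I) (p : mor I B),
    injective_ob I /\ confl i p;
  fr_proj : forall C : E, exists (A P : E) (i : mor A P) (p : mor P C),
    projective_ob P /\ confl i p;
  fr_injproj : forall I : E, injective_ob I <-> projective_ob I }.

End ExactCategories.

(* The stable category: morphisms modulo those factoring through a projective
   (equivalently, injective) object. *)
Section StableCategory.
Variables (K : comPzRingType) (E : conflcat K) (frE : frobenius_cat E).
Implicit Types X Y Z A B : E.

Definition thru_inj X Y (f : mor X Y) :=
  exists (I : E) (u : mor I Y) (v : mor X I), injective_ob I /\ f = u \c v.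
Definition thru_injb X Y : {pred mor X Y} := fun f => `[< thru_inj f >].

Lemma injective_biproduct X Y Z :
  is_biproduct X Y Z -> injective_ob Y -> injective_ob Z -> injective_ob X.
Proof.
move=> [i1 [i2 [p1 [p2 [_ _ _ _ sum]]]]] injY injZ A B i infl f.
have [g1 g1E] := injY _ _ _ infl (p1 \c f).
have [g2 g2E] := injZ _ _ _ infl (p2 \c f).
exists (i1 \c g1 + i2 \c g2).
by rewrite compDl -!compmA g1E g2E !compmA -compDl sum comp1m.
Qed.

Fact thru_inj_submod X Y : submod_closed (@thru_injb X Y).
Proof.
split=> [|a f g /asboolP[I [u [v [injI ->]]]] /asboolP[J [w [t [injJ ->]]]]].
  have [I [_ [_ [_ [injI _]]]]] := fr_inj frE X.
  by apply/asboolP; exists I, 0, 0; rewrite comp0m.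
have [P bP] := (ex_additive (fr_exact frE)).2 I J.
have injP := injective_biproduct bP injI injJ.
have [i1 [i2 [p1 [p2 [p1i1 p2i2 p1i2 p2i1 _]]]]] := bP.
apply/asboolP; exists P, (u \c p1 + w \c p2), (i1 \c (a *: v) + i2 \c t).
split=> //; rewrite compDl !compDr -!compmA (compmA p1 i1) (compmA p1 i2).
rewrite (compmA p2 i1) (compmA p2 i2) p1i1 p2i2 p1i2 p2i1 !comp1m !comp0m.
by rewrite !compm0 addr0 add0r compZr.
Qed.

Lemma thru_injMl X Y Z (g : mor Y Z) (f : mor X Y) :
  thru_inj f -> thru_inj (g \c f).
Proof.
by move=> [I [u [v [injI ->]]]]; exists I, (g \c u), v; rewrite compmA.
Qed.
Lemma thru_injMr X Y Z (g : mor Y Z) (f : mor X Y) :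
  thru_inj g -> thru_inj (g \c f).
Proof.
by move=> [I [u [v [injI ->]]]]; exists I, u, (v \c f); rewrite compmA.
Qed.

Definition stab_hom X Y : lmodType K := modq (thru_inj_submod X Y).
Definition stab_pi X Y (f : mor X Y) : stab_hom X Y := modq_pi _ f.
Definition stab_repr X Y (f : stab_hom X Y) : mor X Y := modq_repr f.
Definition stab_comp X Y Z (g : stab_hom Y Z) (f : stab_hom X Y) :=
  stab_pi (stab_repr g \c stab_repr f).

Lemma stab_piP X Y (f g : mor X Y) :
  stab_pi f = stab_pi g <-> thru_inj (f - g).
Proof.
split=> [/modq_piP/asboolP //|h]; by apply/modq_piP/asboolP.
Qed.
Lemma stab_reprK X Y (f : stab_hom X Y) : stab_pi (stab_repr f) = f.
Proof. exact: modq_reprK. Qed.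
Lemma stab_reprP X Y (f : mor X Y) : thru_inj (stab_repr (stab_pi f) - f).
Proof. by apply/stab_piP; rewrite stab_reprK. Qed.
Lemma stab_pi_linear X Y a (f g : mor X Y) :
  stab_pi (a *: f + g) = a *: stab_pi f + stab_pi g.
Proof. exact: modq_pi_linear. Qed.
Lemma stab_piS X Y (f : stab_hom X Y) : exists f', f = stab_pi f'.
Proof. by exists (stab_repr f); rewrite stab_reprK. Qed.

Lemma stab_piM X Y Z (g : mor Y Z) (f : mor X Y) :
  stab_comp (stab_pi g) (stab_pi f) = stab_pi (g \c f).
Proof.
transitivity (stab_pi (stab_repr (stab_pi g) \c f)); apply/stab_piP.
  by rewrite -compBr; apply: thru_injMl; exact: stab_reprP.
by rewrite -compBl; apply: thru_injMr; exact: stab_reprP.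
Qed.

Fact stab_compA X Y Z W (h : stab_hom Z W) (g : stab_hom Y Z)
    (f : stab_hom X Y) :
  stab_comp h (stab_comp g f) = stab_comp (stab_comp h g) f.
Proof.
have [[h' ->] [g' ->] [f' ->]] := And3 (stab_piS h) (stab_piS g) (stab_piS f).
by rewrite !stab_piM compmA.
Qed.
Fact stab_comp1m X Y (f : stab_hom X Y) : stab_comp (stab_pi (idm Y)) f = f.
Proof. by have [f' ->] := stab_piS f; rewrite stab_piM comp1m. Qed.
Fact stab_compm1 X Y (f : stab_hom X Y) : stab_comp f (stab_pi (idm X)) = f.
Proof. by have [f' ->] := stab_piS f; rewrite stab_piM compm1. Qed.
Fact stab_comp_linearl X Y Z (f : stab_hom X Y) a (g g' : stab_hom Y Z) :
  stab_comp (a *: g + g') f = a *: stab_comp g f + stab_comp g' f.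
Proof.
have [[h ->] [h' ->] [e ->]] := And3 (stab_piS g) (stab_piS g') (stab_piS f).
by rewrite -stab_pi_linear !stab_piM comp_linearl stab_pi_linear.
Qed.
Fact stab_comp_linearr X Y Z (g : stab_hom Y Z) a (f f' : stab_hom X Y) :
  stab_comp g (a *: f + f') = a *: stab_comp g f + stab_comp g f'.
Proof.
have [[h ->] [h' ->] [e ->]] := And3 (stab_piS f) (stab_piS f') (stab_piS g).
by rewrite -stab_pi_linear !stab_piM comp_linearr stab_pi_linear.
Qed.

Definition stab_cat : lincat K :=
  @LinCat K E stab_hom (fun X => stab_pi (idm X)) stab_comp stab_compA
    stab_comp1m stab_compm1 stab_comp_linearl stab_comp_linearr.

(* The suspension of [X] is the cokernel of a chosen inflation of [X] into an
   injective object. *)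
Record hull X := Hull {
  hullI : E;
  hullS : E;
  hull_i : mor X hullI;
  hull_p : mor hullI hullS;
  hull_inj : injective_ob hullI;
  hull_confl : confl hull_i hull_p }.

Lemma hull_exists X : exists _ : hull X, True.
Proof.
by have [I [Z [i [p [injI c]]]]] := fr_inj frE X; exists (Hull injI c).
Qed.
Definition the_hull X : hull X := projT1 (cid (hull_exists X)).

Definition stab_susp_ob X : E := hullS (the_hull X).
Local Notation SS := stab_susp_ob.
Let ii X := hull_i (the_hull X).
Let pp X := hull_p (the_hull X).

(* [s] is induced by [f] on suspensions. *)
Definition susp_lift X Y (f : mor X Y) (s : mor (SS X) (SS Y)) :=
  exists f' : mor (hullI (the_hull X)) (hullI (the_hull Y)),
    f' \c hull_i (the_hull X) = hull_i (the_hull Y) \c f /\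
    s \c hull_p (the_hull X) = hull_p (the_hull Y) \c f'.

Let iinfl X : inflation (ii X).
Proof. by exists (SS X), (pp X); exact: hull_confl. Qed.
Let ppii X : pp X \c ii X = 0.
Proof. by have [[]] := ex_kercok (fr_exact frE) (hull_confl (the_hull X)). Qed.
Let ppP X Z (f : mor (hullI (the_hull X)) Z) :
  f \c ii X = 0 -> exists! g, g \c pp X = f.
Proof.
by have [_ [_]] := ex_kercok (fr_exact frE) (hull_confl (the_hull X)); exact.
Qed.
Let ppI X Z (f g : mor (SS X) Z) : f \c pp X = g \c pp X -> f = g.
Proof.
move=> fg; have [|h [_ hU]] := @ppP X Z (f \c pp X).
  by rewrite -compmA ppii compm0.
by rewrite -(hU f) // -(hU g).
Qed.

Lemma susp_lift_exists X Y (f : mor X Y) : exists s, susp_lift f s.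
Proof.
have [f' f'E] := @hull_inj _ (the_hull Y) _ _ _ (iinfl X) (ii Y \c f).
have [|s [sE _]] := @ppP X _ (pp Y \c f').
  by rewrite -compmA f'E compmA ppii comp0m.
by exists s, f'.
Qed.

Lemma susp_lift_linear X Y a (f g : mor X Y) s t :
  susp_lift f s -> susp_lift g t -> susp_lift (a *: f + g) (a *: s + t).
Proof.
move=> [f' [fE sE]] [g' [gE tE]]; exists (a *: f' + g').
by rewrite comp_linearl comp_linearr fE gE comp_linearl comp_linearr sE tE.
Qed.

Lemma susp_lift0 X Y (f : mor X Y) s :
  susp_lift f s -> thru_inj f -> thru_inj s.
Proof.
move=> [f' [fE sE]] [J [u [v [injJ fuv]]]].
have [w wE] := injJ _ _ _ (iinfl X) v.
have [|t [tE _]] := @ppP X _ (f' - ii Y \c u \c w).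
  by rewrite compBl fE -(compmA _ w) wE -compmA -fuv subrr.
exists (hullI (the_hull Y)), (pp Y), t; split; first exact: hull_inj.
apply: ppI; rewrite -compmA tE compBr !compmA ppii !comp0m subr0.
exact: sE.
Qed.

Lemma susp_lift_uniq X Y (f g : mor X Y) s t :
  susp_lift f s -> susp_lift g t -> stab_pi f = stab_pi g ->
  stab_pi s = stab_pi t.
Proof.
move=> fs gt /stab_piP fg; apply/stab_piP.
have -> : s - t = (-1) *: t + s by rewrite scaleN1r addrC.
apply: susp_lift0 (susp_lift_linear (-1) gt fs) _.
by rewrite scaleN1r addrC.
Qed.

Definition stab_susp_map X Y (f : stab_hom X Y) : stab_hom (SS X) (SS Y) :=
  stab_pi (projT1 (cid (susp_lift_exists (stab_repr f)))).

Lemma stab_susp_mapE X Y (f : mor X Y) s :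
  susp_lift f s -> stab_susp_map (stab_pi f) = stab_pi s.
Proof.
move=> fs; rewrite /stab_susp_map; case: cid => t /= ft.
by apply: susp_lift_uniq ft fs _; rewrite stab_reprK.
Qed.

Fact stab_susp_linear X Y a (f g : stab_hom X Y) :
  stab_susp_map (a *: f + g) = a *: stab_susp_map f + stab_susp_map g.
Proof.
have [[f' ->] [g' ->]] := conj (stab_piS f) (stab_piS g).
have [[s fs] [t gt]] := conj (susp_lift_exists f') (susp_lift_exists g').
rewrite -stab_pi_linear (stab_susp_mapE (susp_lift_linear a fs gt)).
by rewrite (stab_susp_mapE fs) (stab_susp_mapE gt) stab_pi_linear.
Qed.
Fact stab_susp1 X : stab_susp_map (stab_pi (idm X)) = stab_pi (idm (SS X)).
Proof.
apply: stab_susp_mapE; exists (idm (hullI (the_hull X))).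
by rewrite !comp1m !compm1.
Qed.
Fact stab_suspM X Y Z (g : stab_hom Y Z) (f : stab_hom X Y) :
  stab_susp_map (stab_comp g f) =
  stab_comp (stab_susp_map g) (stab_susp_map f).
Proof.
have [[f' ->] [g' ->]] := conj (stab_piS f) (stab_piS g).
have [[s fs] [t gt]] := conj (susp_lift_exists f') (susp_lift_exists g').
rewrite (stab_susp_mapE fs) (stab_susp_mapE gt) !stab_piM.
apply: stab_susp_mapE; have [[f1 [f1E sE]] [g1 [g1E tE]]] := conj fs gt.
exists (g1 \c f1); split; first by rewrite -compmA f1E !compmA g1E.
by rewrite -compmA sE !compmA tE.
Qed.

Definition stab_susp : functor stab_cat stab_cat :=
  @Functor K stab_cat stab_cat stab_susp_ob stab_susp_map stab_susp_linear
    stab_susp1 stab_suspM.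

(* A conflation [A -i-> B -p-> C] and a morphism of conflations
   (idm A, b, e) from it to the chosen one starting at [A]; the sign convention
   for [e] does not affect triangle equivalence. *)
Definition standard_triangle A B (C : E) (i : mor A B) (p : mor B C)
    (e : mor C (SS A)) :=
  confl i p /\ exists b : mor B (hullI (the_hull A)),
    b \c i = hull_i (the_hull A) /\ e \c p = hull_p (the_hull A) \c b.

Definition stab_dist (X Y Z : stab_cat) (f : mor X Y) (g : mor Y Z)
    (h : mor Z (stab_susp X)) :=
  exists (A B C : E) (i : mor A B) (p : mor B C) (e : mor C (SS A))
    (a : @mor K stab_cat A X) (b : @mor K stab_cat B Y)
    (c : @mor K stab_cat C Z),
    [/\ standard_triangle i p e, [/\ is_iso a, is_iso b & is_iso c],
        f \c a = b \c (stab_pi i : @mor K stab_cat A B),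
        g \c b = c \c (stab_pi p : @mor K stab_cat B C) &
        h \c c = fmap stab_susp a \c
                 (stab_pi e : @mor K stab_cat C (stab_susp A))].

Definition stable : suspcat K := @SuspCat K stab_cat stab_susp stab_dist.

End StableCategory.

Definition algebraic (K : comPzRingType) (D : suspcat K) :=
  exists (E : conflcat K) (frE : frobenius_cat E),
    triangle_equivalent (stable frE) D.

Record recollement (K : comPzRingType) (Y D X : suspcat K) := Recollement {
  i_lstar : trifunctor Y D;
  i_ustar : trifunctor D Y;
  i_shriek : trifunctor D Y;
  j_shriek : trifunctor X D;
  j_ustar : trifunctor D X;
  j_lstar : trifunctor X D;
  rec_adj_i : adjunction i_ustar i_lstar;
  rec_adj_i' : adjunction i_lstar i_shriek;
  rec_adj_j : adjunction j_shriek j_ustar;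
  rec_adj_j' : adjunction j_ustar j_lstar;
  rec_ff_i : fully_faithful i_lstar;
  rec_ff_j : fully_faithful j_lstar;
  rec_ff_j' : fully_faithful j_shriek;
  rec_zero : forall M : X, is_zero (i_shriek (j_lstar M));
  rec_tri : forall Z : D, exists h,
    dist (adj_counit rec_adj_i' Z) (adj_unit rec_adj_j' Z) h;
  rec_tri' : forall Z : D, exists h,
    dist (adj_counit rec_adj_j Z) (adj_unit rec_adj_i Z) h }.

(* [LY], [RY] are Y^{<=0}, Y^{>=0}, and likewise for X. *)
Section Gluing.
Variables (K : comPzRingType) (Y D X : suspcat K) (R : recollement Y D X).
Variables (LY RY : Y -> Prop) (LX RX : X -> Prop).

Definition glued_le0 (Z : D) := LX (j_ustar R Z) /\ LY (i_ustar R Z).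
Definition glued_ge0 (Z : D) := RX (j_ustar R Z) /\ RY (i_shriek R Z).

End Gluing.

Definition cpt_to_bfl (K : comPzRingType) (D : pretri K)
    (h : forall M : D, compact_ob M -> bfl M) (M : cptcat D) : bflcat D :=
  exist _ (sval M) (h _ (proj2_sig M)).

Definition generates (K : comPzRingType) (D : pretri K) (T : D)
    (L R : D -> Prop) :=
  (forall Z, gen_le0 T Z <-> L Z) /\ (forall Z, gen_ge0 T Z <-> R Z).

(* Main.v *)
Require Import Defs.
From HB Require Import structures.
From mathcomp Require Import all_boot all_order all_algebra.
From mathcomp Require Import boolp zify.

Set Implicit Arguments.
Unset Strict Implicit.
Unset Printing Implicit Defensive.

Import Order.TTheory GRing.Theory Num.Theory.
Local Open Scope ring_scope.
Local Open Scope lincat_scope.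

(** The adjunctions and the detection hypothesis make [j_!] and [i_*] preserve
    compactness. Vanishing of [Hom(-, V[k])] for [k < 0] on [T] is equivalent to
    the same vanishing on [j_! T_X] and [i_* T_Y], so that [T] has the
    right-hand class of the glued t-structure; passing to left orthogonals
    through the adjunctions gives the left-hand one. That this is a t-structure
    then follows from the existence of truncations for a compact silting object
    (a telescope construction in the big category, which stays in the bounded
    finite length part), so no t-structures need to be glued.

    The remaining points, [Hom(T~_Y, j_! W[1]) = 0] on the aisle of [X] and
    the generation of all compact objects by [T], are reduced by dimension
    shifting to a uniform bound for a silting object [S]: if a cohomological
    vanishing condition holds in high degrees for each single object of bounded
    finite length, it holds in uniformly high degrees on the aisle. Indeed the
    degree 0 truncation of [S] splits repeatedly into a finite family of heart
    objects such that every object [V] of the coaisle with [Hom(S, V) <> 0]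
    receives from a member of the family a nonzero map that is injective on
    [Hom(S, -)], and one inducts on the length of [Hom(S, V)]. *)

(** * Lengths of modules *)

Section Modules.
Variable K : comPzRingType.

Definition linmap (U V : lmodType K) (f : U -> V) :=
  forall a x y, f (a *: x + y) = a *: f x + f y.

Definition liniso (U V : lmodType K) :=
  exists (f : U -> V) (g : V -> U), [/\ linmap f, cancel f g & cancel g f].

Lemma linmap0 (U V : lmodType K) (f : U -> V) : linmap f -> f 0 = 0.
Proof. by move=> lf; have := lf (-1) 0 0; rewrite !scaleN1r !addNr. Qed.
Lemma linmapD (U V : lmodType K) (f : U -> V) x y :
  linmap f -> f (x + y) = f x + f y.
Proof. by move=> lf; have := lf 1 x y; rewrite !scale1r. Qed.
Lemma linmapN (U V : lmodType K) (f : U -> V) x : linmap f -> f (- x) = - f x.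
Proof.
by move=> lf; apply: (addrI (f x)); rewrite -linmapD // !subrr linmap0.
Qed.

Lemma liniso_refl (U : lmodType K) : liniso U U.
Proof. by exists id, id; split. Qed.
Lemma liniso_sym (U V : lmodType K) : liniso U V -> liniso V U.
Proof.
move=> [f [g [lf fK gK]]]; exists g, f; split=> // a x y.
by apply: (can_inj fK); rewrite lf !gK.
Qed.
Lemma liniso_trans (U V W : lmodType K) :
  liniso U V -> liniso V W -> liniso U W.
Proof.
move=> [f [g [lf fK gK]]] [h [k [lh hK kK]]]; exists (h \o f), (g \o k).
by split=> [a x y||]; rewrite /= ?lf ?lh //; exact: can_comp.
Qed.

Definition null (M : lmodType K) := forall x : M, x = 0.

(** Exactness is asked at the middle term alone, so such a class is closed under submodules,
    quotients and extensions. The instances are zero modules and modules of finite length: each long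
    exact sequence argument serves both. *)
Definition exact_closed (Phi : lmodType K -> Prop) :=
  forall (A B C : lmodType K) (f : A -> B) (g : B -> C), linmap f -> linmap g ->
    (forall a, g (f a) = 0) -> (forall b, g b = 0 -> exists a, f a = b) ->
    Phi A -> Phi C -> Phi B.

Lemma null_exact : exact_closed null.
Proof.
move=> A B C f g lf lg _ ex nA nC x.
by have [a <-] := ex x (nC _); rewrite (nA a) linmap0.
Qed.

Section ExactClosed.
Variables (Phi : lmodType K -> Prop) (exPhi : exact_closed Phi).

Lemma exact_closed_inj (A B : lmodType K) (f : B -> A) :
  linmap f -> injective f -> Phi A -> Phi B.
Proof.
move=> lf injf PA.
apply: (exPhi (f := fun _ : A => 0) (g := f)) (PA) (PA) => //.
- by move=> a x y; rewrite scaler0 addr0.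
- by move=> _; exact: linmap0.
- by move=> b; rewrite -(linmap0 lf) => /injf ->; exists 0.
Qed.

Lemma exact_closed_surj (A B : lmodType K) (f : A -> B) :
  linmap f -> (forall b, exists a, f a = b) -> Phi A -> Phi B.
Proof.
move=> lf surj PA.
apply: (exPhi (f := f) (g := fun _ : B => 0 : A)) (PA) (PA) => //.
by move=> a x y; rewrite scaler0 addr0.
Qed.

Lemma exact_closed_iso (A B : lmodType K) : liniso A B -> Phi A -> Phi B.
Proof.
move=> [f [g [lf fK gK]]]; apply: exact_closed_surj lf _ => b.
by exists (g b).
Qed.

End ExactClosed.

Section Submodules.
Variable M : lmodType K.
Implicit Types N P : {pred M}.

Lemma submodD N x y : submod_closed N -> x \in N -> y \in N -> x + y \in N.
Proof. by move=> [_ SL] Nx Ny; rewrite -[x]scale1r SL. Qed.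
Lemma submodZ N a x : submod_closed N -> x \in N -> a *: x \in N.
Proof. by move=> [S0 SL] Nx; rewrite -[_ *: _]addr0 SL. Qed.

Definition psum N P : {pred M} :=
  fun z => `[< exists x y, [/\ x \in N, y \in P & z = x + y] >].

Lemma psum_submod N P : submod_closed N -> submod_closed P ->
  submod_closed (psum N P).
Proof.
move=> SN SP; split=> [|a _ _ /asboolP[x [y [Nx Py ->]]]
    /asboolP[x' [y' [Nx' Py' ->]]]]; apply/asboolP.
  by exists 0, 0; rewrite SN.1 SP.1 addr0.
exists (a *: x + x'), (a *: y + y'); rewrite (SN.2 a) ?(SP.2 a) //.
by rewrite scalerDr addrACA.
Qed.

Lemma sub_psuml N P : submod_closed P -> {subset N <= psum N P}.
Proof.
by move=> SP x Nx; apply/asboolP; exists x, 0; rewrite Nx SP.1 addr0.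
Qed.
Lemma sub_psumr N P : submod_closed N -> {subset P <= psum N P}.
Proof.
by move=> SN x Px; apply/asboolP; exists 0, x; rewrite Px SN.1 add0r.
Qed.
Lemma psum_sub N P Q : submod_closed Q -> {subset N <= Q} ->
  {subset P <= Q} -> {subset psum N P <= Q}.
Proof.
move=> SQ NQ PQ _ /asboolP[x [y [Nx Py ->]]].
by apply: submodD => //; [exact: NQ|exact: PQ].
Qed.

Definition line (x : M) : {pred M} := fun z => `[< exists a, z = a *: x >].
Lemma line_submod x : submod_closed (line x).
Proof.
split=> [|a _ _ /asboolP[b ->] /asboolP[c ->]]; apply/asboolP.
  by exists 0; rewrite scale0r.
by exists (a * b + c); rewrite scalerDl scalerA.
Qed.

(** A composition series of [N] peeled off from the top, with its length as an index for inductions.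
    The index is the length of one series, not an invariant shown to be unique. *)
Fixpoint chain (n : nat) (N : {pred M}) : Prop :=
  match n with
  | 0 => forall x, x \in N -> x = 0
  | n.+1 => exists N0, [/\ submod_closed N0, chain n N0 & simple_step N0 N]
  end.

Lemma chain_sub n N N' : {subset N <= N'} -> {subset N' <= N} ->
  chain n N -> chain n N'.
Proof.
case: n => [|n] NN' N'N /=; first by move=> h x /N'N /h.
move=> [N0 [S0 c0 [sub nsub simp]]]; exists N0; split=> //; split.
- by move=> x /sub /NN'.
- by move=> sub'; apply: nsub => x /NN' /sub'.
- move=> P SP s1 s2; have [|H|H] := simp P SP s1; first by move=> x /s2/N'N.
    by left.
  by right=> x /N'N/H.
Qed.

Definition has_len n := chain n predT.

Lemma has_len0 : has_len 0 -> null M.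
Proof. by move=> h x; exact: h. Qed.

Lemma chain_series n N : submod_closed N -> chain n N ->
  exists F : nat -> {pred M}, [/\ F n = N, forall i, submod_closed (F i),
    forall x, x \in F 0%N -> x = 0 &
    forall i, (i < n)%N -> simple_step (F i) (F i.+1)].
Proof.
elim: n N => [|n IH] N SN /=.
  by move=> h; exists (fun=> N); split.
move=> [N0 [S0 /(IH _ S0)[F [Fn SF F0 st]] st']].
exists (fun i => if (i <= n)%N then F i else N); split=> //.
- by rewrite ltnn.
- by move=> i; case: ifP.
- move=> i; rewrite ltnS => le_in; rewrite le_in.
  case: ltngtP le_in => // [lt_in|->] _; first exact: st.
  by rewrite Fn.
Qed.

Lemma finite_lengthP : finite_length M <-> exists n, has_len n.
Proof.
split=> [[n [F [SF F0 Fn st]]]|[n /chain_series[]]].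
- exists n; rewrite /has_len; apply: (@chain_sub _ (F n)) => //.
  have: (n <= n)%N by [].
  elim: {-2}n => [|i IH] //= lt_in; exists (F i); split=> //.
    exact: IH (ltnW lt_in).
  exact: st.
- by [].
- by move=> F [Fn SF F0 st]; exists n, F; split=> // x; rewrite Fn.
Qed.

(** By simplicity of the top step, [N] is generated by [N0] and any one element of [N] outside [N0]:
    one generator per step. *)
Lemma chain_fg n N : submod_closed N -> chain n N ->
  exists (m : nat) (x : 'I_m -> M), forall y, y \in N ->
    exists a : 'I_m -> K, y = \sum_i a i *: x i.
Proof.
elim: n N => [|n IH] N SN /=.
  move=> N0; exists 0%N, (fun=> 0) => y /N0 ->.
  by exists (fun=> 0); rewrite big_ord0.
move=> [N0 [S0 c0 [sub nsub simp]]].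
have [x Nx nN0x] : exists2 x, x \in N & x \notin N0.
  apply: contrapT => H; apply: nsub => x Nx.
  by apply: contraT => nx; case: H; exists x.
have [m [z zE]] := IH _ S0 c0.
have lineN : {subset line x <= N}.
  by move=> _ /asboolP[a ->]; exact: submodZ.
case: (simp (psum N0 (line x))) => [||||sub'].
- exact: psum_submod S0 (line_submod x).
- exact: sub_psuml (line_submod x).
- exact: psum_sub.
- move=> sub'; case/negP: nN0x; apply/sub'/sub_psumr => //.
  by apply/asboolP; exists 1; rewrite scale1r.
exists m.+1, (fun i => oapp z x (unlift ord0 i)) => y Ny.
have /asboolP[u [_ [/zE[a ->] /asboolP[b ->] ->]]] := sub' _ Ny.
exists (fun i => oapp a b (unlift ord0 i)).
rewrite big_ord_recl unlift_none /= addrC; congr (_ + _).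
by apply: eq_bigr => i _; rewrite liftK.
Qed.

Lemma finite_length_fg : finite_length M ->
  exists (m : nat) (x : 'I_m -> M), forall y,
    exists a : 'I_m -> K, y = \sum_i a i *: x i.
Proof.
move=> /finite_lengthP[n /chain_fg[//|m [x xE]]].
by exists m, x => y; exact: xE.
Qed.

End Submodules.

Section Maps.
Variables (A B : lmodType K) (f : A -> B).
Hypothesis lf : linmap f.

Definition pimage (N : {pred A}) : {pred B} :=
  fun y => `[< exists2 x, x \in N & y = f x >].
Definition ppreim (N : {pred B}) : {pred A} := fun x => f x \in N.

Lemma pimage_submod N : submod_closed N -> submod_closed (pimage N).
Proof.
move=> [S0 SL]; split=> [|a _ _ /asboolP[x Nx ->] /asboolP[y Ny ->]];
  apply/asboolP.
  by exists 0; rewrite ?linmap0.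
by exists (a *: x + y); rewrite ?SL ?lf.
Qed.
Lemma ppreim_submod N : submod_closed N -> submod_closed (ppreim N).
Proof.
move=> [S0 SL]; split=> [|a x y]; rewrite /ppreim unfold_in ?linmap0 //.
by move=> Nx Ny; rewrite unfold_in lf SL.
Qed.
Lemma mem_pimage (N : {pred A}) x : x \in N -> f x \in pimage N.
Proof. by move=> Nx; apply/asboolP; exists x. Qed.

Lemma pimage_sub (N N' : {pred A}) :
  {subset N <= N'} -> {subset pimage N <= pimage N'}.
Proof. by move=> NN' _ /asboolP[x /NN' Nx ->]; exact: mem_pimage. Qed.
Lemma ppreim_sub (N N' : {pred B}) :
  {subset N <= N'} -> {subset ppreim N <= ppreim N'}.
Proof. by move=> NN' x; exact: NN'. Qed.

(** A submodule [Q] between the images is traced back to [P], the part of [N'] sent into [Q], and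
    simplicity is applied to [P]. Preimages are treated dually, through [N + f(Q)]. *)
Lemma pimage_step (N N' : {pred A}) : submod_closed N' -> simple_step N N' ->
  {subset pimage N' <= pimage N} \/ simple_step (pimage N) (pimage N').
Proof.
move=> SN' [sub nsub simp].
have [|nsub'] := pselect {subset pimage N' <= pimage N}; first by left.
right; split=> [|//|Q SQ s1 s2]; first exact: pimage_sub.
pose P : {pred A} := [pred x | (x \in N') && (f x \in Q)].
case: (simp P) => [||x|sub'|sub'].
- have [S0 SL] := SN'; have [Q0 QL] := SQ; split=> [|a x y].
    by rewrite inE S0 linmap0 // Q0.
  by rewrite !inE => /andP[? ?] /andP[? ?]; rewrite SL //= lf QL.
- by move=> x Nx; rewrite inE sub //=; apply: s1; exact: mem_pimage.
- by rewrite inE => /andP[].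
- left=> y Qy; have /asboolP[x N'x yE] := s2 _ Qy.
  by rewrite yE mem_pimage // sub' // inE N'x -yE.
- right=> _ /asboolP[x N'x ->].
  by have := sub' _ N'x; rewrite inE => /andP[].
Qed.

Lemma ppreim_step (N N' : {pred B}) : submod_closed N -> submod_closed N' ->
  simple_step N N' ->
  {subset ppreim N' <= ppreim N} \/ simple_step (ppreim N) (ppreim N').
Proof.
move=> SN SN' [sub nsub simp].
have [|nsub'] := pselect {subset ppreim N' <= ppreim N}; first by left.
right; split=> [|//|Q SQ s1 s2]; first exact: ppreim_sub.
case: (simp (psum N (pimage Q))) => [|||sub'|sub'].
- by apply: psum_submod => //; exact: pimage_submod.
- by apply: sub_psuml; exact: pimage_submod.
- by apply: psum_sub => // _ /asboolP[x Qx ->]; exact: s2.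
- left=> x Qx; apply: sub'; apply: sub_psumr => //; exact: mem_pimage.
- right=> y N'y.
  have /asboolP[x [_ [Nx /asboolP[z Qz ->] yE]]] := sub' _ N'y.
  rewrite -(subrK z y); apply: submodD => //; apply: s1.
  by rewrite /ppreim unfold_in linmapD // linmapN // yE addrK.
Qed.

Lemma chain_image n N : submod_closed N -> chain n N ->
  exists m, chain m (pimage N).
Proof.
elim: n N => [|n IH] N SN /=.
  by move=> N0; exists 0%N => _ /asboolP[x /N0-> ->]; exact: linmap0.
move=> [N0 [S0 /(IH _ S0)[m cm] st]].
have [sub|st'] := pimage_step SN st.
  by exists m; apply: chain_sub sub cm; apply: pimage_sub; case: st.
by exists m.+1, (pimage N0); split=> //; exact: pimage_submod.
Qed.

Lemma chain_preim n N b : submod_closed N -> chain n N ->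
  chain b [pred x | f x == 0] -> exists m, chain m (ppreim N).
Proof.
move=> + + c0; elim: n N => [|n IH] N SN /=.
  move=> N0; exists b; apply: chain_sub c0 => x; rewrite inE.
    by move=> /eqP fx; rewrite /ppreim unfold_in fx SN.1.
  by rewrite /ppreim unfold_in => /N0 ->.
move=> [N0 [S0 /(IH _ S0)[m cm] st]].
have [sub|st'] := ppreim_step S0 SN st.
  by exists m; apply: chain_sub sub cm; apply: ppreim_sub; case: st.
by exists m.+1, (ppreim N0); split=> //; exact: ppreim_submod.
Qed.

End Maps.

Lemma predT_submod (M : lmodType K) : submod_closed (predT : {pred M}).
Proof. by []. Qed.

Lemma finite_length_exact : exact_closed (@finite_length K).
Proof.
move=> A B C f g lf lg gf ex /finite_lengthP[n cA] /finite_lengthP[m cC].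
have [b cb] := chain_image lf (predT_submod A) cA.
have [|k ck] := chain_preim lg (predT_submod C) cC (b := b).
  apply: chain_sub cb => x; rewrite inE.
    by move=> /asboolP[a _ ->]; rewrite gf.
  by move=> /eqP/ex[a <-]; exact: mem_pimage.
by apply/finite_lengthP; exists k.
Qed.

(** Each simple step [N0 < N] of [B] counts for at most one of [A] and [C]. With [I] the part of [N]
    in the image of [f], either [N0 + I] is [N0] and the preimages in [A] agree, or it is [N] and
    the images in [C] agree. *)
Lemma chain_split (A B C : lmodType K) (f : A -> B) (g : B -> C) :
  linmap f -> linmap g -> (forall a, g (f a) = 0) ->
  (forall b, g b = 0 -> exists a, f a = b) -> injective f ->
  forall n N, submod_closed N -> chain n N ->
  exists a c, [/\ chain a (ppreim f N), chain c (pimage g N) & (a + c <= n)%N].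
Proof.
move=> lf lg gf ex injf; elim=> [|n IH] N SN /=.
  move=> N0; exists 0%N, 0%N; split=> // [x|_ /asboolP[x /N0 -> ->]].
    by move=> /N0; rewrite -(linmap0 lf) => /injf.
  exact: linmap0.
move=> [N0 [S0 /(IH _ S0)[a [c [ca cc le]]] st]]; have [sub nsub simp] := st.
pose I : {pred B} := pimage f (ppreim f N).
have SI : submod_closed I by apply/pimage_submod/ppreim_submod.
case: (simp (psum N0 I)) => [|||sub'|sub'].
- exact: psum_submod.
- exact: sub_psuml.
- by apply: psum_sub => // _ /asboolP[x Nx ->].
- have [subg|stg] := pimage_step lg SN st.
    exists a, c; split; last exact: leqW.
    + apply: chain_sub ca; first exact: ppreim_sub.
      move=> x Nx; apply: sub'; apply: sub_psumr => //; exact: mem_pimage.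
    + by apply: chain_sub cc; first exact: pimage_sub.
  exists a, c.+1; split; last by rewrite addnS.
  + apply: chain_sub ca; first exact: ppreim_sub.
    move=> x Nx; apply: sub'; apply: sub_psumr => //; exact: mem_pimage.
  + by exists (pimage g N0); split=> //; exact: pimage_submod.
- have subg : {subset pimage g N <= pimage g N0}.
    move=> _ /asboolP[y /sub' /asboolP[x [_ [Nx /asboolP[z _ ->] ->]]] ->].
    by rewrite linmapD // gf addr0 mem_pimage.
  have cc' : chain c (pimage g N).
    by apply: chain_sub cc; first exact: pimage_sub.
  have [subf|stf] := ppreim_step lf S0 SN st.
    exists a, c; split=> //; last exact: leqW.
    by apply: chain_sub ca; first exact: ppreim_sub.
  exists a.+1, c; split=> //.
  by exists (ppreim f N0); split=> //; exact: ppreim_submod.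
Qed.

Lemma has_len_split (A B C : lmodType K) (f : A -> B) (g : B -> C) n :
  linmap f -> linmap g -> (forall a, g (f a) = 0) ->
  (forall b, g b = 0 -> exists a, f a = b) -> injective f ->
  (forall c, exists b, g b = c) -> has_len B n ->
  exists a c, [/\ has_len A a, has_len C c & (a + c <= n)%N].
Proof.
move=> lf lg gf ex injf surj.
move=> /(chain_split lf lg gf ex injf (predT_submod B))[a [c [ca cc le]]].
exists a, c; split=> //; apply: chain_sub cc => // x _.
by have [b <-] := surj x; exact: mem_pimage.
Qed.

Lemma has_len_pos (M : lmodType K) n (x : M) :
  x != 0 -> has_len M n -> (0 < n)%N.
Proof. by case: n => // /eqP x0 /has_len0 h; case: x0; exact: h. Qed.

End Modules.

(** * Shifts and triangles *)

Section Equivalences.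
Variables (K : comPzRingType) (C E : lincat K).
Variables (F : functor C E) (G : functor E C).
Hypothesis eta : natiso (fcomp G F) (fid C).

Lemma equiv_faithful X Y (f g : mor X Y) : fmap F f = fmap F g -> f = g.
Proof.
move=> fg.
have e1 (h : mor X Y) : h = nto eta Y \c fmap G (fmap F h) \c nfrom eta X.
  by rewrite (nto_nat eta h) -compmA (nfromK eta) compm1.
by rewrite (e1 f) (e1 g) fg.
Qed.

End Equivalences.

Lemma equiv_full (K : comPzRingType) (C E : lincat K)
    (F : functor C E) (G : functor E C)
    (eta : natiso (fcomp G F) (fid C)) (eps : natiso (fcomp F G) (fid E))
    X Y (g : mor (F X) (F Y)) : exists f : mor X Y, fmap F f = g.
Proof.
exists (nto eta Y \c fmap G g \c nfrom eta X).
apply: (equiv_faithful eps).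
set f := _ \c _ \c _.
have fE : nto eta Y \c fmap G (fmap F f) = nto eta Y \c fmap G g.
  by rewrite (nto_nat eta f) -compmA (ntoK eta) compm1.
have := congr1 (fun u => nfrom eta Y \c u) fE.
by rewrite !compmA (ntoK eta) !comp1m.
Qed.

Section Pretri.
Variables (K : comPzRingType) (D : pretri K).
Implicit Types X Y Z M : D.

Lemma homiso X X' Y Y' : isomorphic X X' -> isomorphic Y Y' ->
  liniso (mor X Y) (mor X' Y').
Proof.
move=> [f [f' [f'f ff']]] [g [g' [g'g gg']]].
exists (fun u => g \c u \c f'), (fun u => g' \c u \c f); split.
- by move=> a x y; rewrite comp_linearr comp_linearl.
- by move=> u; rewrite !compmA g'g comp1m -compmA f'f compm1.
- by move=> u; rewrite !compmA gg' comp1m -compmA ff' compm1.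
Qed.

Lemma susp_inj X Y (f g : mor X Y) : fmap susp f = fmap susp g -> f = g.
Proof. exact: (equiv_faithful (suspK (p := D))). Qed.
Lemma susp_full X Y (g : mor (susp X) (susp Y)) :
  exists f : mor X Y, fmap susp f = g.
Proof. exact: (equiv_full (suspK (p := D)) (desuspK (p := D))). Qed.

Lemma iso_suspK X : isomorphic (desusp (susp X)) X.
Proof.
by exists (nto suspK X), (nfrom suspK X); rewrite (ntoK suspK) (nfromK suspK).
Qed.
Lemma iso_desuspK X : isomorphic (susp (desusp X)) X.
Proof.
exists (nto desuspK X), (nfrom desuspK X).
by rewrite (ntoK desuspK) (nfromK desuspK).
Qed.

Lemma hom_susp X Y : liniso (mor X Y) (mor (susp X) (susp Y)).
Proof.
have [inv invE] := choice (fun g => @susp_full X Y g).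
exists (fmap susp), inv; split=> [a f g|f|g]; rewrite ?fmap_linear //.
by apply: susp_inj; rewrite invE.
Qed.

Lemma shiftS M k : isomorphic (susp M.[k]) M.[k + 1].
Proof.
case: k => [n|[|n]]; first by rewrite -PoszD addn1; exact: iso_refl.
  exact: iso_desuspK.
have -> : Negz n.+1 + 1 = Negz n by rewrite !NegzE; lia.
exact: iso_desuspK.
Qed.
Lemma shiftP M k : isomorphic (desusp M.[k]) M.[k - 1].
Proof.
case: k => [[|n]|n].
- exact: iso_refl.
- have -> : n.+1%:Z - 1 = n by lia.
  exact: iso_suspK.
- have -> : Negz n - 1 = Negz n.+1 by rewrite !NegzE; lia.
  exact: iso_refl.
Qed.

Lemma shift_iso M N k : isomorphic M N -> isomorphic M.[k] N.[k].
Proof.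
move=> MN; case: k => n /=; elim: n => [|n IH] //=; exact: fmap_iso.
Qed.

Lemma shiftD M a b : isomorphic (M.[a]).[b] M.[a + b].
Proof.
case: b => n.
  elim: n => [|n IH]; first by rewrite addr0; exact: iso_refl.
  have -> : a + n.+1%:Z = a + n + 1 by lia.
  exact: iso_trans (fmap_iso susp IH) (shiftS _ _).
elim: n => [|n IH]; first exact: shiftP.
have -> : a + Negz n.+1 = a + Negz n - 1 by rewrite !NegzE; lia.
exact: iso_trans (fmap_iso desusp IH) (shiftP _ _).
Qed.

Lemma hom_desusp X Y : liniso (mor X Y) (mor (desusp X) (desusp Y)).
Proof.
apply/liniso_sym/(liniso_trans (hom_susp _ _)).
by apply: homiso; exact: iso_desuspK.
Qed.

Lemma hom_shiftK X Y a : liniso (mor X.[a] Y.[a]) (mor X Y).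
Proof.
case: a => n; elim: n => [|n IH].
- exact: liniso_refl.
- by apply: liniso_trans IH; apply/liniso_sym/hom_susp.
- exact/liniso_sym/hom_desusp.
- by apply: liniso_trans IH; apply/liniso_sym/hom_desusp.
Qed.

Lemma hom_shift X Y a b c : b = c + a ->
  liniso (mor X.[a] Y.[b]) (mor X Y.[c]).
Proof.
move=> ->; apply: liniso_trans (hom_shiftK X Y.[c] a).
by apply: homiso; [exact: iso_refl | exact/iso_sym/shiftD].
Qed.

Section HomP.
Variables (Phi : lmodType K -> Prop) (exPhi : exact_closed Phi).

Definition homP X Y (k : int) := Phi (mor X Y.[k]).

Lemma homP_iso X X' Y Y' k : isomorphic X X' -> isomorphic Y Y' ->
  homP X Y k <-> homP X' Y' k.
Proof.
move=> XX' YY'; have := homiso XX' (shift_iso k YY').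
move=> e; split; first exact: exact_closed_iso e.
exact: (exact_closed_iso exPhi (liniso_sym e)).
Qed.

Lemma homP_shift X Y a b k : homP X.[a] Y.[b] k <-> homP X Y (k + b - a).
Proof.
have e : liniso (mor X.[a] (Y.[b]).[k]) (mor X Y.[k + b - a]).
  apply: liniso_trans (_ : liniso (mor X.[a] Y.[b + k]) _).
    by apply: homiso; [exact: iso_refl | exact: shiftD].
  by apply: hom_shift; rewrite addrNK addrC.
split; first exact: exact_closed_iso e.
exact: (exact_closed_iso exPhi (liniso_sym e)).
Qed.

Lemma homP_shiftl X Y a k : homP X.[a] Y k <-> homP X Y (k - a).
Proof. by have := homP_shift X Y a 0 k; rewrite addr0. Qed.
Lemma homP_shiftr X Y b k : homP X Y.[b] k <-> homP X Y (k + b).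
Proof. by have := homP_shift X Y 0 b k; rewrite subr0. Qed.
Lemma homP_suspl X Y k : homP (susp X) Y k <-> homP X Y (k - 1).
Proof. exact: (homP_shiftl X Y 1 k). Qed.
Lemma homP_suspr X Y k : homP X (susp Y) k <-> homP X Y (k + 1).
Proof. exact: (homP_shiftr X Y 1 k). Qed.
(** Moving the degree to the source turns a statement in degree [k] into one about plain morphisms,
    the form in which compactness and the lifting lemmas apply. *)
Lemma homP_left X Y k : homP X Y k <-> Phi (mor X.[- k] Y).
Proof.
have := homP_shiftl X Y (- k) 0; rewrite /homP /= add0r opprK => h.
by split=> /h.
Qed.

Lemma homP_retractr X Y Z k (i : mor Y X) (p : mor X Y) : p \c i = idm Y ->
  homP Z X k -> homP Z Y k.
Proof.
move=> pi; rewrite !homP_left.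
apply: (exact_closed_inj exPhi (f := fun u => i \c u)).
  by move=> a x y; rewrite comp_linearr.
by move=> u v uv; rewrite -[u]comp1m -[v]comp1m -pi -!compmA uv.
Qed.
Lemma homP_retractl X Y Z k (i : mor Y X) (p : mor X Y) : p \c i = idm Y ->
  homP X Z k -> homP Y Z k.
Proof.
move=> pi; apply: (exact_closed_inj exPhi (f := fun u => u \c p)).
  by move=> a x y; rewrite comp_linearl.
by move=> u v uv; rewrite -[u]compm1 -[v]compm1 -pi !compmA uv.
Qed.

End HomP.
End Pretri.

Section Triangles.
Variables (K : comPzRingType) (D : pretri K).
Hypothesis tri : triangulated D.
Implicit Types X Y Z M : D.

Lemma zero_mor X Y (f : mor X Y) : is_zero X -> f = 0.
Proof. by move=> zX; rewrite -[f]compm1 zX compm0. Qed.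
Lemma mor_zero X Y (f : mor X Y) : is_zero Y -> f = 0.
Proof. by move=> zY; rewrite -[f]comp1m zY comp0m. Qed.
Lemma zero_susp X : is_zero X -> is_zero (susp X).
Proof. by rewrite /is_zero -fmap1 => ->; rewrite fmap0. Qed.
Lemma zero_desusp X : is_zero X -> is_zero (desusp X).
Proof. by rewrite /is_zero -fmap1 => ->; rewrite fmap0. Qed.
Lemma zero_shift X k : is_zero X -> is_zero X.[k].
Proof.
by move=> zX; case: k => n /=; elim: n => [|n IH] //=;
  do ?[exact: zero_susp | exact: zero_desusp].
Qed.

Lemma dist_comp0 X Y Z (f : mor X Y) (g : mor Y Z) (h : mor Z (susp X)) :
  dist f g h -> g \c f = 0.
Proof.
move=> d; have [Z0 z0] := (tr_additive tri).1.
have [|c [-> _]] := tr_fill tri (a := idm X) (b := f) (tr_id tri X z0) d.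
  by [].
by rewrite compm0.
Qed.

Lemma dist_rot X Y Z (f : mor X Y) (g : mor Y Z) (h : mor Z (susp X)) :
  dist f g h -> dist g h (- fmap susp f).
Proof. by move/(tr_rot tri). Qed.

Lemma dist_comp0' X Y Z (f : mor X Y) (g : mor Y Z) (h : mor Z (susp X)) :
  dist f g h -> h \c g = 0.
Proof. by move/dist_rot; exact: dist_comp0. Qed.

(** The identity triangle of [C], rotated once, maps to the rotation of the given triangle by [u]
    and 0. The third component desuspends to the lift, and the signs of the two rotations cancel. *)
Lemma dist_lift X Y Z (f : mor X Y) (g : mor Y Z) (h : mor Z (susp X)) C
    (u : mor C Y) : dist f g h -> g \c u = 0 -> exists v, f \c v = u.
Proof.
move=> d gu; have [Z0 z0] := (tr_additive tri).1.
have d1 := dist_rot (tr_id tri C z0).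
have [|c [_ cE]] := tr_fill tri (a := u) (b := 0) d1 (dist_rot d).
  by rewrite gu comp0m.
have [v vE] := susp_full c; exists v; apply: susp_inj.
apply: oppr_inj; rewrite fmapM vE -compNl cE fmap1.
by rewrite compNr compm1.
Qed.

Lemma dist_ext X Y Z (f : mor X Y) (g : mor Y Z) (h : mor Z (susp X)) C
    (w : mor Y C) : dist f g h -> w \c f = 0 -> exists v, v \c g = w.
Proof.
move=> d wf; have [Z0 z0] := (tr_additive tri).1.
have d1 : dist (0 : mor Z0 C) (idm C) (0 : mor C (susp Z0)).
  apply/(tr_rot tri); rewrite fmap0 oppr0; apply: (tr_id tri).
  exact: zero_susp.
have [|c [cE _]] := tr_fill tri (a := 0) (b := w) d d1.
  by rewrite wf comp0m.
by exists c; rewrite -cE comp1m.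
Qed.

Lemma cocone X Z (h : mor Z (susp X)) :
  exists Y (f : mor X Y) (g : mor Y Z), dist f g h.
Proof.
have [e [e' [e'e ee']]] := iso_desuspK Z.
have [k kE] := susp_full (- (h \c e)).
have [Y [f [l d]]] := tr_cone tri k.
exists Y, f, (e \c l).
apply: (tr_iso tri (a := idm X) (b := idm Y) (c := e)) (dist_rot d).
- by exists (idm X); rewrite !comp1m.
- by exists (idm Y); rewrite !comp1m.
- by exists e'.
- by rewrite compm1 comp1m.
- by rewrite compm1.
- by rewrite fmap1 comp1m kE opprK.
Qed.

Lemma fibre Y Z (g : mor Y Z) :
  exists X (f : mor X Y) (h : mor Z (susp X)), dist f g h.
Proof.
have [C [k [l d]]] := tr_cone tri g.
have [e [e' [e'e ee']]] := iso_desuspK C.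
have [f fE] := susp_full (- (l \c e)).
exists (desusp C), f, (e' \c k); apply/(tr_rot tri).
apply: (tr_iso tri (a := idm Y) (b := idm Z) (c := e')) d.
- by exists (idm Y); rewrite !comp1m.
- by exists (idm Z); rewrite !comp1m.
- by exists e.
- by rewrite compm1 comp1m.
- by rewrite compm1.
- by rewrite fmap1 comp1m fE opprK -compmA ee' compm1.
Qed.

(** Complete the zero map [Z -> susp Y] to a triangle. It splits, so its middle term [W] is a
    biproduct of [Y] and [Z], and [i1 \c r + i2 \c g] identifies it with [X]. *)
Lemma dist_split X Y Z (i1 : mor Y X) (i2 : mor Z X) (p1 : mor X Y)
    (p2 : mor X Z) :
  p1 \c i1 = idm Y -> p2 \c i2 = idm Z -> p1 \c i2 = 0 -> p2 \c i1 = 0 ->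
  i1 \c p1 + i2 \c p2 = idm X -> dist i1 p2 0.
Proof.
move=> p1i1 p2i2 p1i2 p2i1 sum.
have [W [f [g d]]] := cocone (0 : mor Z (susp Y)).
have [s sE] : exists s, g \c s = idm Z.
  by apply: dist_lift (dist_rot d) _; rewrite comp0m.
have f_mono C (u : mor C Y) : f \c u = 0 -> u = 0.
  move=> fu; apply: susp_inj; rewrite fmap0.
  have [|v <-] := dist_lift (u := fmap susp u) (dist_rot (dist_rot d)).
    by rewrite compNl -fmapM fu fmap0 oppr0.
  by rewrite comp0m.
have [r rE] : exists r, f \c r = idm W - s \c g.
  apply: dist_lift d _.
  by rewrite compBr compmA sE comp1m compm1 subrr.
have rf : r \c f = idm Y.
  apply/eqP; rewrite -subr_eq0; apply/eqP/f_mono.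
  rewrite compBr compmA rE compBl comp1m compm1 -compmA (dist_comp0 d).
  by rewrite compm0 subr0 subrr.
have rs : r \c s = 0.
  by apply: f_mono; rewrite compmA rE compBl -compmA sE comp1m compm1 subrr.
apply: (tr_iso tri (a := idm Y) (b := i1 \c r + i2 \c g) (c := idm Z)) (d).
- by exists (idm Y); rewrite !comp1m.
- exists (f \c p1 + s \c p2); split.
    rewrite compDl !compDr -!compmA (compmA p1 i1) (compmA p1 i2).
    rewrite (compmA p2 i1) (compmA p2 i2) p1i1 p1i2 p2i1 p2i2.
    by rewrite !comp0m !compm0 !comp1m addr0 add0r rE subrK.
  rewrite compDl !compDr -!compmA (compmA r f) (compmA r s).
  rewrite (compmA g f) (compmA g s) rf rs sE (dist_comp0 d).
  by rewrite !comp0m !compm0 !comp1m addr0 add0r.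
- by exists (idm Z); rewrite !comp1m.
- by rewrite compm1 compDl -!compmA rf (dist_comp0 d) compm1 compm0 addr0.
- by rewrite compDr !compmA p2i1 p2i2 comp0m add0r.
- by rewrite comp0m compm0.
Qed.

Section LongExact.
Variables (Phi : lmodType K -> Prop) (exPhi : exact_closed Phi).
Variables (X Y Z : D) (f : mor X Y) (g : mor Y Z) (h : mor Z (susp X)).
Hypothesis d : dist f g h.

Lemma phi_mid C : Phi (mor C X) -> Phi (mor C Z) -> Phi (mor C Y).
Proof.
apply: (exPhi (f := fun u => f \c u) (g := fun u => g \c u)).
- by move=> a x y; rewrite comp_linearr.
- by move=> a x y; rewrite comp_linearr.
- by move=> u; rewrite compmA (dist_comp0 d) comp0m.
- by move=> u; exact: dist_lift d.
Qed.

Lemma homP_mid C k : homP Phi C X k -> homP Phi C Z k -> homP Phi C Y k.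
Proof. by rewrite !(homP_left exPhi); exact: phi_mid. Qed.

Lemma homP_midl C k : homP Phi X C k -> homP Phi Z C k -> homP Phi Y C k.
Proof.
move=> PX PZ; rewrite /homP.
apply: (exPhi (f := fun u => u \c g) (g := fun u => u \c f)) PZ PX.
- by move=> a x y; rewrite comp_linearl.
- by move=> a x y; rewrite comp_linearl.
- by move=> u; rewrite -compmA (dist_comp0 d) compm0.
- by move=> u; exact: dist_ext d.
Qed.

End LongExact.

Section LongExactRotated.
Variables (Phi : lmodType K -> Prop) (exPhi : exact_closed Phi).
Variables (X Y Z : D) (f : mor X Y) (g : mor Y Z) (h : mor Z (susp X)).
Hypothesis d : dist f g h.

Lemma homP_cone C k :
  homP Phi C Y k -> homP Phi C X (k + 1) -> homP Phi C Z k.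
Proof.
move=> PY PX; apply: (homP_mid exPhi (dist_rot d)) PY _.
exact/(homP_suspr exPhi).
Qed.
Lemma homP_fibre C k :
  homP Phi C Z k -> homP Phi C Y (k + 1) -> homP Phi C X (k + 1).
Proof.
move=> PZ PY; apply/(homP_suspr exPhi).
apply: (homP_mid exPhi (dist_rot (dist_rot d))) PZ _.
exact/(homP_suspr exPhi).
Qed.
Lemma homP_conel C k :
  homP Phi X C k -> homP Phi Y C (k + 1) -> homP Phi Z C (k + 1).
Proof.
move=> PX PY; apply: (homP_midl exPhi (dist_rot d)) PY _.
by apply/(homP_suspl exPhi); rewrite addrK.
Qed.
Lemma homP_fibrel C k :
  homP Phi Y C k -> homP Phi Z C (k + 1) -> homP Phi X C k.
Proof.
move=> PY PZ; rewrite -[k](addrK 1); apply/(homP_suspl exPhi).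
apply: (homP_midl exPhi (dist_rot (dist_rot d))) PZ _.
by apply/(homP_suspl exPhi); rewrite addrK.
Qed.

End LongExactRotated.

End Triangles.

(** * Truncations *)

Section Coproducts.
Variables (K : comPzRingType) (C : lincat K).
Variables (I : choiceType) (M : I -> C) (Y : C) (inj : forall i, mor (M i) Y).
Hypothesis coY : is_coproduct inj.

Lemma coprod_ext Z (f g : mor Y Z) :
  (forall i, f \c inj i = g \c inj i) -> f = g.
Proof.
move=> fg; have [h [_ hU]] := coY (fun i => f \c inj i).
by rewrite -(hU f) // -(hU g).
Qed.

Lemma coprod_proj m : exists p : mor Y (M m),
  p \c inj m = idm (M m) /\ forall n, n != m -> p \c inj n = 0.
Proof.
(* A Kronecker delta; on the diagonal the identity is transported along the equality of indices. *)
pose c n : mor (M n) (M m) :=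
  if pselect (n = m) is left e then ecast m (mor (M n) (M m)) e (idm (M n))
  else 0.
have [p [pE _]] := coY c; exists p; split=> [|n /eqP nm]; rewrite pE /c.
  by case: pselect => // e; rewrite eq_axiomK.
by case: pselect.
Qed.

End Coproducts.

Local Notation hv := (homP (@null _)).

Section Vanishing.
Variables (K : comPzRingType) (D : pretri K).
Implicit Types X Y Z : D.

Lemma compact_shiftk X k : compact_ob X -> compact_ob X.[k].
Proof.
have [cs cd] := compact_shift D.
by move=> cX; case: k => n; elim: n => [|n IH] //=;
  do ?[exact: cs | exact: cd].
Qed.

Lemma hv_coprodr (I : choiceType) (M : I -> D) Y
    (inj : forall i, mor (M i) Y) C k :
  is_coproduct inj -> compact_ob C -> (forall i, hv C (M i) k) -> hv C Y k.
Proof.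
move=> coY /(compact_shiftk (- k)) cC hM; apply/(homP_left (@null_exact K)) => f.
have [s [g [_ ->]]] := (cC _ _ _ _ coY).1 f.
rewrite big1_seq // => i _.
by rewrite ((homP_left (@null_exact K) C (M i) k).1 (hM i) (g i)) compm0.
Qed.

Lemma hv_coprodl (I : choiceType) (M : I -> D) Y
    (inj : forall i, mor (M i) Y) Z k :
  is_coproduct inj -> (forall i, hv (M i) Z k) -> hv Y Z k.
Proof.
move=> coY hM f; apply: (coprod_ext coY) => i.
by rewrite comp0m; exact: hM.
Qed.

End Vanishing.

(** * Telescopes and maps into them from compact objects *)

Section Telescope.
Variables (K : comPzRingType) (D : pretri K).
Hypothesis tri : triangulated D.
Variables (U : nat -> D) (s : forall n, mor (U n) (U n.+1)).
Variables (S : D) (inj : forall n, mor (U n) S).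
Hypothesis coS : is_coproduct inj.
Variable sigma : mor S S.
Hypothesis sigmaE : forall n, sigma \c inj n = inj n.+1 \c s n.
Variables (H : D) (q : mor S H) (delta : mor H (susp S)).
Hypothesis d : dist (idm S - sigma) q delta.

(* With [p m] the projections, [pi 0 = p 0] and [pi m.+1 = p m.+1 + s m pi m]
   one has [pi m (1 - sigma) = p m]. *)
Lemma telescope_inj C (x : mor C S) : compact_ob C ->
  (idm S - sigma) \c x = 0 -> x = 0.
Proof.
move=> cC dx.
pose p m : mor S (U m) := projT1 (cid (coprod_proj coS m)).
have pid m : p m \c inj m = idm (U m) by rewrite /p; case: cid => ? [].
have pne m n : n != m -> p m \c inj n = 0.
  by rewrite /p; case: cid => ? [_] /=; exact.
have pi_exists m : exists pi : mor S (U m), pi \c (idm S - sigma) = p m.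
  elim: m => [|m [pi piE]].
    exists (p 0%N); apply: (coprod_ext coS) => n.
    rewrite compBr compm1 compBl -(compmA _ sigma) sigmaE compmA.
    by rewrite [p _ \c inj n.+1]pne // comp0m subr0.
  exists (p m.+1 + s m \c pi); rewrite compDl -compmA piE.
  apply: (coprod_ext coS) => n.
  rewrite compDl compBr compm1 compBl -(compmA _ sigma) sigmaE !compmA.
  rewrite -(compmA (s m)).
  have [->|nm] := eqVneq n m.
    by rewrite !pid compm1 comp1m subrK.
  by rewrite [p _ \c inj n.+1]pne ?eqSS // [p m \c _]pne // compm0 comp0m
    subr0 addr0.
have px m : p m \c x = 0.
  by have [pi <-] := pi_exists m; rewrite -compmA dx compm0.
have [r [g [ur xE]]] := (cC _ _ _ _ coS).1 x.
rewrite xE big1_seq // => m mr.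
suff -> : g m = 0 by rewrite compm0.
have /andP[_ {}mr] := mr.
rewrite -[RHS](px m) xE comp_sumr (bigD1_seq m) //= compmA pid comp1m.
rewrite big1 ?addr0 // => n nm.
by rewrite compmA pne // comp0m.
Qed.

(** Since [idm S - sigma] is injective on maps from compact objects, [delta] kills [c], which
    therefore lifts to the coproduct [S]. Compactness leaves finitely many stages, and these are
    pushed along [s] to a common one. *)
Lemma telescope_factor C (c : mor C H) : compact_ob C ->
  exists N (z : mor C (U N)), c = q \c inj N \c z.
Proof.
move=> cC.
have dc : delta \c c = 0.
  have [e [e' [e'e ee']]] := iso_desuspK C.
  have [x xE] := susp_full (delta \c c \c e).
  have x0 : x = 0.
    apply: telescope_inj; first exact: (compact_shift D).2.
    apply: susp_inj; rewrite fmapM xE fmap0 !compmA.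
    have := dist_comp0' tri (dist_rot tri d).
    rewrite compNl => /eqP; rewrite oppr_eq0 => /eqP ->.
    by rewrite !comp0m.
  by rewrite -[LHS]compm1 -ee' compmA -xE x0 fmap0 comp0m.
have [y <-] := dist_lift tri (dist_rot tri d) dc.
have qE n : q \c inj n = q \c inj n.+1 \c s n.
  have := dist_comp0 tri d; move=> /(congr1 (fun u => u \c inj n)).
  rewrite compBr compm1 compBl comp0m => /eqP; rewrite subr_eq0 => /eqP ->.
  by rewrite -!compmA sigmaE.
have push m n (z : mor C (U m)) : exists z' : mor C (U (m + n)),
    q \c inj m \c z = q \c inj (m + n)%N \c z'.
  elim: n => [|n [z' ->]]; first by rewrite addn0; exists z.
  by rewrite addnS; exists (s _ \c z'); rewrite qE !compmA.
have [r [g [_ ->]]] := (cC _ _ _ _ coS).1 y.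
elim: r => [|m r [N [z zE]]].
  by exists 0%N, 0; rewrite big_nil !compm0.
have [z1 z1E] := push N m z; have [z2 z2E] := push m N (g m).
rewrite big_cons compDr compmA z2E zE z1E.
rewrite addnC in z1 {z1E} *.
by exists (m + N)%N, (z2 + z1); rewrite compDr.
Qed.

End Telescope.

(** * Truncation at a compact object without positive self-extensions *)

Section Truncation.
Variables (K : comPzRingType) (D : pretri K).
Hypotheses (tri : triangulated D) (coprods : has_coproducts D).
Variable T : D.
Hypotheses (cT : compact_ob T) (hTT : forall k : int, 0 < k -> hv T T k).
Let nx := @null_exact K.

(** Two features of the aisle generated by [T] that survive coproducts and cones, and hence reach
    the telescope. The orthogonality is asked in all degrees at most 0 because the cone argument
    uses degree [k - 1] as well. *)
Definition aisle_like (U : D) :=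
  (forall k : int, 0 < k -> hv T U k) /\
  (forall Y : D, (forall k : int, k <= 0 -> hv T Y k) ->
     forall k : int, k <= 0 -> hv U Y k).

Lemma aisle_like_cells (I : choiceType) (n : I -> nat) (Y : D)
    (inj : forall i, mor T.[n i] Y) : is_coproduct inj -> aisle_like Y.
Proof.
move=> coY; split=> [k k0|Z hZ k k0].
  apply: hv_coprodr coY cT _ => i.
  by apply/(homP_shiftr nx); apply: hTT; lia.
apply: hv_coprodl coY _ => i.
by apply/(homP_shiftl nx)/hZ; lia.
Qed.

Lemma aisle_like_coprod (I : choiceType) (M : I -> D) (Y : D)
    (inj : forall i, mor (M i) Y) :
  is_coproduct inj -> (forall i, aisle_like (M i)) -> aisle_like Y.
Proof.
move=> coY aM; split=> [k k0|Z hZ k k0].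
  by apply: hv_coprodr coY cT _ => i; exact: (aM i).1.
by apply: hv_coprodl coY _ => i; exact: (aM i).2.
Qed.

Lemma aisle_like_cone X Y Z (f : mor X Y) (g : mor Y Z) h :
  dist f g h -> aisle_like X -> aisle_like Y -> aisle_like Z.
Proof.
move=> d [X1 X2] [Y1 Y2]; split=> [k k0|W hW k k0].
  by apply: (homP_cone tri nx d); [exact: Y1 | apply: X1; lia].
rewrite -(subrK 1 k); apply: (homP_conel tri nx d).
  by apply: X2 => //; lia.
by rewrite subrK; apply: Y2.
Qed.

Variable W : D.

(* [stage n.+1] is obtained from [stage n] by coning off all maps from
   nonnegative shifts of [T] that vanish in [W]. Hence a map from such a shift to
   the telescope that vanishes in [W], which factors through a stage by
   compactness, is killed at the next one. *)
Record stage := Stage {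
  st_ob : D;
  st_map : mor st_ob W;
  st_aisle : aisle_like st_ob }.

(** All maps from nonnegative shifts of [T] index the coproduct; [phi] sends those to be ignored to
    0, so that no subfamily has to be indexed. *)
Lemma cells_exist (U : D) (phi : forall n : nat, mor T.[n] U -> mor T.[n] U) :
  exists (P : D) (inj : forall c : {n : nat & mor T.[n] U}, mor T.[tag c] P)
    (p : mor P U),
    [/\ aisle_like P, is_coproduct inj & forall c, p \c inj c = phi _ (tagged c)].
Proof.
have [P [inj coP]] :=
  coprods (fun c : {n : nat & mor T.[n] U} => T.[tag c]).
have [p [pE _]] := coP _ (fun c => phi _ (tagged c)).
by exists P, inj, p; split=> //; exact: aisle_like_cells coP.
Qed.

Lemma first_stage : exists a : stage,
  forall (n : nat) (f : mor T.[n] W), exists v, st_map a \c v = f.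
Proof.
have [P [inj [p [aP _ pE]]]] := cells_exist (fun n (f : mor T.[Posz n] W) => f).
exists (Stage p aP) => n f; exists (inj (existT _ n f)).
exact: (pE (existT _ n f)).
Qed.

Lemma next_stage (a : stage) : exists (b : stage)
    (s : mor (st_ob a) (st_ob b)), st_map b \c s = st_map a /\
  forall (n : nat) (f : mor T.[n] (st_ob a)), st_map a \c f = 0 -> s \c f = 0.
Proof.
case: a => U u aU /=.
have [P [inj [p [aP coP pE]]]] :=
  cells_exist (fun n (f : mor T.[Posz n] U) => if u \c f == 0 then f else 0).
have up : u \c p = 0.
  apply: (coprod_ext coP) => c; rewrite comp0m -compmA pE.
  by case: eqP => // _; rewrite compm0.
have [V [s [h d]]] := tr_cone tri p.
have [v vs] := dist_ext tri d up.
exists (Stage v (aisle_like_cone d aP aU)), s; split=> // n f uf.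
have pf := pE (existT _ n f); rewrite /= uf eqxx in pf.
by rewrite -pf compmA (dist_comp0 tri d) comp0m.
Qed.

Definition next (a : stage) : stage := sval (cid (next_stage a)).
Definition nexts (a : stage) : mor (st_ob a) (st_ob (next a)) :=
  sval (cid (proj2_sig (cid (next_stage a)))).
Lemma nextsE (a : stage) : st_map (next a) \c nexts a = st_map a /\
  forall (n : nat) (f : mor T.[n] (st_ob a)),
    st_map a \c f = 0 -> nexts a \c f = 0.
Proof. rewrite /next /nexts; case: cid => b bP; exact (proj2_sig (cid bP)). Qed.

(** [U] is the telescope [H] and [V] the cone of [w : H -> W]. On maps from nonnegative shifts of
    [T], [w] is onto by the first stage and injective by the later ones, so no such map to [V] is
    nonzero. *)
Lemma truncation : exists (U V : D) (f : mor U W) (g : mor W V)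
    (h : mor V (susp U)),
  [/\ dist f g h, aisle_like U & forall k : int, k <= 0 -> hv T V k].
Proof.
have [a0 a0E] := first_stage.
pose a n := iter n next a0; pose U n := st_ob (a n).
pose u n : mor (U n) W := st_map (a n).
pose s n : mor (U n) (U n.+1) := nexts (a n).
have us n : u n.+1 \c s n = u n by exact: (nextsE (a n)).1.
have s0 (m : nat) n (f : mor T.[m] (U n)) : u n \c f = 0 -> s n \c f = 0.
  exact: (nextsE (a n)).2.
have [S [inj coS]] := coprods U.
have [sigma [sigmaE _]] := coS _ (fun n => inj n.+1 \c s n).
have [H [q [delta d]]] := tr_cone tri (idm S - sigma).
have aS : aisle_like S.
  by apply: aisle_like_coprod coS _ => n; exact: st_aisle.
have aH : aisle_like H := aisle_like_cone d aS aS.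
have [v [vE _]] := coS _ u.
have [|w wE] := dist_ext tri (w := v) d.
  apply: (coprod_ext coS) => n.
  by rewrite comp0m compBr compBl compm1 -compmA sigmaE compmA !vE us subrr.
have wq n : w \c q \c inj n = u n by rewrite wE vE.
have w_inj (m : nat) (y : mor T.[m] H) : w \c y = 0 -> y = 0.
  have [|N [z ->]] := telescope_factor tri coS sigmaE d y.
    exact: compact_shiftk.
  rewrite !compmA wq => uz.
  have qE : q \c inj N = q \c inj N.+1 \c s N.
    have := dist_comp0 tri d; move=> /(congr1 (fun u => u \c inj N)).
    rewrite compBr compm1 compBl comp0m => /eqP; rewrite subr_eq0 => /eqP ->.
    by rewrite -!compmA sigmaE.
  by rewrite qE -!compmA s0 // !compm0.
have [V [g [h d']]] := tr_cone tri w.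
exists H, V, w, g, h; split=> // k k0; apply/(homP_left nx) => x.
have [n nE] : exists n : nat, - k = n by exists `|k|%N; lia.
rewrite nE in x *.
(* For the source [T] itself, [h \c x] lies in [Hom(T, H[1])], which is zero in the aisle. For
   higher shifts it desuspends, and injectivity of [w] applies. *)
have hx : h \c x = 0.
  case: n nE x => [|n] nE x.
    by have := aH.1 1 isT; move=> /(_ (h \c x)).
  have [y yE] := susp_full (h \c x : mor (susp T.[n]) (susp H)).
  rewrite -yE (w_inj n y) ?fmap0 //.
  apply: susp_inj; rewrite fmapM yE compmA fmap0.
  have := dist_comp0' tri (dist_rot tri d').
  by rewrite compNl => /eqP; rewrite oppr_eq0 => /eqP ->; rewrite comp0m.
have [y <-] := dist_lift tri (dist_rot tri d') hx.
have [z <-] := a0E n y.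
have := wq 0%N; rewrite /u /= => <-.
by rewrite !compmA (dist_comp0 tri d') !comp0m.
Qed.

End Truncation.

Lemma sval_shift (K : comPzRingType) (D : pretri K) (P : D -> Prop)
    (hP : shift_closed P) (X : subcat hP) k : sval X.[k] = (sval X).[k].
Proof.
by case: k => n; elim: n => [|n IH] //=; congr (fob _ _); exact: IH.
Qed.

Lemma homP_sub (K : comPzRingType) (D : pretri K) (P : D -> Prop)
    (hP : shift_closed P) Phi (X Y : subcat hP) k :
  homP Phi X Y k = homP Phi (sval X) (sval Y) k.
Proof. by rewrite /homP -sval_shift. Qed.

(** * Silting objects *)

Section BoundedFiniteLength.
Variables (K : comPzRingType) (D : pretri K).
Hypothesis tri : triangulated D.
Implicit Types X Y Z C M : D.
Local Notation hfl := (homP (@finite_length K)).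
Let nx := @null_exact K.
Let fx := @finite_length_exact K.

Definition hbdd C M := exists n : nat, forall k : int, (n < `|k|)%N -> hv C M k.
Definition hbfl C M := (forall k, hfl C M k) /\ hbdd C M.

Lemma null_finite_length (M : lmodType K) : null M -> finite_length M.
Proof. by move=> nM; apply/finite_lengthP; exists 0%N => x _; exact: nM. Qed.

Lemma hbfl_mid C X Y Z (f : mor X Y) (g : mor Y Z) h : dist f g h ->
  hbfl C X -> hbfl C Z -> hbfl C Y.
Proof.
move=> d [fX [n nX]] [fZ [m mZ]]; split.
  by move=> k; apply: (homP_mid tri fx d).
exists (maxn n m) => k; rewrite gtn_max => /andP[nk mk].
by apply: (homP_mid tri nx d); [exact: nX | exact: mZ].
Qed.

Lemma hbfl_midl C X Y Z (f : mor X Y) (g : mor Y Z) h : dist f g h ->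
  hbfl X C -> hbfl Z C -> hbfl Y C.
Proof.
move=> d [fX [n nX]] [fZ [m mZ]]; split.
  by move=> k; apply: (homP_midl tri fx d).
exists (maxn n m) => k; rewrite gtn_max => /andP[nk mk].
by apply: (homP_midl tri nx d); [exact: nX | exact: mZ].
Qed.

Lemma hbfl_shiftl C X a : hbfl X C -> hbfl X.[a] C.
Proof.
move=> [fX [n nX]]; split=> [k|]; first exact/(homP_shiftl fx).
by exists (n + `|a|)%N => k nk; apply/(homP_shiftl nx)/nX; lia.
Qed.

Lemma bfl_mid X Y Z (f : mor X Y) (g : mor Y Z) h : dist f g h ->
  bfl X -> bfl Z -> bfl Y.
Proof.
by move=> d bX bZ C cC; apply: (hbfl_mid d); [exact: bX | exact: bZ].
Qed.

Lemma bfl_cone X Y Z (f : mor X Y) (g : mor Y Z) h : dist f g h ->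
  bfl X -> bfl Y -> bfl Z.
Proof.
by move=> d bX bY; apply: (bfl_mid (dist_rot tri d)) => //; exact: (bfl_shift D).1.
Qed.

Lemma bfl_shiftk X k : bfl X -> bfl X.[k].
Proof.
have [bs bd] := bfl_shift D.
by move=> bX; case: k => n; elim: n => [|n IH] //=; do ?[exact: bs | exact: bd].
Qed.

Lemma bfl_iso X Y : isomorphic X Y -> bfl X -> bfl Y.
Proof.
move=> XY bX C cC; have [fX [n nX]] := bX C cC; have CC := iso_refl C.
split=> [k|]; first exact: ((homP_iso fx k CC XY).1 (fX k)).
by exists n => k nk; exact: ((homP_iso nx k CC XY).1 (nX k nk)).
Qed.

Lemma bfl_fibre X Y Z (f : mor X Y) (g : mor Y Z) h : dist f g h ->
  bfl Y -> bfl Z -> bfl X.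
Proof.
move=> d bY bZ; apply: (bfl_iso (iso_suspK X)); apply: (bfl_shift D).2.
exact: bfl_cone (dist_rot tri d) bY bZ.
Qed.

Lemma bfl_retract X Y (i : mor Y X) (p : mor X Y) : p \c i = idm Y ->
  bfl X -> bfl Y.
Proof.
move=> pi bX C cC; have [fX [n nX]] := bX C cC; change (hbfl C Y); split.
  by move=> k; exact: (homP_retractr fx pi (fX k)).
by exists n => k nk; apply: (homP_retractr nx pi); exact: nX.
Qed.

Lemma bfl_zero X : is_zero X -> bfl X.
Proof.
move=> zX C cC; change (hbfl C X); have h k : hv C X k.
  by move=> f; apply: mor_zero; exact: zero_shift.
by split=> [k|]; [exact: null_finite_length (h k) | exists 0%N].
Qed.

End BoundedFiniteLength.

Section Silting.
Variables (K : comPzRingType) (D : pretri K).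
Hypotheses (tri : triangulated D) (cg : compactly_generated D).
Hypothesis hD : forall M : D, compact_ob M -> bfl M.
Variable T : cptcat D.
Hypothesis silt : silting T.
Local Notation t := (sval T).
Local Notation t0 := (cpt_to_bfl hD T).
Implicit Types W X Y Z U V : D.
Let nx := @null_exact K.
Let fx := @finite_length_exact K.
Let ct : compact_ob t := proj2_sig T.

Lemma silting_hv k : 0 < k -> hv t t k.
Proof. by move=> k0; rewrite -homP_sub => f; exact: silt.1. Qed.

(** Restricting [P] to the compact objects gives a thick subcategory of [cptcat D]; devissage can
    then be run on predicates over [D]. *)
Lemma silting_ind (P : D -> Prop) : thick P -> P t ->
  forall C, compact_ob C -> P C.
Proof.
move=> [[Ps Pd] Pe Pm] Pt C cC.
apply: (silt.2 (fun c : cptcat D => P (sval c)) _ Pt (exist _ C cC)).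
split.
- by split=> -[X cX]; [exact: Ps | exact: Pd].
- by move=> [X cX] [Y cY] [Z cZ] f g h; exact: Pe.
- move=> [X cX] [Y cY] [[Z cZ] [i1 [i2 [p1 [p2 b]]]]]; apply: Pm.
  by exists Z, i1, i2, p1, p2.
Qed.

Lemma silting_zero M : (forall k, hv t M k) -> is_zero M.
Proof.
move=> h; have [_ [I [S [cS dS]]]] := cg; apply: dS => i k.
move: k; change (forall k : int, hv (S i) M k).
apply: (silting_ind (P := fun C => forall k : int, hv C M k)) => //.
split.
- split=> X hX k; first exact/(homP_suspl nx).
  exact/(homP_shiftl nx X M (- 1) k).
- by move=> X Y Z f g h' d hX hZ k; apply: (homP_midl tri nx d).
- move=> X Y [Z [i1 [i2 [p1 [p2 [e _ _ _ _]]]]]] hY k.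
  exact: (homP_retractl nx e).
Qed.

Lemma bfl_test M : hbfl t M -> bfl M.
Proof.
move=> h; apply: (silting_ind (P := fun C => hbfl C M)) => //; split.
- split=> X hX; first exact: (hbfl_shiftl 1 hX).
  exact: (hbfl_shiftl (- 1) hX).
- by move=> X Y Z f g h' d; exact: (hbfl_midl tri d).
- move=> X Y [Z [i1 [i2 [p1 [p2 [e _ _ _ _]]]]]] [fY [n nY]]; split.
    by move=> k; apply: (homP_retractl fx e).
  by exists n => k nk; apply: (homP_retractl nx e); exact: nY.
Qed.

(** [truncation] is applied to [t[-n]]. Bounded finite length persists because it can be tested on
    [t]: there [V] vanishes up to degree [n] and is controlled by [W] above it, where [U]
    vanishes. *)
Lemma truncation_at (n : int) W : bfl W ->
  exists U V (f : mor U W) (g : mor W V) (h : mor V (susp U)),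
  [/\ dist f g h, bfl U /\ bfl V, forall k, n < k -> hv t U k,
      forall k, k <= n -> hv t V k &
      forall Y, (forall k, k <= n -> hv t Y k) -> hv U Y 0].
Proof.
move=> bW.
have tE Y k : hv t.[- n] Y k <-> hv t Y (k + n).
  by rewrite (homP_shiftl nx) opprK.
have [||U [V [f [g [h [d [U1 U2] V1]]]]]] :=
  @truncation K D tri cg.1 t.[- n] _ _ W.
- exact: compact_shiftk.
- by move=> k k0; apply/tE/(homP_shiftr nx); rewrite addrK; exact: silting_hv.
have hU k : n < k -> hv t U k.
  by move=> nk; rewrite -[k](subrK n); apply/tE/U1; lia.
have hV k : k <= n -> hv t V k.
  by move=> nk; rewrite -[k](subrK n); apply/tE/V1; lia.
have bV : bfl V.
  apply: bfl_test; have [fW [m mW]] := bW t ct; split=> [k|].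
    have [kn|nk] := leP k n; first exact/null_finite_length/hV.
    apply: (homP_cone tri fx d); first exact: fW.
    by apply/null_finite_length/hU; lia.
  exists m => k mk; have [kn|nk] := leP k n; first exact: hV.
  apply: (homP_cone tri nx d); first exact: mW.
  by apply: hU; lia.
exists U, V, f, g, h; split=> //; first by split=> //; exact: bfl_fibre d bW bV.
by move=> Y hY; apply: U2 => // k k0; apply/tE/hY; lia.
Qed.

(** Truncate [Z] at 0. If [Z] is orthogonal, then [Z -> V] is zero and [Z] is a retract of [U]. If
    [Hom(t, Z[k])] vanishes for [k > 0], then [Hom(t, V[k])] vanishes for all [k] and [V] is
    zero. *)
Lemma gen_le0P (Z : bflcat D) :
  gen_le0 t0 Z <-> forall k, 0 < k -> hv t (sval Z) k.
Proof.
have [U [V [f [g [h [d [bU bV] hU hV oU]]]]]] := truncation_at 0 (proj2_sig Z).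
split=> [gZ k k0|hZ Y hY u].
  have g0 : g = 0.
    apply: (gZ (exist _ V bV : bflcat D)) => j j0.
    change (hv t0 (exist _ V bV : bflcat D) j); rewrite homP_sub.
    exact: hV.
  have [s sE] : exists s, f \c s = idm (sval Z).
    by apply: dist_lift d _ => //; rewrite g0 comp0m.
  by apply: (homP_retractr nx sE); exact: hU.
have zV : is_zero V.
  apply: silting_zero => k; have [k0|k0] := leP k 0; first exact: hV.
  apply: (homP_cone tri nx d); first exact: hZ.
  by apply: hU; lia.
have : hv (sval Z) (sval Y) 0.
  apply: (homP_midl tri nx d).
    by apply: oU => k k0; rewrite -[t]/(sval t0) -homP_sub; exact: hY.
  by move=> v; exact: zero_mor.
exact.
Qed.
End Silting.

(** * Additive closures and approximations by sums of copies of an object *)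

Section AddGen.
Variable K : comPzRingType.

(** Writing [idm X] as a finite sum of maps through [T] makes [X] a retract of a power of [T]
    without naming the power. This form composes and is preserved by functors; [in_addP] relates it
    to [in_add]. *)
Definition add_gen (C : lincat K) (T X : C) :=
  exists s : seq (mor T X * mor X T), \sum_(c <- s) c.1 \c c.2 = idm X.

Lemma add_gen_retract (C : lincat K) (T Y X : C) (r : mor Y X) (j : mor X Y) :
  r \c j = idm X -> add_gen T Y -> add_gen T X.
Proof.
move=> rj [s sE]; exists [seq (r \c c.1, c.2 \c j) | c <- s].
rewrite big_map /= -rj -[j in RHS]comp1m -sE comp_suml comp_sumr.
by apply: eq_bigr => c _; rewrite !compmA.
Qed.

Lemma add_gen_trans (C : lincat K) (T Y X : C) :
  add_gen T Y -> add_gen Y X -> add_gen T X.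
Proof.
move=> [s sE] [r rE].
exists [seq (d.1 \c c.1, c.2 \c d.2) | d <- r, c <- s].
rewrite big_allpairs_dep /= -rE; apply: eq_bigr => d _.
rewrite -[d.2 in RHS]comp1m -sE comp_suml comp_sumr.
by apply: eq_bigr => c _; rewrite !compmA.
Qed.

Lemma add_gen_fmap (C E : lincat K) (F : functor C E) (T X : C) :
  add_gen T X -> add_gen (F T) (F X).
Proof.
move=> [s sE]; exists [seq (fmap F c.1, fmap F c.2) | c <- s].
rewrite big_map -fmap1 -sE fmap_sum; apply: eq_bigr => c _.
by rewrite fmapM.
Qed.

Section Additive.
Variable C : lincat K.
Implicit Types T X Y Z : C.

Lemma retract_summand X Y (i : mor X Y) (r : mor Y X) :
  split_idempotents C -> r \c i = idm X -> is_summand X Y.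
Proof.
move=> split ri; pose e := idm Y - i \c r.
have ei : e \c i = 0 by rewrite /e compBl -compmA ri compm1 comp1m subrr.
have re : r \c e = 0 by rewrite /e compBr compmA ri compm1 comp1m subrr.
have ee : e \c e = e by rewrite {2}/e compBr compmA ei comp0m subr0 compm1.
have [Z [p [j [pj jp]]]] := split _ _ ee.
exists Z, i, j, r, p; split=> //.
- by rewrite -[j]compm1 -pj (compmA j) jp compmA re comp0m.
- by rewrite -[p]comp1m -pj -(compmA p j) jp -compmA ei compm0.
- by rewrite jp /e addrC subrK.
Qed.

Lemma summand_zero Z X : is_zero Z -> is_summand Z X.
Proof.
move=> zZ; exists X, 0, (idm X), 0, (idm X).
by rewrite !compm0 !comp1m !compm1 !add0r -zZ.
Qed.

Definition biproduct_closed (P : C -> Prop) :=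
  (forall X, is_zero X -> P X) /\
  (forall X Y Z, is_biproduct X Y Z -> P Y -> P Z -> P X).

Hypothesis addC : additive_cat C.

Lemma power_exists T n : exists Y (inj : 'I_n -> mor T Y) (p : 'I_n -> mor Y T),
  [/\ forall i j, p i \c inj j = if i == j then idm T else 0,
      \sum_i inj i \c p i = idm Y &
      forall P, biproduct_closed P -> P T -> P Y].
Proof.
elim: n => [|n [Y [inj [p [pE sumE clE]]]]].
  have [Z zZ] := addC.1; exists Z, (fun=> 0), (fun=> 0).
  by rewrite big_ord0; split=> [[]//||P [Pz _] _]; last exact: Pz.
have [X [i1 [i2 [p1 [p2 [p1i1 p2i2 p1i2 p2i1 sum]]]]]] := addC.2 T Y.
exists X, (fun i => oapp (fun j => i2 \c inj j) i1 (unlift ord0 i)).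
exists (fun i => oapp (fun j => p j \c p2) p1 (unlift ord0 i)).
split=> [i j||P [Pz Pb] PT].
- case: (unliftP ord0 i) => [i' ->|->]; case: (unliftP ord0 j) => [j' ->|->] /=.
  + rewrite -compmA (compmA p2) p2i2 comp1m pE.
    by rewrite (inj_eq (@lift_inj _ ord0)).
  + by rewrite -compmA p2i1 compm0.
  + by rewrite compmA p1i2 comp0m.
  + by [].
- rewrite big_ord_recl unlift_none /= -sum; congr (_ + _).
  rewrite -[p2 in RHS]comp1m -sumE comp_suml comp_sumr.
  by apply: eq_bigr => i _; rewrite liftK /= !compmA.
- apply: (Pb X T Y) => //; last by apply: clE.
  by exists i1, i2, p1, p2.
Qed.

Lemma in_addP T X : split_idempotents C -> in_add T X <-> add_gen T X.
Proof.
move=> split; split=> [[n [Y [inj [coY [Z [j [_ [r [_ [rj _ _ _ _]]]]]]]]]]|].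
  apply: add_gen_retract rj _.
  pose p i : mor Y T := sval (cid (coprod_proj coY i)).
  have pid i : p i \c inj i = idm T by rewrite /p; case: cid => ? [].
  have pne i k : k != i -> p i \c inj k = 0.
    by rewrite /p; case: cid => ? [_] /=; exact.
  exists [seq (inj i, p i) | i <- enum 'I_n].
  rewrite big_map big_enum /=; apply: (coprod_ext coY) => k.
  rewrite comp_suml (bigD1 k) //= -compmA pid compm1 comp1m big1 ?addr0 //.
  by move=> i ik; rewrite -compmA pne ?compm0 // eq_sym.
move=> [s sE]; have [Y [inj [p [pE sumE _]]]] := power_exists T (size s).
exists (size s), Y, inj; split.
  move=> Z f; exists (\sum_i f i \c p i); split=> [j|g gE].
    rewrite comp_suml (bigD1 j) //= -compmA pE eqxx compm1 big1 ?addr0 //.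
    by move=> i ij; rewrite -compmA pE (negPf ij) compm0.
  rewrite -[g]compm1 -sumE comp_sumr; apply: eq_bigr => i _.
  by rewrite compmA gE.
pose c i := tnth (in_tuple s) i.
apply: (@retract_summand _ _ (\sum_i inj i \c (c i).2)
  (\sum_i (c i).1 \c p i)) => //.
rewrite comp_suml -sE [RHS]big_tnth; apply: eq_bigr => i _.
rewrite comp_sumr (bigD1 i) //= -compmA (compmA (p i)) pE eqxx comp1m.
rewrite big1 ?addr0 // => j ji.
by rewrite -compmA (compmA (p i)) pE eq_sym (negPf ji) comp0m compm0.
Qed.

Lemma right_approx T W : finite_length (mor T W) ->
  exists Y (phi : mor Y W), [/\ add_gen T Y,
    forall x : mor T W, exists y, phi \c y = x &
    forall P, biproduct_closed P -> P T -> P Y].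
Proof.
move=> /finite_length_fg[n [x xE]].
have [Y [inj [p [pE sumE clE]]]] := power_exists T n.
exists Y, (\sum_i x i \c p i); split=> //.
  exists [seq (inj i, p i) | i <- enum 'I_n].
  by rewrite big_map big_enum /= -sumE.
move=> y; have [a ->] := xE y; exists (\sum_i a i *: inj i).
rewrite comp_sumr; apply: eq_bigr => i _.
rewrite compZr comp_suml (bigD1 i) //= -compmA pE eqxx compm1 big1 ?addr0 //.
by move=> j ji; rewrite -compmA pE (negPf ji) compm0.
Qed.

(** Finitely many generators of the module [Hom(M, F T)] are the components of [phi]. The functor
    [F] is there for [susp]: the approximation then maps into a suspension and can be the last map
    of a triangle. *)
Lemma left_approx (E : lincat K) (F : functor C E) (M : E) T :
  finite_length (mor M (F T)) ->
  exists Y (phi : mor M (F Y)),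
    [/\ add_gen T Y, forall x : mor M (F T), exists y, y \c phi = x &
        forall P, biproduct_closed P -> P T -> P Y].
Proof.
move=> /finite_length_fg[n [x xE]].
have [Y [inj [p [pE sumE clE]]]] := power_exists T n.
exists Y, (\sum_i fmap F (inj i) \c x i); split=> //.
  exists [seq (inj i, p i) | i <- enum 'I_n].
  by rewrite big_map big_enum /= -sumE.
move=> y; have [a ->] := xE y; exists (\sum_i a i *: fmap F (p i)).
rewrite comp_suml; apply: eq_bigr => i _.
rewrite compZl comp_sumr (bigD1 i) //= compmA -fmapM pE eqxx fmap1 comp1m.
rewrite big1 ?addr0 // => j ji.
by rewrite compmA -fmapM pE eq_sym (negPf ji) fmap0 comp0m.
Qed.

End Additive.

Section AddGenVanishing.
Variable D : pretri K.
Hypothesis tri : triangulated D.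
Let nx := @null_exact K.

Lemma hv_gen_l (T Y C : D) k : add_gen T Y -> hv T C k -> hv Y C k.
Proof.
move=> [s sE] h f; rewrite -[f]compm1 -sE comp_sumr big1_seq // => c _.
by rewrite compmA (h (f \c c.1)) comp0m.
Qed.

Lemma hv_gen_r (T Y C : D) k : add_gen T Y -> hv C T k -> hv C Y k.
Proof.
move=> [s sE] /(homP_left nx) h; apply/(homP_left nx) => f.
rewrite -[f]comp1m -sE comp_suml big1_seq // => c _.
by rewrite -compmA (h (c.2 \c f)) compm0.
Qed.

Lemma biproduct_dist (X Y Z : D) : is_biproduct X Y Z ->
  exists (f : mor Y X) (g : mor X Z) h, dist f g h.
Proof.
move=> [i1 [i2 [p1 [p2 [e1 e2 e3 e4 e5]]]]].
by exists i1, p2, 0; exact: (dist_split tri e1 e2 e3 e4 e5).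
Qed.

Lemma ext_biproduct_closed (P : D -> Prop) : (forall X, is_zero X -> P X) ->
  extension_closed P -> biproduct_closed P.
Proof.
move=> Pz Pe; split=> // X Y Z /biproduct_dist[f [g [h d]]]; exact: Pe d.
Qed.

Lemma thick_biproduct_closed (P : D -> Prop) T : P T -> summand_closed P ->
  extension_closed P -> biproduct_closed P.
Proof.
move=> PT Ps; apply: ext_biproduct_closed => X zX.
by apply: Ps PT; exact: summand_zero.
Qed.

End AddGenVanishing.
End AddGen.

(** * The uniform bound *)

Section Monomorphisms.
Variables (K : comPzRingType) (D : pretri K).
Hypothesis tri : triangulated D.
Variables (X Y Z : D) (f : mor X Y) (g : mor Y Z) (h : mor Z (susp X)).
Hypothesis d : dist f g h.
Let nx := @null_exact K.

Lemma dist_mono C (u : mor C X) : hv C Z (- 1) -> f \c u = 0 -> u = 0.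
Proof.
move=> hZ fu; apply: susp_inj; rewrite fmap0.
have [|v <-] := dist_lift tri (u := fmap susp u) (dist_rot tri (dist_rot tri d)).
  by rewrite compNl -fmapM fu fmap0 oppr0.
have /(homP_shiftl nx C Z 1 0) hZ' : hv C Z (0 - 1) by rewrite sub0r.
by rewrite (hZ' v) compm0.
Qed.

Lemma hv_cone_mono C : hv C Y (- 1) ->
  (forall u : mor C X, f \c u = 0 -> u = 0) -> hv C Z (- 1).
Proof.
move=> hY f_mono; rewrite -[- 1]sub0r; apply/(homP_shiftl nx C Z 1 0).
suff v0 (v : mor (susp C) Z) : v = 0 by exact: v0.
have [y yE] := susp_full (h \c v).
have hv0 : h \c v = 0.
  rewrite -yE (f_mono y) ?fmap0 //; apply: susp_inj.
  rewrite fmapM yE compmA fmap0.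
  have := dist_comp0' tri (dist_rot tri d).
  by rewrite compNl => /eqP; rewrite oppr_eq0 => /eqP ->; rewrite comp0m.
have [w <-] := dist_lift tri (dist_rot tri d) hv0.
have /(homP_shiftl nx C Y 1 0) hY' : hv C Y (0 - 1) by rewrite sub0r.
by rewrite (hY' w) compm0.
Qed.

Lemma dist_epi C (u : mor C Z) : hv C X 1 -> exists v, g \c v = u.
Proof. by move=> hX; apply: (dist_lift tri (dist_rot tri d)); exact: hX. Qed.

Lemma has_len_cone C n : hv C X 1 ->
  (forall u : mor C X, f \c u = 0 -> u = 0) -> has_len (mor C Y) n ->
  exists a c, [/\ has_len (mor C X) a, has_len (mor C Z) c & (a + c <= n)%N].
Proof.
move=> hX f_mono.
apply: (has_len_split (f := fun u : mor C X => f \c u) (g := fun u => g \c u)).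
- by move=> a x y; rewrite comp_linearr.
- by move=> a x y; rewrite comp_linearr.
- by move=> u; rewrite compmA (dist_comp0 tri d) comp0m.
- by move=> u; exact: (dist_lift tri d).
- move=> u v uv; apply/eqP; rewrite -subr_eq0; apply/eqP/f_mono.
  by rewrite compBr uv subrr.
- by move=> u; exact: dist_epi.
Qed.

End Monomorphisms.

Section SiltingBounds.
Variables (K : comPzRingType) (D : pretri K).
Hypotheses (tri : triangulated D) (cg : compactly_generated D).
Hypothesis hD : forall M : D, compact_ob M -> bfl M.
Variable T : cptcat D.
Hypothesis silt : silting T.
Local Notation t := (sval T).
Local Notation t0 := (cpt_to_bfl hD T).
Implicit Types A W X Y Z U V : D.
Let nx := @null_exact K.
Let fx := @finite_length_exact K.
Let ct : compact_ob t := proj2_sig T.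
Let zero_hv M : (forall k, hv t M k) -> is_zero M.
Proof. exact: silting_zero. Qed.
Let trunc n W (bW : bfl W) := truncation_at tri cg silt n bW.

(** One step of dimension shifting: the approximation by copies of [t] is onto in degree 0, so [C]
    loses that degree and [C[-1]] is again in the aisle. *)
Lemma resolution W : bfl W -> (forall k, 0 < k -> hv t W k) ->
  exists Y C (phi : mor Y W) (g : mor W C) (h : mor C (susp Y)),
  [/\ dist phi g h, add_gen t Y, forall P, biproduct_closed P -> P t -> P Y,
      bfl Y /\ bfl C & forall k, 0 <= k -> hv t C k].
Proof.
move=> bW hW; have flW : finite_length (mor t W) by exact: (bW t ct).1 0.
have [Y [phi [gY epi clY]]] := right_approx (tr_additive tri) flW.
have [C [g [h d]]] := tr_cone tri phi.
have hY k : 0 < k -> hv t Y k.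
  by move=> k0; apply: hv_gen_r gY _; exact: silting_hv.
have bY : bfl Y.
  apply: (clY (@bfl K D)); last exact: hD.
  apply: (ext_biproduct_closed tri); first exact: bfl_zero.
  by move=> ? ? ? ? ? ? d'; exact: (bfl_mid tri d').
exists Y, C, phi, g, h; split=> //.
  by split=> //; exact: (bfl_cone tri d bY bW).
move=> k; rewrite le_eqVlt => /predU1P[<-|k0].
  move=> x; have [|w <-] := dist_epi tri d x; first exact: hY.
  have [y <-] := epi w; by rewrite compmA (dist_comp0 tri d) comp0m.
by apply: (homP_cone tri nx d); [exact: hW | apply: hY; lia].
Qed.

Lemma silting_tstructure : tstructure (gen_le0 t0) (gen_ge0 t0).
Proof.
split.
- split=> X Y [Z [i1 [i2 [p1 [p2 [e _ _ _ _]]]]]].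
    move=> LX V hV f; rewrite -[f]compm1 -e compmA.
    by rewrite (LX V hV (f \c p1)) comp0m.
  by move=> RX k k0; apply: (homP_retractr nx e); exact: RX.
- move=> X LX V hV; change (hv X.[1] V 0); apply/(homP_shiftl nx).
  apply: LX => k k0; apply/(homP_shiftr nx)/hV; lia.
- move=> X Y LX RY; apply: LX => k k0; apply/(homP_shiftr nx)/RY; lia.
move=> [M bM]; have [U [V [f [g [h [d [bU bV] hU hV _]]]]]] := trunc 0 bM.
pose V0 : bflcat D := exist _ V bV.
exists (exist _ U bU), V0, V0.[1], f, g, h; split=> //.
- exact/(gen_le0P tri cg hD silt).
- move=> k k0; apply/(homP_shiftr nx); rewrite homP_sub; apply: hV; lia.
- exact/iso_sym/(shiftD V0 1 (- 1)).
Qed.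

(** The hypotheses make [T'] relatively projective in the aisle. The cone [C] of an approximation by
    copies of [t] has [C[-1]] in the aisle, so [T' -> C] is zero and [T'] splits off. *)
Lemma silting_add (T' : cptcat D) : (forall k, 0 < k -> hv t (sval T') k) ->
  (forall Z, bfl Z -> (forall k, 0 < k -> hv t Z k) -> hv (sval T') Z 1) ->
  add_gen T T'.
Proof.
move=> hT' oT'.
have [Y [C [phi [g [h [d gY clY [bY bC] hC]]]]]] :=
  resolution (hD (proj2_sig T')) hT'.
have g0 : g = 0.
  have : hv (sval T') C.[- 1] 1.
    apply: oT' => [|k k0]; first exact: bfl_shiftk.
    by apply/(homP_shiftr nx)/hC; lia.
  by move/(homP_shiftr nx); exact.
have [|s sE] := dist_lift tri (u := idm (sval T')) d; first by rewrite g0 comp0m.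
exact: (add_gen_retract sE gY).
Qed.

Section UniformBound.
(** [Q X n] abstracts a cohomological vanishing condition on [X] in degree [n]; it is later the
    vanishing of [Hom(C, G(X)[n])] for a compact [C] and a triangle functor [G]. *)
Variable Q : D -> int -> Prop.
Hypothesis Qmid : forall X Y Z (f : mor X Y) (g : mor Y Z) (h : mor Z (susp X)) n,
  dist f g h -> bfl X -> bfl Z -> Q X n -> Q Z n -> Q Y n.
Hypothesis Qshift : forall X k n, bfl X -> Q X.[k] n <-> Q X (n + k).
Hypothesis Qzero : forall X n, is_zero X -> Q X n.
Hypothesis Qbounded : forall X, bfl X -> exists N, forall n, N <= n -> Q X n.

Definition heart S := bfl S /\ forall k, k != 0 -> hv t S k.
Definition coaisle V := bfl V /\ forall k, k < 0 -> hv t V k.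
Definition hmono S V (g : mor S V) := forall x : mor t S, g \c x = 0 -> x = 0.
Definition covers (F : D -> Prop) S := forall V (f : mor S V),
  coaisle V -> f <> 0 -> exists s (g : mor s V), [/\ F s, g <> 0 & hmono g].

(* If some nonzero [f : S -> V] is not injective on [Hom(t, -)], then [S] is an
   extension of the image of [f] by its kernel in the heart, both of smaller
   length, and their families together cover [S]. *)
Lemma cover_exists n S : heart S -> has_len (mor t S) n ->
  exists (F : D -> Prop) (N : int), covers F S /\
    forall s, F s -> heart s /\ forall m, N <= m -> Q s m.
Proof.
elim/ltn_ind: n S => n IH S hS lS.
have [mono|] := pselect (forall V (f : mor S V), coaisle V -> f <> 0 -> hmono f).
  have [N QN] := Qbounded hS.1.
  exists (eq S), N; split=> [V f cV f0|s <- //].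
  by exists S, f; split=> //; exact: mono.
move=> /existsNP[V /existsNP[f /not_implyP[cV /not_implyP[f0]]]].
move=> /existsNP[x /not_implyP[fx0 x0]].
have [F [a [h d]]] := fibre tri f.
have hF k : k < 0 -> hv t F k.
  move=> k0; rewrite -[k](subrK 1); apply: (homP_fibre tri nx d).
    by apply: cV.2; lia.
  by rewrite subrK; apply: hS.2; lia.
have bF : bfl F by exact: (bfl_fibre tri d hS.1 cV.1).
(* [F] has no negative degrees, so its truncation [M] is the kernel of [f] in the heart. *)
have [M [V1 [b [e [h1 [d1 [bM bV1] hM hV1 _]]]]]] := trunc 0 bF.
(* The image of [f] in the heart, as the cokernel of its kernel. *)
have [I [g [h2 d2]]] := tr_cone tri (a \c b).
have heartM : heart M.
  split=> // k kn0; have [k0|k0] := ltP 0 k; first exact: hM.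
  rewrite -[k](subrK 1); apply: (homP_fibre tri nx d1); first by apply: hV1; lia.
  by rewrite subrK; apply: hF; lia.
have ab_mono (y : mor t M) : a \c b \c y = 0 -> y = 0.
  rewrite -compmA => /(dist_mono tri d (cV.2 (- 1) isT)).
  by apply: (dist_mono tri d1); exact: hV1.
have heartI : heart I.
  split=> [|k k0]; first exact: (bfl_cone tri d2 bM hS.1).
  have [->|k1] := eqVneq k (- 1).
    by apply: (hv_cone_mono tri d2) => //; exact: hS.2.
  by apply: (homP_cone tri nx d2); [exact: hS.2 | apply: heartM.2; lia].
have [m [c [lM lI le]]] := has_len_cone tri d2 (heartM.2 1 isT) ab_mono lS.
(* The element [x] killed by [f] comes from [M], so [M] has positive length; that of [I] is positive
   as [f] is nonzero. Both are thus less than [n]. *)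
have [y yE] := dist_lift tri d fx0.
have [|z zE] := dist_lift tri d1 (u := y); first exact: (hV1 0).
have m0 : (0 < m)%N.
  apply: (has_len_pos (x := z)) lM; apply/eqP => z0.
  by apply: x0; rewrite -yE -zE z0 !compm0.
have fab : f \c (a \c b) = 0 by rewrite compmA (dist_comp0 tri d) comp0m.
have c0 : (0 < c)%N.
  case: (c) lI => // /has_len0 nI; case: f0.
  have [w <-] := dist_ext tri d2 fab.
  rewrite (zero_mor w) ?comp0m //; apply: zero_hv => k.
  by have [->|] := eqVneq k 0; [exact: nI | exact: heartI.2].
have [|FM [NM [covM QM]]] := IH m _ M heartM lM; first by lia.
have [|FI [NI [covI QI]]] := IH c _ I heartI lI; first by lia.
exists (fun s => FM s \/ FI s), (Num.max NM NI); split; last first.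
  move=> s [/QM|/QI] [hs Qs]; split=> // j; rewrite ge_max => /andP[? ?];
    exact: Qs.
(* A nonzero map out of [S] is nonzero on [M] or factors through [I]. *)
move=> V' f' cV' f'0; have [f'ab|f'ab] := pselect (f' \c (a \c b) = 0).
  have [w wE] := dist_ext tri d2 f'ab.
  have [|s [u [Fs u0 mu]]] := covI V' w cV'.
    by move=> w0; apply: f'0; rewrite -wE w0 comp0m.
  by exists s, u; split=> //; right.
have [s [u [Fs u0 mu]]] := covM V' _ cV' f'ab.
by exists s, u; split=> //; left.
Qed.

Section Cover.
Variables (A : D) (u : mor t A) (F : D -> Prop) (N : int).
Hypothesis uP : forall V (x : mor t V), coaisle V -> exists f, f \c u = x.
Hypothesis covF : covers F A.
Hypothesis FP : forall s, F s -> heart s /\ forall m, N <= m -> Q s m.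

(** A nonzero element of [Hom(t, V)] extends along [u] to a nonzero map [A -> V], and the cover
    supplies a nonzero map [s -> V] injective on [Hom(t, -)]. Its cone is again in the coaisle, with
    a shorter degree 0 part. *)
Lemma cover_step (m : nat) V l : coaisle V ->
  (forall k, m%:Z < k -> hv t V k) -> has_len (mor t V) l -> ~ null (mor t V) ->
  exists V' c, [/\ coaisle V', forall k, m%:Z < k -> hv t V' k,
    has_len (mor t V') c, (c < l)%N &
    forall n, N <= n -> Q V' n -> Q V n].
Proof.
move=> cV hV lV /existsNP[x x0].
have [f fE] := uP x cV.
have [|s [g [Fs g0 mg]]] := covF cV (f := f).
  by move=> f0; apply: x0; rewrite -fE f0 comp0m.
have [hs Qs] := FP Fs.
have [V' [g' [h d]]] := tr_cone tri g.
have [a [c [ls lV' le]]] := has_len_cone tri d (hs.2 1 isT) mg lV.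
have a0 : (0 < a)%N.
  case: (a) ls => // /has_len0 ns; case: g0; apply: zero_mor.
  by apply: zero_hv => k; have [->|] := eqVneq k 0; [exact: ns | exact: hs.2].
have bV' : bfl V' := bfl_cone tri d hs.1 cV.1.
exists V', c; split=> //.
- split=> // k k0; have [->|k1] := eqVneq k (- 1).
    by apply: (hv_cone_mono tri d) => //; exact: cV.2.
  by apply: (homP_cone tri nx d); [exact: cV.2 | apply: hs.2; lia].
- move=> k mk; apply: (homP_cone tri nx d); [exact: hV | apply: hs.2; lia].
- by lia.
- by move=> n Nn QV'; apply: (Qmid d hs.1 bV') => //; exact: Qs.
Qed.

(** Outer induction on the top degree [m], inner induction on the length of [Hom(t, V)]. Once that
    module is zero, either [m = 0] and [V] is zero, or [V[1]] is in the coaisle with top degree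
    [m - 1], at the cost of one degree in the bound. *)
Lemma cover_bound (m : nat) V : coaisle V -> (forall k, m%:Z < k -> hv t V k) ->
  forall n, N + m%:Z <= n -> Q V n.
Proof.
elim: m V => [|m IHm] V cV hV n Nn.
all: have /finite_lengthP[l lV] := (cV.1 t ct).1 0.
all: elim/ltn_ind: l V cV hV lV => l IHl V cV hV lV.
all: have [nV|nV] := pselect (null (mor t V)).
all: try by have [V' [c [cV' hV' lV' cl QV]]] := cover_step cV hV lV nV;
  apply: QV; [lia | exact: (IHl c)].
- apply/Qzero/zero_hv => k; have [->|k0] := eqVneq k 0; first exact: nV.
  by have [kn|kp] := ltP k 0; [exact: cV.2 | apply: hV; lia].
- rewrite -[n](subrK 1); apply/(Qshift 1 (n - 1) cV.1); apply: IHm; last by lia.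
    split=> [|k k0]; first exact: (bfl_shiftk 1 cV.1).
    apply/(homP_shiftr nx); have [->|k1] := eqVneq k (- 1).
      by rewrite addNr; exact: nV.
    by apply: cV.2; lia.
  by move=> k mk; apply/(homP_shiftr nx)/hV; lia.
Qed.

End Cover.

Lemma uniform_bound : exists N : int, forall W, bfl W ->
  (forall k, 0 < k -> hv t W k) -> forall n, N <= n -> Q W n.
Proof.
have bt : bfl t := hD ct.
(* Truncating [t] at -1 leaves its degree 0 part [A], through which every map from [t] to the
   coaisle factors. *)
have [U [A [e [u [h [d [bU bA] hU hA oU]]]]]] := trunc (- 1) bt.
have hTA : heart A.
  split=> // k k0; have [kn|kp] := leP k (- 1); first exact: hA.
  apply: (homP_cone tri nx d); last by apply: hU; lia.
  by apply: silting_hv => //; lia.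
have /finite_lengthP[l lA] := (bA t ct).1 0.
have [F [N [covF FP]]] := cover_exists hTA lA.
exists N => W bW hW n Nn; have [_ [m mW]] := bW t ct.
have uP V (x : mor t V) : coaisle V -> exists f, f \c u = x.
  move=> cV; apply: (dist_ext tri d).
  have : hv U V 0 by apply: oU => k k0; apply: cV.2; lia.
  exact.
(* If [W] lives in degrees from [-m] to 0, then [W[-m]] is in the coaisle with top degree [m]. The
   shift cancels the [m] in the bound of [cover_bound], so [N] does not depend on [W]. *)
rewrite -[n](addrK m%:Z); apply/(Qshift (- m%:Z) (n + m%:Z) bW).
apply: (cover_bound uP covF FP (m := m)); last by lia.
- split=> [|k k0]; first exact: bfl_shiftk.
  by apply/(homP_shiftr nx)/mW; lia.
- by move=> k mk; apply/(homP_shiftr nx)/hW; lia.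
Qed.

End UniformBound.
End SiltingBounds.

(** * Functors and adjunctions *)

Section TriangleFunctors.
Variable K : comPzRingType.

Lemma tf_zero (C E : lincat K) (G : functor C E) X : is_zero X -> is_zero (G X).
Proof. by rewrite /is_zero -fmap1 => ->; rewrite fmap0. Qed.

Lemma tf_shift (C E : pretri K) (G : trifunctor C E) X k :
  isomorphic (G X.[k]) (G X).[k].
Proof.
have Gs Z : isomorphic (G (susp Z)) (susp (G Z)).
  exists (nto (tf_susp G) Z), (nfrom (tf_susp G) Z).
  by split; [exact: (ntoK (tf_susp G)) | exact: (nfromK (tf_susp G))].
have Gd Z : isomorphic (G (desusp Z)) (desusp (G Z)).
  apply: iso_trans (iso_sym (iso_suspK _)) _; apply: fmap_iso.
  apply: iso_trans (iso_sym (Gs _)) _; apply: fmap_iso; exact: iso_desuspK.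
case: k => n; elim: n => [|n IH].
- exact: iso_refl.
- exact: iso_trans (Gs _) (fmap_iso susp IH).
- exact: Gd.
- exact: iso_trans (Gd _) (fmap_iso desusp IH).
Qed.

Lemma adj_hom (C E : lincat K) (L : functor C E) (R : functor E C)
  (a : adjunction L R) A B : liniso (mor (L A) B) (mor A (R B)).
Proof.
exists (fun u => fmap R u \c adj_unit a A), (fun v => adj_counit a B \c fmap L v).
split=> [c x y|u|v]; first by rewrite fmap_linear comp_linearl.
  by rewrite fmapM compmA counit_nat -compmA adj_unitK compm1.
by rewrite fmapM -compmA -unit_nat compmA adj_counitK comp1m.
Qed.

Lemma adj_inj (C E : lincat K) (L : functor C E) (R : functor E C)
    (a : adjunction L R) A B (u v : mor (L A) B) :
  fmap R u \c adj_unit a A = fmap R v \c adj_unit a A -> u = v.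
Proof.
move=> uv; have uE (w : mor (L A) B) :
    w = adj_counit a B \c fmap L (fmap R w \c adj_unit a A).
  by rewrite fmapM compmA counit_nat -compmA adj_unitK compm1.
by rewrite (uE u) uv -uE.
Qed.

Lemma counit_iso (C E : lincat K) (L : functor C E) (R : functor E C)
  (a : adjunction L R) B : fully_faithful R -> isomorphic (L (R B)) B.
Proof.
move=> ffR; have inj X Y (f g : mor X Y) : fmap R f = fmap R g -> f = g.
  by move=> fg; have [h [_ hU]] := ffR _ _ (fmap R f); rewrite -(hU f) // -(hU g).
have [phi [phiE _]] := ffR _ _ (adj_unit a (R B)).
have ephi : adj_counit a B \c phi = idm B.
  by apply: inj; rewrite fmapM phiE adj_counitK fmap1.
exists (adj_counit a B), phi; split=> //.
apply: (@adj_inj _ _ _ _ a (R B) (L (R B)));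
  rewrite fmapM -compmA adj_counitK compm1 phiE.
by rewrite fmap1 comp1m.
Qed.

Lemma adj_homP Phi (exPhi : exact_closed Phi) (C E : pretri K)
    (L : trifunctor C E) (R : trifunctor E C) (a : adjunction L R) A B k :
  homP Phi (L A) B k <-> homP Phi A (R B) k.
Proof.
have e : liniso (mor (L A) B.[k]) (mor A (R B).[k]).
  apply: liniso_trans (adj_hom a A B.[k]) _.
  by apply: homiso; [exact: iso_refl | exact: tf_shift].
split; first exact: exact_closed_iso e.
exact: (exact_closed_iso exPhi (liniso_sym e)).
Qed.

Lemma ff_homP Phi (exPhi : exact_closed Phi) (C E : pretri K)
    (G : trifunctor C E) A B k : fully_faithful G ->
  homP Phi (G A) (G B) k <-> homP Phi A B k.
Proof.
move=> ffG.
have e1 : liniso (mor A B.[k]) (mor (G A) (G B.[k])).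
  have [inv invE] := choice (fun g => ffG _ _ g : exists f : mor A B.[k], _).
  exists (fmap G), inv; split=> [c x y|f|g]; first exact: fmap_linear.
    by have [_] := invE (fmap G f); exact.
  by have [] := invE g.
have e : liniso (mor A B.[k]) (mor (G A) (G B).[k]).
  apply: liniso_trans e1 _.
  by apply: homiso; [exact: iso_refl | exact: tf_shift].
split; first exact: (exact_closed_iso exPhi (liniso_sym e)).
exact: exact_closed_iso e.
Qed.

End TriangleFunctors.

(** * Thick classes and devissage along a silting object *)

Section ThickClasses.
Variables (K : comPzRingType) (D : pretri K).
Hypothesis tri : triangulated D.
Implicit Types X Y Z J U : D.
Let nx := @null_exact K.

Lemma thick_retract (P : D -> Prop) X Y (i : mor Y X) (r : mor X Y) :
  summand_closed P -> r \c i = idm Y -> P X -> P Y.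
Proof. by move=> Ps ri; apply: Ps; exact: (retract_summand (tr_split tri) ri). Qed.

Lemma thick_iso (P : D -> Prop) X Y :
  summand_closed P -> isomorphic X Y -> P X -> P Y.
Proof. by move=> Ps [f [g [gf fg]]]; exact: (thick_retract Ps fg). Qed.

Lemma thick_shift (P : D -> Prop) X k : shift_closed P -> P X -> P X.[k].
Proof.
move=> [Ps Pd] PX; case: k => n; elim: n => [|n IH] //=;
  do ?[exact: Ps | exact: Pd].
Qed.

Lemma susp_hv_r C J U : in_susp J U -> (forall k, 0 < k -> hv C J k) ->
  forall k, 0 < k -> hv C U k.
Proof.
move=> sU hJ; apply: (sU (fun X => forall k, 0 < k -> hv C X k)) => //.
- move=> X Y Z f g h d hX hZ k k0.
  by apply: (homP_mid tri nx d); [exact: hX | exact: hZ].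
- move=> X Y [Z [i1 [i2 [p1 [p2 [e _ _ _ _]]]]]] hY k k0.
  by apply: (homP_retractr nx e); exact: hY.
- by move=> Y hY k k0; apply/(homP_suspr nx)/hY; lia.
Qed.

Lemma susp_hv_l J U Z (n : int) : in_susp J U -> (forall k, k <= n -> hv J Z k) ->
  forall k, k <= n -> hv U Z k.
Proof.
move=> sU hJ; apply: (sU (fun X => forall k, k <= n -> hv X Z k)) => //.
- move=> X Y W f g h d hX hZ k k0.
  by apply: (homP_midl tri nx d); [exact: hX | exact: hZ].
- move=> X Y [W [i1 [i2 [p1 [p2 [e _ _ _ _]]]]]] hY k k0.
  by apply: (homP_retractl nx e); exact: hY.
- by move=> Y hY k k0; apply/(homP_suspl nx)/hY; lia.
Qed.

Section SiltingThick.
Hypothesis cg : compactly_generated D.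
Hypothesis hD : forall M : D, compact_ob M -> bfl M.
Variable T : cptcat D.
Hypothesis silt : silting T.
Local Notation t := (sval T).

(* For [Z] in the aisle, [d] bounds the degrees in which [Hom(Z, -)] can be
   nonzero on the aisle; the fibre of an approximation of [Z] by copies of [t]
   lowers this bound, and [Z] is a summand of its approximation when [d = 0]. *)
Lemma silting_thick (P : D -> Prop) Z (N : int) : thick P -> P t -> bfl Z ->
  (forall W, bfl W -> (forall k, 0 < k -> hv t W k) ->
     forall n, N <= n -> hv Z W n) -> P Z.
Proof.
move=> [Psh Pe Ps] Pt.
have clP : biproduct_closed P by exact: (thick_biproduct_closed tri Pt Ps Pe).
suff main (d : nat) X : bfl X -> (forall k, 0 < k -> hv t X k) ->
    (forall W, bfl W -> (forall k, 0 < k -> hv t W k) ->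
      forall n, d%:Z < n -> hv X W n) -> P X.
  move=> bZ hZ; have [_ [m mZ]] := bZ _ (proj2_sig T).
  apply: (thick_iso Ps (_ : isomorphic (Z.[m]).[- m%:Z] Z)).
    by have := shiftD Z m (- m%:Z); rewrite subrr.
  apply: thick_shift => //; apply: (main (absz (N + m%:Z))).
  - exact: bfl_shiftk.
  - by move=> k k0; apply/(homP_shiftr nx)/mZ; lia.
  - by move=> W bW hW n Nn; apply/(homP_shiftl nx)/(hZ W bW hW); lia.
elim: d X => [|d IH] X bX hX oX.
all: have [Y [C [phi [g [h [dX gY clY [bY bC] hC]]]]]] :=
  resolution tri hD silt bX hX.
all: have hC1 k : 0 < k -> hv t C.[- 1] k by
  move=> k0; apply/(homP_shiftr nx)/hC; lia.
  have g0 : g = 0.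
    have : hv X C.[- 1] 1 by apply: oX => //; exact: bfl_shiftk.
    by move/(homP_shiftr nx); exact.
  have [|s sE] := dist_lift tri (u := idm X) dX; first by rewrite g0 comp0m.
  by apply: (thick_retract Ps sE); exact: clY.
apply: (Pe _ _ _ _ _ _ dX); first exact: clY.
apply: (thick_iso Ps (iso_desuspK C)); apply: Psh.1.
(* Copies of [t] have no maps to aisle objects in positive degrees, so [C] inherits the bound of [X]
   and [C[-1]] improves it by one. *)
apply: (IH C.[- 1]) => //; first exact: bfl_shiftk.
move=> W bW hW n dn; apply/(homP_shiftl nx); rewrite opprK.
apply: (homP_conel tri nx dX); last by apply: oX => //; lia.
by apply: (hv_gen_l gY); apply: hW; lia.
Qed.

End SiltingThick.
End ThickClasses.

(** * Compact objects through their detection in finite length *)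

Section CompactDetection.
Variables (K : comPzRingType) (D : pretri K).
Hypotheses (tri : triangulated D) (det : compact_detectable D).
Implicit Types X Y Z J M : D.
Let nx := @null_exact K.

Definition hbdd_above X := forall E, bfl E ->
  exists n : int, forall k, n <= k -> hv X E k.

Lemma compactE X : compact_ob X <-> bfl X /\ hbdd_above X.
Proof. exact: det. Qed.

Lemma compact_ext : extension_closed (@compact_ob K D).
Proof.
move=> X Y Z f g h d /compactE[bX aX] /compactE[bZ aZ]; apply/compactE.
split=> [|E bE]; first exact: (bfl_mid tri d bX bZ).
have [n hX] := aX E bE; have [m hZ] := aZ E bE; exists (Num.max n m) => k.
rewrite ge_max => /andP[nk mk].
by apply: (homP_midl tri nx d); [exact: hX | exact: hZ].
Qed.

Lemma compact_zero X : is_zero X -> compact_ob X.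
Proof.
move=> zX; apply/compactE; split=> [|E bE]; first exact: bfl_zero.
by exists 0 => k _ f; exact: zero_mor.
Qed.

Lemma compact_retract X Y (i : mor Y X) (r : mor X Y) :
  r \c i = idm Y -> compact_ob X -> compact_ob Y.
Proof.
move=> ri /compactE[bX aX]; apply/compactE; split=> [|E bE].
  exact: (bfl_retract ri).
have [n hX] := aX E bE; exists n => k nk.
by apply: (homP_retractl nx ri); exact: hX.
Qed.

Lemma compact_biproduct_closed : biproduct_closed (@compact_ob K D).
Proof.
by apply: (ext_biproduct_closed tri); [exact: compact_zero | exact: compact_ext].
Qed.

Lemma cptcat_additive : additive_cat (cptcat D).
Proof.
have [[Z zZ] bi] := tr_additive tri.
split; first by exists (exist _ Z (compact_zero zZ)).
move=> [Y cY] [W cW]; have [X b] := bi Y W.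
exists (exist _ X (compact_biproduct_closed.2 _ _ _ b cY cW)).
by have [i1 [i2 [p1 [p2 e]]]] := b; exists i1, i2, p1, p2.
Qed.

Lemma cptcat_split : split_idempotents (cptcat D).
Proof.
move=> [X cX] e ee; have [Y [p [i [pi ip]]]] := tr_split tri ee.
by exists (exist _ Y (compact_retract pi cX)), p, i.
Qed.

(* The top degree [N + 1] is killed first, by [Q -> M1 -> M -> Q[1]] with [Q] a
   sum of copies of [J[N]]; the octahedron on [Q -> M1 -> U1[1]] splices this
   with the triangle obtained by induction for [M1]. *)
Lemma approx_exists J (N : nat) M : compact_ob J -> bfl J ->
  (forall k, 0 < k -> hv J J k) -> compact_ob M ->
  (forall k, N%:Z < k -> hv M J k) ->
  exists (V U : D) (f : mor V M) (g : mor M (susp U)) (h : mor (susp U) (susp V)),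
    [/\ dist f g h, compact_ob V, in_susp J U & forall k, 0 < k -> hv V J k].
Proof.
move=> cJ bJ hJ; elim: N M => [|N IH] M cM hM.
  have [Z zZ] := (tr_additive tri).1.
  exists M, Z, (idm M), 0, 0; split=> //.
    by apply: (tr_id tri); exact: zero_susp.
  by move=> P PJ _ Ps _; apply: Ps PJ; exact: summand_zero.
have fl : finite_length (mor M (susp J.[N])) by exact: (bJ M cM).1 N.+1.
have [Q [phi [gQ lift clQ]]] := left_approx (tr_additive tri) fl.
have [M1 [p [a dp]]] := cocone tri phi.
have cQ : compact_ob Q.
  apply: (clQ (@compact_ob K D)); last exact: compact_shiftk.
  exact: compact_biproduct_closed.
have cM1 : compact_ob M1 by exact: (compact_ext dp).
have hQ k : N%:Z < k -> hv Q J k.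
  move=> Nk; apply: (hv_gen_l gQ); apply/(homP_shiftl nx)/hJ; lia.
have hM1 k : N%:Z < k -> hv M1 J k.
  move=> Nk; have [kE|kN] := eqVneq k N.+1; last first.
    by apply: (homP_midl tri nx dp); [exact: hQ | apply: hM; lia].
  rewrite {}kE in Nk * => y; have yp : y \c p = 0 by exact: hQ Nk _.
  have [y' <-] := dist_ext tri dp yp; have [psi <-] := lift y'.
  by rewrite -compmA (dist_comp0' tri dp) compm0.
have [V [U1 [v [w [h1 [dv cV sU1 hV]]]]]] := IH M1 cM1 hM1.
(* [U] is an extension of [Q] by [U1], whence its membership in the suspended closure of [J]. *)
have [U [x [y dU]]] := cocone tri (w \c p).
have [u [s [du _ _ _ _]]] := tr_octahedron tri dp (dist_rot tri dv)
  (dist_rot tri (dist_rot tri dU)).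
exists V, U, (a \c v), u, s; split=> //.
  apply/(tr_rot tri); rewrite fmapM; move: du; rewrite compNr; exact.
move=> P PJ Pe Ps Psusp; apply: (Pe _ _ _ _ _ _ dU); first exact: sU1.
apply: clQ; first exact: (thick_biproduct_closed tri PJ Ps Pe).
by elim: (N) => //= n; exact: Psusp.
Qed.

End CompactDetection.

(** * Triangle functors between bounded finite length parts *)

Section BflFunctors.
Variables (K : comPzRingType) (X D : pretri K).
Hypotheses (triX : triangulated X) (triD : triangulated D).
Variable G : trifunctor (bflcat X) (bflcat D).
Let nx := @null_exact K.

Lemma bfl_eq (E : pretri K) (A B : bflcat E) : sval A = sval B -> A = B.
Proof. by case: A B => [A bA] [B bB] /=; exact: eq_exist. Qed.

Lemma bflcat_iso (E : pretri K) (A B : bflcat E) :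
  isomorphic A B -> isomorphic (sval A) (sval B).
Proof. by []. Qed.

Lemma thick_preimage (P : D -> Prop) : thick P ->
  thick (fun M : X => exists b : bfl M, P (sval (G (exist _ M b)))).
Proof.
move=> [Psh Pe Ps]; split.
- have sh k M (b : bfl M) : P (sval (G (exist _ M b))) ->
      exists b' : bfl M.[k], P (sval (G (exist _ M.[k] b'))).
    move=> PM; pose A : bflcat X := exist _ M b; exists (bfl_shiftk k b).
    have -> : exist _ M.[k] (bfl_shiftk k b) = A.[k].
      by apply: bfl_eq; rewrite sval_shift.
    apply: (thick_iso triD Ps (bflcat_iso (iso_sym (tf_shift G A k)))).
    by rewrite sval_shift; exact: thick_shift.
  by split=> M [b]; [exact: (sh 1) | exact: (sh (- 1))].
- move=> A B C f g h d [bA PA] [bC PC]; have bB := bfl_mid triX d bA bC.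
  exists bB; have := tf_dist G (_ : @dist K (bflcat X) (exist _ A bA)
    (exist _ B bB) (exist _ C bC) f g h) => /(_ d) dG.
  exact: Pe dG PA PC.
- move=> A B [C [i1 [i2 [p1 [p2 [e _ _ _ _]]]]]] [bA PA].
  have bB := bfl_retract e bA; exists bB.
  pose A0 : bflcat X := exist _ A bA; pose B0 : bflcat X := exist _ B bB.
  have Ge : fmap G (p1 : mor A0 B0) \c fmap G (i1 : mor B0 A0) = idm (G B0).
    by rewrite -fmapM -fmap1; congr (fmap G _).
  exact: (@thick_retract K D triD P (sval (G A0)) (sval (G B0)) _ _ Ps Ge PA).
Qed.

Hypothesis cgX : compactly_generated X.
Hypothesis hX : forall M : X, compact_ob M -> bfl M.
Variable T : cptcat X.
Hypothesis silt : silting T.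
Local Notation t := (sval T).

(** [uniform_bound] is applied to the vanishing of [Hom(C, G(M)[n])]. Quantifying over proofs of
    [bfl M] extends this condition to all of [X], and proof irrelevance removes the choice. *)
Lemma functor_bound (C : D) : compact_ob C -> exists N : int,
  forall W : bflcat X, (forall k, 0 < k -> hv t (sval W) k) ->
  forall n, N <= n -> hv C (sval (G W)) n.
Proof.
move=> cC.
pose Q M n := forall b : bfl M, hv C (sval (G (exist _ M b))) n.
have [||||N QN] := uniform_bound triX cgX hX silt (Q := Q).
- move=> A B E f g h n d bA bE QA QE bB.
  have := tf_dist G (_ : @dist K (bflcat X) (exist _ A bA)
    (exist _ B bB) (exist _ E bE) f g h) => /(_ d) dG.
  exact: (homP_mid triD nx dG (QA bA) (QE bE)).
- move=> M k n bM.
  have e : hv C (sval (G (exist _ M bM : bflcat X).[k])) n <->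
      hv C (sval (G (exist _ M bM))) (n + k).
    rewrite -(homP_shiftr nx) -sval_shift.
    exact: (homP_iso nx n (iso_refl C) (bflcat_iso (tf_shift G _ k))).
  have bk : bfl M.[k] by exact: bfl_shiftk.
  have eM : exist _ M.[k] bk = (exist _ M bM : bflcat X).[k].
    by apply: bfl_eq; rewrite sval_shift.
  split=> QM b.
    by rewrite (Prop_irrelevance b bM); apply/e; rewrite -eM; exact: QM.
  by rewrite (Prop_irrelevance b bk) eM; apply/e; exact: QM.
- move=> M n zM b; have zG : is_zero (G (exist _ M b : bflcat X)).
    exact: (@tf_zero _ _ _ G (exist _ M b) zM).
  by apply/(homP_left nx) => f; apply: mor_zero.
- move=> M bM; have [_ [m mM]] := proj2_sig (G (exist _ M bM)) C cC.
  exists (m%:Z + 1) => n mn b; rewrite (Prop_irrelevance b bM).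
  by apply: mM; lia.
exists N => -[W bW] hW n Nn; exact: QN.
Qed.

(** Dimension shifting down from the bound of [functor_bound]. A resolution reduces degree [n] for
    [W] to degree [n] for [J] and degree [n + 1] for another aisle object; [d] measures the gap left
    to [N]. *)
Lemma functor_vanish (C : D) : compact_ob C ->
  let J := sval (G (cpt_to_bfl hX T)) in
  (forall k, 0 < k -> hv C J k) ->
  forall W : bflcat X, (forall k, 0 < k -> hv t (sval W) k) ->
  hv C (sval (G W)) 1.
Proof.
move=> cC J hJ; have [N QN] := functor_bound cC.
suff main (d : nat) n (W : bflcat X) : 0 < n -> N <= n + d%:Z ->
    (forall k, 0 < k -> hv t (sval W) k) -> hv C (sval (G W)) n.
  by move=> W hW; apply: (main `|N|%N) => //; lia.
elim: d n W => [|d IH] n [W bW] n0 Nn hW; first by apply: QN => //; lia.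
have [Y [E [phi [g [h [dW gY _ [bY bE] hE]]]]]] := resolution triX hX silt bW hW.
have := tf_dist G (_ : @dist K (bflcat X) (exist _ Y bY)
    (exist _ W bW) (exist _ E bE) phi g h) => /(_ dW) dG.
apply: (homP_mid triD nx dG).
  have gG : add_gen (G (cpt_to_bfl hX T)) (G (exist _ Y bY)).
    exact: (@add_gen_fmap _ _ _ G (cpt_to_bfl hX T) (exist _ Y bY) gY).
  apply: (@hv_gen_r _ _ J (sval (G (exist _ Y bY))) C n gG).
  exact: hJ.
pose E1 : bflcat X := (exist _ E bE : bflcat X).[- 1].
have : hv C (sval (G E1)) (n + 1).
  apply: IH; [by lia|by lia|move=> k k0].
  by rewrite sval_shift; apply/(homP_shiftr nx)/hE; lia.
rewrite (homP_iso nx (n + 1) (iso_refl C)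
  (bflcat_iso (tf_shift G (exist _ E bE) (- 1)))) sval_shift.
by rewrite (homP_shiftr nx) addrK.
Qed.

End BflFunctors.

(** * The glued silting object *)

Section Main.
Variables (K : comPzRingType) (Y D X : pretri K).
Hypotheses (triY : triangulated Y) (triD : triangulated D)
  (triX : triangulated X).
Hypotheses (cgY : compactly_generated Y) (cgD : compactly_generated D)
  (cgX : compactly_generated X).
Variable R : recollement (bflcat Y) (bflcat D) (bflcat X).
Hypotheses (hY : forall M : Y, compact_ob M -> bfl M)
  (hD : forall M : D, compact_ob M -> bfl M)
  (hX : forall M : X, compact_ob M -> bfl M).
Hypothesis detD : compact_detectable D.
Variables (TX : cptcat X) (TY : cptcat Y).
Hypotheses (siltX : silting TX) (siltY : silting TY).
Let nx := @null_exact K.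

Local Notation tX := (cpt_to_bfl hX TX).
Local Notation tY := (cpt_to_bfl hY TY).
Local Notation J0 := (j_shriek R tX).
Local Notation I0 := (i_lstar R tY).
Local Notation J := (sval J0).
Local Notation I := (sval I0).

(** By adjunction [Hom(L T, M[k])] is [Hom(T, G(M)[k])], zero for large [k] since [G(M)] is bounded;
    detection turns this into compactness. *)
Lemma adj_compact (E : pretri K) (hE : forall M : E, compact_ob M -> bfl M)
    (L : trifunctor (bflcat E) (bflcat D)) (G : trifunctor (bflcat D) (bflcat E))
    (a : adjunction L G) (T : cptcat E) :
  compact_ob (sval (L (cpt_to_bfl hE T))).
Proof.
apply/(compactE detD); split=> [|M bM]; first exact: proj2_sig.
have [_ [n nG]] := proj2_sig (G (exist _ M bM)) _ (proj2_sig T).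
exists (n%:Z + 1) => k kn.
have : hv (L (cpt_to_bfl hE T)) (exist _ M bM : bflcat D) k.
  by apply/(adj_homP nx a); rewrite homP_sub; apply: nG; lia.
by rewrite homP_sub.
Qed.

Lemma compactJ : compact_ob J. Proof. exact: adj_compact (rec_adj_j R) _. Qed.
Lemma compactI : compact_ob I. Proof. exact: adj_compact (rec_adj_i' R) _. Qed.

Lemma homJ (Z : bflcat D) k : hv J (sval Z) k <-> hv tX (j_ustar R Z) k.
Proof. by rewrite -homP_sub; exact: (adj_homP nx (rec_adj_j R)). Qed.
Lemma homI (Z : bflcat D) k : hv I (sval Z) k <-> hv tY (i_shriek R Z) k.
Proof. by rewrite -homP_sub; exact: (adj_homP nx (rec_adj_i' R)). Qed.

(** Two adjunctions identify the endomorphisms of this object with maps into some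
    [i_shriek (j_lstar M)], which is zero. *)
Lemma j_ustar_i_lstar (B : bflcat Y) : is_zero (j_ustar R (i_lstar R B)).
Proof.
suff : hv (j_ustar R (i_lstar R B)) (j_ustar R (i_lstar R B)) 0 by exact.
apply/(adj_homP nx (rec_adj_j' R))/(adj_homP nx (rec_adj_i' R)).
by move=> f; apply: mor_zero; exact: rec_zero.
Qed.

Lemma hJJ k : 0 < k -> hv J J k.
Proof.
move=> k0; rewrite -homP_sub; apply/(ff_homP nx tX tX k (@rec_ff_j' _ _ _ _ R)).
by rewrite homP_sub; exact: silting_hv.
Qed.
Lemma hII k : 0 < k -> hv I I k.
Proof.
move=> k0; rewrite -homP_sub; apply/(ff_homP nx tY tY k (@rec_ff_i _ _ _ _ R)).
by rewrite homP_sub; exact: silting_hv.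
Qed.
Lemma hJI k : hv J I k.
Proof.
apply/homJ => f; apply: mor_zero; apply: zero_shift; exact: j_ustar_i_lstar.
Qed.

(** [C] is an extension of images of [j_ustar R C] and [i_ustar R C]. Compactness of these two is
    not established; instead [functor_bound] for [j_lstar] and [i_lstar], read through the
    adjunctions, bounds their maps to the aisles, and [silting_thick] puts them in the preimages of
    [P]. *)
Lemma compact_thick (P : D -> Prop) C :
  thick P -> P J -> P I -> compact_ob C -> P C.
Proof.
move=> thP PJ PI cC; pose C0 : bflcat D := exist _ C (hD cC).
have [h dC] := rec_tri' R C0; have [_ Pe _] := thP.
apply: (Pe _ _ _ _ _ _ dC).
- have [N QN] := functor_bound triX triD (j_lstar R) cgX hX siltX cC.
  have [|||b PM] := silting_thick triX hX siltX
    (Z := sval (j_ustar R C0)) (N := N) (thick_preimage triX triD (j_shriek R) thP).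
  + by exists (proj2_sig tX).
  + exact: proj2_sig.
  + move=> W bW hW n Nn.
    have := QN (exist _ W bW) hW n Nn; rewrite -[C]/(sval C0) -!homP_sub.
    rewrite -(adj_homP nx (rec_adj_j' R)) homP_sub; exact.
  by rewrite -[j_ustar R C0](bfl_eq (A := exist _ _ b)).
- have [N QN] := functor_bound triY triD (i_lstar R) cgY hY siltY cC.
  have [|||b PM] := silting_thick triY hY siltY
    (Z := sval (i_ustar R C0)) (N := N) (thick_preimage triY triD (i_lstar R) thP).
  + by exists (proj2_sig tY).
  + exact: proj2_sig.
  + move=> W bW hW n Nn.
    have := QN (exist _ W bW) hW n Nn; rewrite -[C]/(sval C0) -!homP_sub.
    rewrite -(adj_homP nx (rec_adj_i R)) homP_sub; exact.
  by rewrite -[i_ustar R C0](bfl_eq (A := exist _ _ b)).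
Qed.

Definition left_approximation (V U : D) :=
  [/\ [/\ compact_ob V, compact_ob I & compact_ob U],
      exists (f : mor V I) (g : mor I U.[1]) (h : mor U.[1] (susp V)),
        dist f g h,
      in_susp J U &
      forall W : bflcat X, gen_le0 tX W ->
        forall f : mor V (sval (j_shriek R W)).[1], f = 0].

Lemma left_approximation_exists : exists V U : D, left_approximation V U.
Proof.
(* Detection for the compact object [I] bounds the degrees of [Hom(I, J[k])] above, which gives the
   [N] of [approx_exists]. *)
have [n hn] := ((compactE detD I).1 compactI).2 J (hD compactJ).
have [|V [U [f [g [h [d cV sU hV]]]]]] := approx_exists triD detD (N := absz n)
  compactJ (hD compactJ) hJJ compactI.
  by move=> k nk; apply: hn; lia.
exists V, U; split=> //.
- split=> //; first exact: compactI.
  apply: (sU (@compact_ob K D)) => //; first exact: compactJ.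
  + exact: compact_ext.
  + by move=> A B [C [i1 [i2 [p1 [p2 [e _ _ _ _]]]]]]; exact: compact_retract e.
  + by move=> A; exact: (compact_shift D).1.
- by exists f, g, h.
- move=> W gW; suff : hv V (sval (j_shriek R W)) 1 by exact.
  apply: (functor_vanish triX triD cgX siltX cV hV).
  exact/(gen_le0P triX cgX hX siltX).
Qed.

(** * The object [T] built from an approximation triangle *)

Section Approximation.
Variables (V U T : D).
Hypothesis aVU : left_approximation V U.
Hypothesis bT : is_biproduct T J V.

Lemma homT_left Z k : hv T Z k <-> hv J Z k /\ hv V Z k.
Proof.
have [f [g [h d]]] := biproduct_dist triD bT.
have [i1 [i2 [p1 [p2 [e1 e2 _ _ _]]]]] := bT.
split=> [hT|[hJ hV]]; last exact: (homP_midl triD nx d hJ hV).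
by split; [exact: (homP_retractl nx e1) | exact: (homP_retractl nx e2)].
Qed.
Lemma homT_right Z k : hv Z J k -> hv Z V k -> hv Z T k.
Proof.
by have [f [g [h d]]] := biproduct_dist triD bT; exact: (homP_mid triD nx d).
Qed.

Lemma compactT : compact_ob T.
Proof.
have [[cV _ _] _ _ _] := aVU.
exact: (compact_biproduct_closed triD detD).2 bT compactJ cV.
Qed.

(** For [k > 0], [J[k]] is up to isomorphism the suspension of the image of [tX[k - 1]], an aisle
    object. *)
Lemma hVJ k : 0 < k -> hv V J k.
Proof.
move=> k0; have [_ _ _ oV] := aVU; pose W : bflcat X := tX.[k - 1].
have gW : gen_le0 tX W.
  apply/(gen_le0P triX cgX hX siltX) => j j0.
  rewrite sval_shift; apply/(homP_shiftr nx); apply: silting_hv => //; lia.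
have : hv V (sval (j_shriek R W)) 1 by exact: oV.
rewrite (homP_iso nx 1 (iso_refl V)
  (bflcat_iso (tf_shift (j_shriek R) tX (k - 1)))).
by rewrite sval_shift (homP_shiftr nx) addrCA subrr addr0.
Qed.

(** [Hom(U, I[j])] vanishes in all degrees because this holds for [J]. Through the triangle [V -> I
    -> U[1]], maps into [V] are then controlled by those into [I] and [U], and maps from [V] to [I]
    by those out of [I] and [U]. *)
Lemma homT_silting k : 0 < k -> hv T T k.
Proof.
have [_ [f [g [h d]]] sU _] := aVU.
have hJU j : 0 < j -> hv J U j by exact: (susp_hv_r triD sU hJJ).
have hVU j : 0 < j -> hv V U j by exact: (susp_hv_r triD sU hVJ).
have hUI j : hv U I j.
  by apply: (susp_hv_l triD (n := j) sU) => // i _; exact: hJI.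
move=> k0; apply/homT_left; split; apply: homT_right.
- exact: hJJ.
- rewrite -[k](subrK 1); apply: (homP_fibre triD nx d); last exact: hJI.
  by apply/(homP_suspr nx); rewrite subrK; exact: hJU.
- exact: hVJ.
- rewrite -[k](subrK 1); apply: (homP_fibre triD nx d).
    by apply/(homP_suspr nx); rewrite subrK; exact: hVU.
  rewrite subrK; apply: (homP_fibrel triD nx d); first exact: hII.
  exact/(homP_suspl nx).
Qed.

Lemma thickT (P : D -> Prop) : thick P -> P T -> forall C, compact_ob C -> P C.
Proof.
move=> thP PT C; have [_ [f [g [h d]]] sU _] := aVU.
have [Psh Pe Ps] := thP.
have [i1 [i2 [p1 [p2 [e1 e2 _ _ _]]]]] := bT.
have PJ : P J by exact: (thick_retract triD Ps e1).
have PV : P V by exact: (thick_retract triD Ps e2).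
apply: compact_thick => //; apply: (Pe _ _ _ _ _ _ d PV); apply: (Psh.1 U).
by apply: sU => //; exact: Psh.1.
Qed.

Local Notation T0 := (exist _ T compactT : cptcat D).
Local Notation t0 := (cpt_to_bfl hD T0).

Lemma siltingT : silting T0.
Proof.
split=> [i f i0|P [[Ps Pd] Pe Pm] PT [C cC]].
  by have hT : hv T0 T0 i; [rewrite homP_sub; exact: homT_silting | exact: hT].
have [c PC] : exists c : compact_ob C, P (exist _ C c); last first.
  by rewrite (Prop_irrelevance cC c).
apply: (thickT (P := fun M => exists c : compact_ob M, P (exist _ M c))) => //.
- split.
  + split=> M [c PM]; first by exists ((compact_shift D).1 _ c); exact: Ps PM.
    by exists ((compact_shift D).2 _ c); exact: Pd PM.
  + move=> A B E f g h d [cA PA] [cE PE].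
    have cB := compact_ext triD detD d cA cE; exists cB.
    exact: (Pe (exist _ A cA) (exist _ B cB) (exist _ E cE) f g h d PA PE).
  + move=> A B [E [i1 [i2 [p1 [p2 [e1 e2 e3 e4 e5]]]]]] [cA PA].
    have cB := compact_retract detD e1 cA; have cE := compact_retract detD e2 cA.
    exists cB; apply: Pm PA; exists (exist _ E cE), i1, i2, p1, p2.
    by split.
- by exists compactT.
Qed.

(** As [U] is in the suspended closure of [J], vanishing on [J] in degrees at most [n] passes to
    [U], and the triangle exchanges [V] for [I]. The case [n = -1] serves the right-hand class,
    [n = 0] the orthogonal that defines the left-hand one. *)
Lemma perpT (Z : bflcat D) (n : int) : (forall k, k <= n -> hv T (sval Z) k) <->
  (forall k, k <= n -> hv tX (j_ustar R Z) k) /\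
  (forall k, k <= n -> hv tY (i_shriek R Z) k).
Proof.
have [_ [f [g [h d]]] sU _] := aVU.
split=> [hT|[hx hy] k kn].
  have hJ k : k <= n -> hv J (sval Z) k by move=> /hT/homT_left[].
  split=> k kn; first exact/homJ/hJ.
  apply/homI/(homP_midl triD nx d); first by have /homT_left[] := hT k kn.
  apply/(homP_suspl nx)/(susp_hv_l triD sU hJ); lia.
have hJ j : j <= n -> hv J (sval Z) j by move=> jn; exact/homJ/hx.
apply/homT_left; split; first exact: hJ.
apply: (homP_fibrel triD nx d); first exact/homI/hy.
by apply/(homP_suspl nx); rewrite addrK; exact: (susp_hv_l triD sU hJ).
Qed.

Local Notation Dle0 := (glued_le0 R (gen_le0 tY) (gen_le0 tX)).
Local Notation Dge0 := (glued_ge0 R (gen_ge0 tY) (gen_ge0 tX)).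

Lemma gen_ge0T Z : gen_ge0 t0 Z <-> Dge0 Z.
Proof.
have E (A : pretri K) (a b : bflcat A) :
  perp_lt0 a b <-> forall k, k <= - 1 -> hv a b k.
  by split=> h k k0; apply: h; lia.
rewrite /gen_ge0 /glued_ge0 !E -perpT.
by split=> h k k0; have := h k k0; rewrite homP_sub.
Qed.

Lemma perp_le0T (Z : bflcat D) : perp_le0 t0 Z <->
  perp_le0 tX (j_ustar R Z) /\ perp_le0 tY (i_shriek R Z).
Proof.
have E (A : pretri K) (a b : bflcat A) :
  perp_le0 a b <-> forall k, k <= 0 -> hv a b k by [].
rewrite !E -perpT.
by split=> h k k0; have := h k k0; rewrite homP_sub.
Qed.

(** [Z] is tested on [j_lstar B] and [i_lstar B], from which [j_ustar] and [i_shriek] return [B], up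
    to isomorphism, or 0. Conversely the triangle [rec_tri'] reduces maps out of [Z] to maps out of
    its outer terms. *)
Lemma gen_le0T Z : gen_le0 t0 Z <-> Dle0 Z.
Proof.
split=> [gZ|[Zx Zy] B /perp_le0T[Bx By]].
  split=> B hB; change (hv (j_ustar R Z) B 0) || change (hv (i_ustar R Z) B 0).
  - apply/(adj_homP nx (rec_adj_j' R)); apply: gZ; apply/perp_le0T; split=> k k0.
      have /(homP_iso nx k (iso_refl tX)) e :=
        counit_iso (rec_adj_j' R) B (@rec_ff_j _ _ _ _ R).
      by apply/e; exact: hB.
    by move=> f; apply: mor_zero; apply: zero_shift; exact: rec_zero.
  - apply/(adj_homP nx (rec_adj_i R)); apply: gZ; apply/perp_le0T; split=> k k0.
      move=> f; apply: mor_zero; apply: zero_shift; exact: j_ustar_i_lstar.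
    apply/(adj_homP nx (rec_adj_i' R))/(ff_homP nx _ _ _ (@rec_ff_i _ _ _ _ R)).
    exact: hB.
have [h dZ] := rec_tri' R Z.
suff : hv Z B 0 by exact.
rewrite homP_sub; apply: (homP_midl triD nx dZ); rewrite -homP_sub.
  by apply/(adj_homP nx (rec_adj_j R)); exact: Zx.
by apply/(adj_homP nx (rec_adj_i' R)); exact: Zy.
Qed.

Lemma generatesT : generates t0 Dle0 Dge0.
Proof. by split; [exact: gen_le0T | exact: gen_ge0T]. Qed.

Lemma glued_tstructure : tstructure Dle0 Dge0.
Proof.
have <- : gen_le0 t0 = Dle0.
  by apply/funext => Z; apply/propext; exact: gen_le0T.
have <- : gen_ge0 t0 = Dge0.
  by apply/funext => Z; apply/propext; exact: gen_ge0T.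
exact: (silting_tstructure triD cgD hD siltingT).
Qed.

(** Each silting object lies in the common aisle and is relatively projective there, so
    [silting_add] applies in both directions. *)
Lemma generates_unique (T1 : cptcat D) : silting T1 ->
  generates (cpt_to_bfl hD T1) Dle0 Dge0 -> add_equiv T0 T1.
Proof.
move=> silt1 [gen1 _].
have same Z : gen_le0 t0 Z <-> gen_le0 (cpt_to_bfl hD T1) Z.
  by rewrite gen1; exact: gen_le0T.
have key (A B : cptcat D) : silting A -> silting B ->
    (forall Z, gen_le0 (cpt_to_bfl hD A) Z <-> gen_le0 (cpt_to_bfl hD B) Z) ->
    add_gen A B.
  move=> sA sB AB.
  apply: (silting_add triD hD sA) => [|Z bZ hZ].
    apply/(gen_le0P triD cgD hD sA (cpt_to_bfl hD B))/AB.
    by apply/(gen_le0P triD cgD hD sB) => k; exact: silting_hv.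
  by apply: (gen_le0P triD cgD hD sB (exist _ Z bZ)).1 => //;
    apply/AB/(gen_le0P triD cgD hD sA).
have inP A B := in_addP (cptcat_additive triD detD) A B (cptcat_split triD detD).
have T01 : add_gen T0 T1 by apply: key siltingT silt1 same.
have T10 : add_gen T1 T0.
  by apply: key silt1 siltingT _ => Z; apply: iff_sym.
by move=> M; rewrite !inP; split; exact: add_gen_trans.
Qed.

End Approximation.
End Main.

Theorem corollary6p12 (K : comPzRingType) (Y D X : pretri K)
  (triY : triangulated Y) (triD : triangulated D) (triX : triangulated X)
  (algY : algebraic Y) (algD : algebraic D) (algX : algebraic X)
  (cgY : compactly_generated Y) (cgD : compactly_generated D)
  (cgX : compactly_generated X)
  (R : recollement (bflcat Y) (bflcat D) (bflcat X))
  (hY : forall M : Y, compact_ob M -> bfl M)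
  (hD : forall M : D, compact_ob M -> bfl M)
  (hX : forall M : X, compact_ob M -> bfl M)
  (detD : compact_detectable D)
  (TX : cptcat X) (TY : cptcat Y) (siltX : silting TX) (siltY : silting TY) :
  let tX : bflcat X := cpt_to_bfl hX TX in
  let tY : bflcat Y := cpt_to_bfl hY TY in
  let jTX : D := sval (j_shriek R tX) in
  let iTY : D := sval (i_lstar R tY) in
  let Dle0 : bflcat D -> Prop := glued_le0 R (gen_le0 tY) (gen_le0 tX) in
  let Dge0 : bflcat D -> Prop := glued_ge0 R (gen_ge0 tY) (gen_ge0 tX) in
  let approx (Tt U : D) : Prop :=
    [/\ [/\ compact_ob Tt, compact_ob iTY & compact_ob U],
        exists (f : mor Tt iTY) (g : mor iTY U.[1]) (h : mor U.[1] (susp Tt)),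
          dist f g h,
        in_susp jTX U &
        forall W : bflcat X, gen_le0 tX W ->
          forall f : mor Tt (sval (j_shriek R W)).[1], f = 0] in
  (exists Tt U : D, approx Tt U) /\
  (forall Tt U T : D, approx Tt U -> is_biproduct T jTX Tt ->
     exists cT : compact_ob T,
       let T0 : cptcat D := exist _ T cT in
       [/\ silting T0,
           tstructure Dle0 Dge0,
           generates (cpt_to_bfl hD T0) Dle0 Dge0 &
           forall T1 : cptcat D, silting T1 ->
             generates (cpt_to_bfl hD T1) Dle0 Dge0 -> add_equiv T0 T1]).
Proof.
move=> tX tY jTX iTY Dle0 Dge0 approx; split.
  exact: (left_approximation_exists triD triX cgX R hY hD hX detD TY siltX).
move=> V U T aVU bT.
exists (compactT triD detD aVU bT) => /=.
split.
- exact: siltingT.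
- exact: (glued_tstructure triY triD triX cgY cgD cgX hD detD siltX siltY aVU bT).
- exact: generatesT.
- exact: generates_unique.
Qed.
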